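(* Let $M$ be a finite-volume orientable hyperbolic $3$-manifold such that $\pi_1(M)$ is $5$-free. Then $$\operatorname{rank}\pi_1(M)<1+157.497\cdot\operatorname{vol}(M).$$
   Context: Hyperbolic manifolds are complete and connected, i.e. of the form $\mathbf H^3/\Gamma$ with $\Gamma$ a discrete torsion-free group of isometries. $\operatorname{vol}$ denotes hyperbolic volume. The rank of a finitely generated group is the minimal cardinality of a generating set. For a positive integer $k$, a group $\Pi$ is $k$-free if each subgroup of $\Pi$ having rank at most $k$ is free. *)

(* Defs.v *)
From HB Require Import structures.
From mathcomp Require Import all_boot all_order all_algebra.
From mathcomp Require Import finmap generic_quotient.
From mathcomp Require Import all_classical all_reals all_analysis.
From mathcomp Require Import homotopy.
From mathcomp Require Import ring lra.

Set Implicit Arguments.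
Unset Strict Implicit.
Unset Printing Implicit Defensive.

Import Order.TTheory GRing.Theory Num.Theory.
Import numFieldNormedType.Exports.

Local Open Scope classical_set_scope.
Local Open Scope ring_scope.
Local Open Scope quotient_scope.

Section GroupNotions.
Context {G : groupType}.
Implicit Types (S X : set G) (w : seq (G * bool)).
Local Open Scope group_scope.

Definition is_subgroup S : Prop :=
  S 1 /\ forall x y, S x -> S y -> S (x * y^-1).

Definition generated X : set G := smallest is_subgroup X.

Definition has_rank S (n : nat) : Prop :=
  (exists2 X : {fset G}, generated [set` X] = S & #|` X| = n) /\
  (forall X : {fset G}, generated [set` X] = S -> (n <= #|` X|)%N).

(* The letter [(x, true)] stands for [x] and [(x, false)] for [x^-1]. *)
Definition word_eval w : G := \prod_(l <- w) (if l.2 then l.1 else l.1^-1).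

Definition reduced_word w : bool :=
  sorted (fun l m => ~~ ((l.1 == m.1) && (l.2 != m.2))) w.

Definition free_basis X S : Prop :=
  generated X = S /\
  forall w, (forall l, l \in w -> X l.1) -> reduced_word w ->
    word_eval w = 1 -> w = [::].

Definition is_free S : Prop := exists X, free_basis X S.

Definition k_free (k : nat) : Prop :=
  forall S n, is_subgroup S -> has_rank S n -> (n <= k)%N -> is_free S.

End GroupNotions.
Arguments k_free : clear implicits.

Section UnitInterval.
Context {R : realType}.

Definition unit_interval : Type := set_type `[0%R, 1%R : R]%classic.

HB.instance Definition _ := Choice.on unit_interval.
HB.instance Definition _ := Topological.on unit_interval.

Definition clamp_val (t : R) : R := Num.max 0 (Num.min t 1).

Lemma clamp_subproof (t : R) : clamp_val t \in (`[0%R, 1%R : R]%classic).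
Proof.
apply/mem_set; rewrite /= in_itv /= /clamp_val le_max lexx /=.
by rewrite ge_max ler01 ge_min lexx orbT.
Qed.

Definition clamp (t : R) : unit_interval :=
  exist (fun x : R => x \in _) _ (clamp_subproof t).

Definition uval (t : unit_interval) : R := \val t.

Lemma uvalE (t : R) : uval (clamp t) = clamp_val t. Proof. by []. Qed.

Lemma uval_bound (t : unit_interval) : 0 <= uval t <= 1.
Proof. by rewrite /uval; case: t => t /= ht; have := set_mem ht; rewrite /= in_itv. Qed.

Lemma clampK (t : unit_interval) : clamp (uval t) = t.
Proof.
apply: val_inj; rewrite /= /clamp_val -/(uval t).
have /andP[t0 t1] := uval_bound t.
by rewrite min_l // max_r.
Qed.

Lemma clamp_le0 (t : R) : t <= 0 -> clamp t = clamp 0.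
Proof.
move=> t0; apply: val_inj; rewrite /= /clamp_val.
by rewrite !min_l ?ler01 ?(le_trans t0) ?ler01 // max_l // maxxx.
Qed.

Lemma clamp_ge1 (t : R) : 1 <= t -> clamp t = clamp 1.
Proof. by move=> t1; apply: val_inj; rewrite /= /clamp_val min_r// minxx. Qed.

Lemma clamp01 : clamp 0 != clamp 1.
Proof.
apply/eqP => /(congr1 uval); rewrite !uvalE /clamp_val.
by rewrite minxx min_l // maxxx max_r // => /esym/eqP; rewrite oner_eq0.
Qed.

HB.instance Definition _ :=
  isBiPointed.Build unit_interval clamp01.

Lemma uval_continuous : continuous uval.
Proof. exact: initial_continuous. Qed.

Lemma clamp_continuous : continuous clamp.
Proof.
apply: continuous_comp_initial.
have h : continuous ((cst 0 : R -> R) \max ((@idfun R) \min (cst 1 : R -> R))).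
apply: max_fun_continuous; first by move=> t; exact: cvg_cst.
by apply: min_fun_continuous => t; [exact: cvg_id|exact: cvg_cst].
exact: h.
Qed.

End UnitInterval.
Arguments unit_interval : clear implicits.

Section FundamentalGroup.
Context {R : realType} {X : topologicalType} (x : X).
Local Notation I := (unit_interval R).

Definition loop : Type := {path I from x to x in X}.
HB.instance Definition _ := Choice.on loop.

Definition homotopic (p q : loop) : Prop :=
  exists H : I * I -> X,
    [/\ continuous H,
        forall t, H (zero, t) = p t /\ H (one, t) = q t &
        forall s, H (s, zero) = x /\ H (s, one) = x].

Definition loop_ext (p : loop) : R -> X := p \o clamp.

Lemma loop_ext_continuous p : continuous (loop_ext p).
Proof. by move=> t; apply: continuous_comp; [exact: clamp_continuous|exact: cts_fun]. Qed.

Lemma loop_extK p t : loop_ext p (uval t) = p t.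
Proof. by rewrite /loop_ext /= clampK. Qed.

Lemma loop_ext_le0 p t : t <= 0 -> loop_ext p t = x.
Proof. by move=> t0; rewrite /loop_ext /= clamp_le0 //; exact: path_zero. Qed.

Lemma loop_ext_ge1 p t : 1 <= t -> loop_ext p t = x.
Proof. by move=> t0; rewrite /loop_ext /= clamp_ge1 //; exact: path_one. Qed.

Local Lemma glue_continuous (U : topologicalType) (a : U -> R) (f g : U -> X) :
  continuous a -> continuous f -> continuous g ->
  (forall u, a u = 0 -> f u = g u) ->
  continuous (fun u => if a u <= 0 then f u else g u).
Proof.
move=> ca cf cg fg u; have [au0|au0|au0] := ltgtP (a u) 0.
- have : \forall v \near u, a v < 0 by apply: (ca u [set y | y < 0]); exact: lt_nbhsl.
  move=> h; rewrite /continuous_at (ltW au0).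
  apply: cvg_trans (cf u); apply: near_eq_cvg.
  by apply: filterS h => v /ltW ->.
- have : \forall v \near u, 0 < a v by apply: (ca u [set y | 0 < y]); exact: lt_nbhsr.
  move=> h; rewrite /continuous_at leNgt au0.
  apply: cvg_trans (cg u); apply: near_eq_cvg.
  by apply: filterS h => v; rewrite leNgt => ->.
- rewrite /continuous_at au0 lexx.
  move=> V /= V_; have Vf := cf u V V_.
  have Vg : nbhs u (g @^-1` V) by apply: cg; rewrite -fg.
  suff : nbhs u [set v | V (if a v <= 0 then f v else g v)] by [].
  by near=> v; rewrite /=; case: ifP => _; near: v.
Unshelve. all: by end_near.
Qed.

Lemma uval0 : uval (zero : I) = 0.
Proof. by rewrite uvalE /clamp_val min_l // maxxx. Qed.
Lemma uval1 : uval (one : I) = 1.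
Proof. by rewrite uvalE /clamp_val minxx max_r. Qed.

Local Lemma shift_continuous (b : R) : continuous (fun y : R => y - b).
Proof. by move=> y; apply: cvgB; [exact: cvg_id|exact: cvg_cst]. Qed.

Local Lemma double_continuous : continuous (fun y : R => 2 * y).
Proof. by move=> y; apply: cvgM; [exact: cvg_cst|exact: cvg_id]. Qed.

Local Lemma double_shift_continuous : continuous (fun y : R => 2 * y - 1).
Proof.
by move=> y; apply: cvgB; [exact: double_continuous|exact: cvg_cst].
Qed.

Local Lemma flip_continuous : continuous (fun y : R => 1 - y).
Proof. by move=> y; apply: cvgB; [exact: cvg_cst|exact: cvg_id]. Qed.

Local Lemma comp_uval (U : topologicalType) (g : R -> R) (h : U -> I) :
  continuous g -> continuous h -> continuous (fun u => g (uval (h u))).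
Proof.
move=> cg ch u; apply: (@continuous_comp _ _ _ (uval \o h) g); last exact: cg.
by apply: continuous_comp; [exact: ch|exact: uval_continuous].
Qed.

Local Lemma comp_clamp (U : topologicalType) (g : R -> R) (h : U -> I) :
  continuous g -> continuous h -> continuous (fun u => clamp (g (uval (h u)))).
Proof.
move=> cg ch u.
apply: (@continuous_comp _ _ _ (fun u => g (uval (h u))) clamp).
  exact: comp_uval.
exact: clamp_continuous.
Qed.

Local Lemma comp_ext (U : topologicalType) p (g : R -> R) (h : U -> I) :
  continuous g -> continuous h ->
  continuous (fun u => loop_ext p (g (uval (h u)))).
Proof.
move=> cg ch u.
apply: (@continuous_comp _ _ _ (fun u => clamp (g (uval (h u)))) p).
  exact: comp_clamp.
exact: cts_fun.
Qed.

Local Lemma id_continuous (U : topologicalType) : continuous (@idfun U).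
Proof. by move=> u; exact: cvg_id. Qed.

Local Lemma fst_continuous (U V : topologicalType) : continuous (@fst U V).
Proof. by move=> u; exact: cvg_fst. Qed.

Local Lemma snd_continuous (U V : topologicalType) : continuous (@snd U V).
Proof. by move=> u; exact: cvg_snd. Qed.

Local Lemma comp_pair (U V W Y : topologicalType) (K : V * W -> Y) (f : U -> V)
    (g : U -> W) :
  continuous K -> continuous f -> continuous g ->
  continuous (fun u => K (f u, g u)).
Proof.
move=> cK cf cg u; apply: (@continuous_comp _ _ _ (fun u => (f u, g u)) K).
  exact: cvg_pair (cf u) (cg u).
exact: cK.
Qed.

Section Concat.
Variables p q : loop.

Definition concat_fun (t : I) : X :=
  if uval t - 2^-1 <= 0 then loop_ext p (2 * uval t)
  else loop_ext q (2 * uval t - 1).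

Lemma concat_continuous : continuous concat_fun.
Proof.
apply: glue_continuous => [| | |t t2].
- exact: comp_uval (@shift_continuous _) (@id_continuous _).
- exact: comp_ext double_continuous (@id_continuous _).
- exact: comp_ext double_shift_continuous (@id_continuous _).
- by rewrite loop_ext_ge1 ?loop_ext_le0//; lra.
Qed.

Lemma concat_zero : concat_fun zero = x.
Proof. by rewrite /concat_fun uval0 ifT ?loop_ext_le0//; lra. Qed.
Lemma concat_one : concat_fun one = x.
Proof. by rewrite /concat_fun uval1 ifF ?loop_ext_ge1//; lra. Qed.

Definition concat : loop := mk_path concat_continuous concat_zero concat_one.

End Concat.


Section Reverse.
Variable p : loop.

Definition reverse_fun (t : I) : X := loop_ext p (1 - uval t).

Lemma reverse_continuous : continuous reverse_fun.
Proof.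
exact: comp_ext flip_continuous (@id_continuous _).
Qed.

Lemma reverse_zero : reverse_fun zero = x.
Proof. by rewrite /reverse_fun uval0 loop_ext_ge1// subr0. Qed.
Lemma reverse_one : reverse_fun one = x.
Proof. by rewrite /reverse_fun uval1 loop_ext_le0// subrr. Qed.

Definition reverse : loop :=
  mk_path reverse_continuous reverse_zero reverse_one.

End Reverse.

Definition const_loop : loop := cst x.

Lemma reparam_homotopic (r p q : loop) (f g : R -> R) :
  continuous f -> continuous g ->
  (forall t, p t = loop_ext r (f (uval t))) ->
  (forall t, q t = loop_ext r (g (uval t))) ->
  (f 0 <= 0 /\ g 0 <= 0) \/ (1 <= f 0 /\ 1 <= g 0) ->
  (f 1 <= 0 /\ g 1 <= 0) \/ (1 <= f 1 /\ 1 <= g 1) ->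
  homotopic p q.
Proof.
move=> cf cg pE qE e0 e1.
exists (fun st => loop_ext r
  ((1 - uval st.1) * f (uval st.2) + uval st.1 * g (uval st.2))); split.
- have c1 : continuous (fun st : I * I => uval st.1).
    exact: comp_uval (@id_continuous R) (@fst_continuous I I).
  have c3 : continuous (fun st : I * I => 1 - uval st.1).
    exact: comp_uval flip_continuous (@fst_continuous I I).
  have c4 : continuous (fun st : I * I => f (uval st.2)).
    exact: comp_uval (@snd_continuous I I).
  have c5 : continuous (fun st : I * I => g (uval st.2)).
    exact: comp_uval (@snd_continuous I I).
  move=> st; apply: (@continuous_comp _ _ _ (fun st : I * I =>
    (1 - uval st.1) * f (uval st.2) + uval st.1 * g (uval st.2))); last first.
    exact: loop_ext_continuous.
  exact: continuousD (continuousM (c3 st) (c4 st)) (continuousM (c1 st) (c5 st)).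
- move=> t /=; rewrite uval0 uval1 pE qE.
  by split; congr loop_ext; lra.
- move=> s /=; rewrite uval0 uval1; have /andP[s0 s1] := uval_bound s.
  split.
    by case: e0 => -[??]; [rewrite loop_ext_le0|rewrite loop_ext_ge1] => //; nra.
  by case: e1 => -[??]; [rewrite loop_ext_le0|rewrite loop_ext_ge1] => //; nra.
Qed.

Lemma homotopic_refl p : homotopic p p.
Proof.
apply: (@reparam_homotopic p p p idfun idfun); rewrite /=; try by move=> t; exact: cvg_id.
- by move=> t; rewrite loop_extK.
- by move=> t; rewrite loop_extK.
- by left.
- by right.
Qed.

Lemma homotopic_sym p q : homotopic p q -> homotopic q p.
Proof.
move=> [H [cH He Hx]].
have c01 : clamp (1 - uval (zero : I)) = one by rewrite uval0 subr0.
have c11 : clamp (1 - uval (one : I)) = zero by rewrite uval1 subrr.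
exists (fun st => H (clamp (1 - uval st.1), st.2)); split.
- exact: comp_pair cH (comp_clamp flip_continuous (@fst_continuous I I)) (@snd_continuous I I).
- by move=> t /=; rewrite c01 c11; have [] := He t.
- by move=> s; exact: Hx.
Qed.

Lemma homotopic_trans q p r :
  homotopic p q -> homotopic q r -> homotopic p r.
Proof.
move=> [H [cH He Hx]] [K [cK Ke Kx]].
exists (fun st => if uval st.1 - 2^-1 <= 0 then H (clamp (2 * uval st.1), st.2)
                  else K (clamp (2 * uval st.1 - 1), st.2)); split.
- apply: glue_continuous => [| | |[s t] /= s2].
  + exact: comp_uval (@shift_continuous _) (@fst_continuous I I).
  + exact: comp_pair cH (comp_clamp double_continuous (@fst_continuous I I)) (@snd_continuous I I).
  + exact: comp_pair cK (comp_clamp double_shift_continuous (@fst_continuous I I)) (@snd_continuous I I).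
  + rewrite clamp_ge1; last lra.
    rewrite [X in K (X, _)]clamp_le0; last lra.
    by rewrite (He t).2 (Ke t).1.
- move=> t /=; rewrite uval0 uval1 ifT; last lra.
  rewrite ifF; last lra.
  rewrite mulr0 mulr1 (_ : 2 - 1 = 1 :> R); last lra.
  by rewrite (He t).1 (Ke t).2.
- move=> s /=; case: ifP => _.
    by have [-> ->] := Hx (clamp (2 * uval s)).
  by have [-> ->] := Kx (clamp (2 * uval s - 1)).
Qed.

Lemma homotopic_concat p p' q q' :
  homotopic p p' -> homotopic q q' -> homotopic (concat p q) (concat p' q').
Proof.
move=> [H [cH He Hx]] [K [cK Ke Kx]].
exists (fun st => if uval st.2 - 2^-1 <= 0 then H (st.1, clamp (2 * uval st.2))
                  else K (st.1, clamp (2 * uval st.2 - 1))); split.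
- apply: glue_continuous => [| | |[s t] /= s2].
  + exact: comp_uval (@shift_continuous _) (@snd_continuous I I).
  + exact: comp_pair cH (@fst_continuous I I) (comp_clamp double_continuous (@snd_continuous I I)).
  + exact: comp_pair cK (@fst_continuous I I) (comp_clamp double_shift_continuous (@snd_continuous I I)).
  + rewrite clamp_ge1; last lra.
    rewrite [X in K (_, X)]clamp_le0; last lra.
    by rewrite (Hx s).2 (Kx s).1.
- move=> t; change ((if uval t - 2^-1 <= 0 then H (zero, clamp (2 * uval t))
      else K (zero, clamp (2 * uval t - 1))) = concat_fun p q t /\
    (if uval t - 2^-1 <= 0 then H (one, clamp (2 * uval t))
      else K (one, clamp (2 * uval t - 1))) = concat_fun p' q' t).
  by rewrite /concat_fun; case: ifP => _; [exact: He|exact: Ke].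
- move=> s; cbn [fst snd]; rewrite uval0 uval1 ifT; last lra.
  rewrite ifF; last lra.
  rewrite mulr0 mulr1 (_ : 2 - 1 = 1 :> R); last lra.
  by rewrite (Hx s).1 (Kx s).2.
Qed.

Lemma homotopic_reverse p q :
  homotopic p q -> homotopic (reverse p) (reverse q).
Proof.
move=> [H [cH He Hx]].
exists (fun st => H (st.1, clamp (1 - uval st.2))); split.
- exact: comp_pair cH (@fst_continuous I I) (comp_clamp flip_continuous (@snd_continuous I I)).
- by move=> t; exact: He.
- move=> s; cbn [fst snd]; rewrite uval0 uval1 subr0 subrr.
  by have [] := Hx s.
Qed.

Lemma clamp_valE (t : R) : (0 <= t -> t <= 1 -> clamp_val t = t).
Proof. by move=> t0 t1; rewrite /clamp_val min_l // max_r. Qed.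

Lemma concat_ext p q t : loop_ext (concat p q) t =
  if t <= 2^-1 then loop_ext p (2 * t) else loop_ext q (2 * t - 1).
Proof.
change (loop_ext (concat p q) t) with (concat_fun p q (clamp t)).
rewrite /concat_fun uvalE subr_le0.
have [t0|t0] := leP t 0.
  have -> : clamp_val t = 0 by rewrite -uvalE clamp_le0 // uvalE clamp_valE.
  rewrite ifT; last lra.
  by rewrite ifT ?loop_ext_le0//; lra.
have [t1|t1] := leP 1 t.
  have -> : clamp_val t = 1 by rewrite -uvalE clamp_ge1 // uvalE clamp_valE.
  rewrite ifF; last lra.
  by rewrite ifF ?loop_ext_ge1//; lra.
by rewrite clamp_valE //; lra.
Qed.

Lemma concatE p q t : concat p q t =
  if uval t <= 2^-1 then loop_ext p (2 * uval t) else loop_ext q (2 * uval t - 1).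
Proof. by rewrite -[LHS]loop_extK concat_ext. Qed.

Local Lemma affine_continuous (a b : R) : continuous (fun t : R => a * t + b).
Proof.
move=> t; apply: cvgD; last exact: cvg_cst.
by apply: cvgM; [exact: cvg_cst|exact: cvg_id].
Qed.

Lemma concatA p q r :
  homotopic (concat p (concat q r)) (concat (concat p q) r).
Proof.
pose f1 := fun t : R => 2^-1 * t + 0.
pose f2 := fun t : R => 1 * t + - 4^-1.
pose f3 := fun t : R => 2 * t + - 1.
apply: (@reparam_homotopic (concat (concat p q) r) _ _
   (f1 \max (f2 \max f3)) idfun).
- apply: max_fun_continuous; first exact: affine_continuous.
  by apply: max_fun_continuous; exact: affine_continuous.
- by move=> t; exact: cvg_id.
- move=> t; have /andP[] := uval_bound t; rewrite concatE.
  move: (uval t) => {}t t0 t1; rewrite !concat_ext /= /f1 /f2 /f3.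
  have [t2|t2] := leP t 2^-1; rewrite /=.
    rewrite [Num.max (1 * t + _) _]max_l; last lra.
    rewrite max_l; last lra.
    rewrite ifT; last lra.
    rewrite ifT; last lra.
    by congr loop_ext; lra.
  have [t3|t3] := leP t (3 / 4).
    rewrite ifT; last lra.
    rewrite [Num.max (1 * t + _) _]max_l; last lra.
    rewrite max_r; last lra.
    rewrite ifT; last lra.
    rewrite ifF; last lra.
    by congr loop_ext; lra.
  rewrite ifF; last lra.
  rewrite [Num.max (1 * t + _) _]max_r; last lra.
  rewrite max_r; last lra.
  rewrite ifF; last lra.
  by congr loop_ext; lra.
- by move=> t; rewrite loop_extK.
- by left; rewrite /f1 /f2 /f3 /= !ge_max; split; lra.
- by right; rewrite /f1 /f2 /f3 /= !le_max; split; lra.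
Qed.

Lemma concat1p p : homotopic (concat const_loop p) p.
Proof.
apply: (@reparam_homotopic p _ _ (fun t => 2 * t + -1) idfun).
- exact: affine_continuous.
- by move=> t; exact: cvg_id.
- move=> t; rewrite concatE; case: ifP => // t2.
  by rewrite [RHS]loop_ext_le0 //; lra.
- by move=> t; rewrite loop_extK.
- by left; split => /=; lra.
- by right; split => /=; lra.
Qed.

Lemma concatp1 p : homotopic (concat p const_loop) p.
Proof.
apply: (@reparam_homotopic p _ _ (fun t => 2 * t + 0) idfun).
- exact: affine_continuous.
- by move=> t; exact: cvg_id.
- move=> t; rewrite concatE addr0; case: ifP => // t2.
  by rewrite [RHS]loop_ext_ge1 //; lra.
- by move=> t; rewrite loop_extK.
- by left; split => /=; lra.
- by right; split => /=; lra.
Qed.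

Lemma reverse_ext p t : loop_ext (reverse p) t = loop_ext p (1 - t).
Proof.
change (loop_ext (reverse p) t) with (reverse_fun p (clamp t)).
rewrite /reverse_fun uvalE.
have [t0|t0] := leP t 0.
  have -> : clamp_val t = 0 by rewrite -uvalE clamp_le0 // uvalE clamp_valE.
  by rewrite !loop_ext_ge1 //; lra.
have [t1|t1] := leP 1 t.
  have -> : clamp_val t = 1 by rewrite -uvalE clamp_ge1 // uvalE clamp_valE.
  by rewrite !loop_ext_le0 //; lra.
by rewrite clamp_valE //; lra.
Qed.

Lemma concatpV p : homotopic (concat p (reverse p)) const_loop.
Proof.
pose f1 := fun t : R => 2 * t + 0.
pose f2 := fun t : R => (-2) * t + 2.
apply: (@reparam_homotopic p _ _ (f1 \min f2) (cst 0)).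
- by apply: min_fun_continuous; exact: affine_continuous.
- by move=> t; exact: cvg_cst.
- move=> t; rewrite concatE reverse_ext /= /f1 /f2; case: ifP => t2.
    by rewrite min_l ?addr0//; lra.
  rewrite min_r; last lra.
  by congr loop_ext; lra.
- by move=> t; rewrite loop_ext_le0.
- by left; rewrite /f1 /f2 /= !ge_min; split; lra.
- by left; rewrite /f1 /f2 /= !ge_min; split; lra.
Qed.

Lemma concatVp p : homotopic (concat (reverse p) p) const_loop.
Proof.
pose f1 := fun t : R => (-2) * t + 1.
pose f2 := fun t : R => 2 * t + -1.
apply: (@reparam_homotopic p _ _ (f1 \max f2) (cst 1)).
- by apply: max_fun_continuous; exact: affine_continuous.
- by move=> t; exact: cvg_cst.
- move=> t; rewrite concatE reverse_ext /= /f1 /f2; case: ifP => t2.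
    rewrite max_l; last lra.
    by congr loop_ext; lra.
  by rewrite max_r //; lra.
- by move=> t; rewrite loop_ext_ge1.
- by right; rewrite /f1 /f2 /= !le_max; split; lra.
- by right; rewrite /f1 /f2 /= !le_max; split; lra.
Qed.

Definition homotopicb (p q : loop) : bool := `[< homotopic p q >].

Lemma homotopicb_equiv : equiv_class_of homotopicb.
Proof.
split=> [p|p q|q p r].
- exact/asboolP/homotopic_refl.
- by apply/asboolP/asboolP; exact: homotopic_sym.
- by move=> /asboolP pq /asboolP qr; exact/asboolP/(homotopic_trans pq).
Qed.

Canonical homotopic_rel := EquivRelPack homotopicb_equiv.

Definition pi1 : Type := {eq_quot homotopicb}.
HB.instance Definition _ := Choice.on pi1.
HB.instance Definition _ := Quotient.on pi1.

Lemma pi1P (p q : loop) : homotopic p q -> \pi_pi1 p = \pi_pi1 q.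
Proof.
by move=> pq; apply: (elimT (@eqmodP _ homotopic_rel p q)); exact/asboolP.
Qed.

Lemma pi1_reprP (p : loop) : homotopic (repr (\pi_pi1 p)) p.
Proof.
apply/asboolP; apply: (introT (@eqmodP _ homotopic_rel (repr (\pi_pi1 p)) p)).
exact: (reprK (\pi_pi1 p)).
Qed.

Definition pi1_one : pi1 := \pi_pi1 const_loop.
Definition pi1_inv (a : pi1) : pi1 := \pi_pi1 (reverse (repr a)).
Definition pi1_mul (a b : pi1) : pi1 := \pi_pi1 (concat (repr a) (repr b)).

Lemma pi1_mulE p q : pi1_mul (\pi_pi1 p) (\pi_pi1 q) = \pi_pi1 (concat p q).
Proof. by apply: pi1P; apply: homotopic_concat; exact: pi1_reprP. Qed.

Lemma pi1_invE p : pi1_inv (\pi_pi1 p) = \pi_pi1 (reverse p).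
Proof. by apply: pi1P; apply: homotopic_reverse; exact: pi1_reprP. Qed.

Lemma pi1_mulA : associative pi1_mul.
Proof.
elim/quotW => p; elim/quotW => q; elim/quotW => r.
rewrite (pi1_mulE q r) (pi1_mulE p q) (pi1_mulE p (concat q r)).
by rewrite (pi1_mulE (concat p q) r); apply: pi1P; exact: concatA.
Qed.

Lemma pi1_mul1 : left_id pi1_one pi1_mul.
Proof. by elim/quotW => p; rewrite pi1_mulE; apply: pi1P; exact: concat1p. Qed.

Lemma pi1_1mul : right_id pi1_one pi1_mul.
Proof. by elim/quotW => p; rewrite pi1_mulE; apply: pi1P; exact: concatp1. Qed.

Lemma pi1_mulV : left_inverse pi1_one pi1_inv pi1_mul.
Proof.
by elim/quotW => p; rewrite pi1_invE pi1_mulE; apply: pi1P; exact: concatVp.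
Qed.

Lemma pi1_Vmul : right_inverse pi1_one pi1_inv pi1_mul.
Proof.
by elim/quotW => p; rewrite pi1_invE pi1_mulE; apply: pi1P; exact: concatpV.
Qed.

HB.instance Definition _ := isGroup.Build pi1
  pi1_mulA pi1_mul1 pi1_1mul pi1_mulV pi1_Vmul.

End FundamentalGroup.
Arguments pi1 R {X} x.

Section HyperbolicSpace.
Context {R : realType}.

(* Upper half-space model: [(x, y, t)] with [t > 0], with the Euclidean
   subspace topology. *)
Definition upper_half_space : set (R * R * R) := [set p | 0 < p.2].

Definition H3 : Type := set_type upper_half_space.
HB.instance Definition _ := Choice.on H3.
HB.instance Definition _ := Topological.on H3.

Definition coords (p : H3) : R * R * R := \val p.
Definition height (p : H3) : R := (coords p).2.

Definition euclid_dist2 (p q : R * R * R) : R :=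
  (p.1.1 - q.1.1) ^+ 2 + (p.1.2 - q.1.2) ^+ 2 + (p.2 - q.2) ^+ 2.

Definition arcosh (u : R) : R := ln (u + Num.sqrt (u ^+ 2 - 1)).

Definition hdist (p q : H3) : R :=
  arcosh (1 + euclid_dist2 (coords p) (coords q) / (2 * height p * height q)).

Definition hyp_isometry (g : H3 -> H3) : Prop :=
  bijective g /\ forall p q, hdist (g p) (g q) = hdist p q.

(* The Riemannian volume form of the metric (dx^2 + dy^2 + dt^2) / t^2. *)
Definition hvolume (A : set H3) : \bar R :=
  (\int[(lebesgue_measure \x lebesgue_measure) \x lebesgue_measure]_(p
     in coords @` A) (p.2 ^- 3)%:E)%E.

Definition hmeasurable (A : set H3) : Prop :=
  measurable (coords @` A :
    set (measurableTypeR R * measurableTypeR R * measurableTypeR R)).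

Lemma base_point_subproof : (0, 0, 1) \in upper_half_space.
Proof. by apply/mem_set; rewrite /upper_half_space /= ltr01. Qed.

Definition base_point : H3 :=
  exist (fun p => p \in upper_half_space) _ base_point_subproof.

Definition row_of_H3 (p : H3) : 'rV[R]_3 :=
  \row_i [:: (coords p).1.1; (coords p).1.2; (coords p).2]`_i.

(* The value outside the open upper half-space is irrelevant: it is only used
   to differentiate at points of positive height. *)
Definition H3_of_row (v : 'rV[R]_3) : H3 :=
  insubd base_point (v ord0 0, v ord0 1, v ord0 2%:R).

Definition jacobian_det (g : H3 -> H3) (p : H3) : R :=
  \det ('J (row_of_H3 \o g \o H3_of_row) (row_of_H3 p)).

End HyperbolicSpace.
Arguments H3 : clear implicits.

(* The manifold is [H3 / deck]. *)
Record hyperbolic_3_manifold (R : realType) := HyperbolicManifold {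
  deck :> set (H3 R -> H3 R);
  deck_isometry : forall g, deck g -> hyp_isometry g;
  deck_id : deck idfun;
  deck_comp : forall g h, deck g -> deck h -> deck (g \o h);
  deck_inv : forall g, deck g -> exists2 h, deck h & cancel g h;
  deck_discrete : forall g, deck g ->
    isolated (deck : set {compact-open, H3 R -> H3 R}) g;
  deck_torsion_free : forall g n, deck g -> (0 < n)%N ->
    iter n g =1 id -> g = idfun }.

Section Manifold.
Context {R : realType} (M : hyperbolic_3_manifold R).

Definition same_orbit (p q : H3 R) : bool :=
  `[< exists2 g, deck M g & g p = q >].

Lemma same_orbit_equiv : equiv_class_of same_orbit.
Proof.
have sym p q : same_orbit p q -> same_orbit q p.
  move=> /asboolP[g Mg <-]; apply/asboolP.
  by have [h Mh hK] := deck_inv Mg; exists h.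
split=> [p|p q|q p r].
- by apply/asboolP; exists idfun => //; exact: deck_id.
- by apply/idP/idP; exact: sym.
- move=> /asboolP[g Mg <-] /asboolP[h Mh <-]; apply/asboolP.
  by exists (h \o g) => //; exact: deck_comp.
Qed.

Canonical same_orbit_rel := EquivRelPack same_orbit_equiv.

Definition manifold_space : Type := quotient_topology {eq_quot same_orbit}.
HB.instance Definition _ := Topological.on manifold_space.
HB.instance Definition _ := Quotient.on manifold_space.

(* The orientation double cover of [H3 / deck] is the quotient of
   [H3 * bool], where [g] flips the sign iff it reverses orientation;
   hence an orientation is an equivariant continuous [o]. *)
Definition orientable : Prop :=
  exists2 o : H3 R -> bool, continuous o &
    forall g p, deck M g -> o (g p) = (o p == (0 < jacobian_det g p)).

(* The quotient map is a local isometry, so a measurable piece of the manifold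
   lifted injectively to [A] has volume [hvolume A], and the pieces exhaust the
   manifold. *)
Definition vol : \bar R :=
  ereal_sup [set hvolume A | A in
    [set A : set (H3 R) | hmeasurable A /\ set_inj A \pi_manifold_space]].

End Manifold.

(* Main.v *)
(* Write M as the quotient of hyperbolic space by the group G of deck
   transformations, which is identified with the fundamental group. Two
   noncommuting elements of G generate a free group on them; comparing the number
   of words of length n, which is about 3^n, with the volume growth of balls shows
   that two elements moving a common point by less than mu = (log 3)/2 commute.
   Hence the points moved by less than mu by some nontrivial element form disjoint
   tubes around the ends of the centralizers, and flowing out of such a tube from
   a fixed point at infinity shows that the complement X of all tubes is connected.

   Choose a maximal G-invariant mu-separated set S in X. As X is connected, the
   graph joining the points of S at distance less than 2 mu is connected, and so is
   its relative neighbourhood graph, in which an edge p q is dropped when some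
   third point of S is closer to both p and q. Consequently the finitely many
   G-orbits of edges give a generating set of G. In this graph the midpoints of two
   distinct edges are at distance at least 2 rho, where cosh (2 rho) is about
   1.0289, so that disjoint embedded balls of radius rho, each of volume more than
   1/157.497, sit at the images of these midpoints in M. The rank is therefore at
   most the number e of orbits of edges, and e < 157.497 vol M + 1. *)

From HB Require Import structures.
From mathcomp Require Import all_boot all_order all_algebra all_fingroup.
From mathcomp Require Import finmap generic_quotient.
From mathcomp Require Import all_classical all_reals all_analysis.
From mathcomp Require Import homotopy measurable_realfun.
From mathcomp Require Import zify ring lra.
Require Import Defs.

Set Implicit Arguments.
Unset Strict Implicit.
Unset Printing Implicit Defensive.

Import Order.TTheory GRing.Theory Num.Theory.

(** * Words and free groups *)

Section FreeWords.
Local Open Scope group_scope.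

(** [k_free] makes a rank-two subgroup free on some basis only. That noncommuting [a], [b] form a
    basis themselves is the Hopfian property, obtained by counting assignments into symmetric
    groups. It also makes commutation transitive on nontrivial elements, so that centralizers can
    index the tubes. Loxodromic and parabolic elements are not separated. In the hyperboloid model
    each nontrivial element has a null eigenvector [v]; along the flow from [v], the hyperbolic
    cosine of the displacement of a commuting element is a constant plus a multiple of the square of
    the flow parameter. Tubes and cusps thus share one radial structure. Connectedness of the thick
    part takes the form that a locally constant label on it is constant. The value of [mu] balances
    [3 ^ n] words against a ball volume of order [expR (2 * n * d)]. Edges must be dropped from the
    distance graph because the two diagonals of a small square share their midpoint. Ball volumes
    involve pi, which is replaced by 25/9 to keep all final comparisons rational. *)

Definition weval (T : Type) (H : groupType) (f : T -> H) (w : seq (T * bool)) : H :=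
  \prod_(l <- w) (if l.2 then f l.1 else (f l.1)^-1).

Definition wreduced (T : eqType) (w : seq (T * bool)) : bool :=
  sorted (fun l m => ~~ ((l.1 == m.1) && (l.2 != m.2))) w.

Definition winv (T : Type) (w : seq (T * bool)) : seq (T * bool) :=
  rev (map (fun l => (l.1, ~~ l.2)) w).

Definition wsubst (T U : Type) (s : T -> seq (U * bool)) (w : seq (T * bool)) :=
  flatten (map (fun l => if l.2 then s l.1 else winv (s l.1)) w).

Variable H : groupType.

Lemma weval_nil (T : Type) (f : T -> H) : weval f [::] = 1.
Proof. by rewrite /weval big_nil. Qed.

Lemma weval_cons (T : Type) (f : T -> H) l w :
  weval f (l :: w) = (if l.2 then f l.1 else (f l.1)^-1) * weval f w.
Proof. by rewrite /weval big_cons. Qed.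

Lemma weval_cat (T : Type) (f : T -> H) w1 w2 :
  weval f (w1 ++ w2) = weval f w1 * weval f w2.
Proof. by rewrite /weval big_cat. Qed.

Lemma weval_inv (T : Type) (f : T -> H) w : weval f (winv w) = (weval f w)^-1.
Proof.
elim: w => [|[x b] w IH]; first by rewrite /winv /= weval_nil invg1.
rewrite /winv /= rev_cons -cats1 weval_cat IH !weval_cons weval_nil invgM mulg1 /=.
by case: b => //=; rewrite invgK.
Qed.

Lemma weval_subst (T U : Type) (f : U -> H) (s : T -> seq (U * bool)) w :
  weval f (wsubst s w) = weval (fun x => weval f (s x)) w.
Proof.
elim: w => [|[x b] w IH]; first by rewrite /wsubst /= !weval_nil.
rewrite weval_cons /wsubst /= weval_cat -/(wsubst s w) IH.
by case: b => //=; rewrite weval_inv.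
Qed.

Lemma not_wreduced (T : eqType) (w : seq (T * bool)) : ~~ wreduced w ->
  exists w1 w2 x b, w = w1 ++ (x, b) :: (x, ~~ b) :: w2.
Proof.
case: w => [//|l w]; rewrite /wreduced /=.
elim: w l => [//|m w IH] l /=; rewrite negb_and => /orP[|].
  rewrite negbK => /andP[/eqP e1 e2]; exists [::], w, l.1, l.2 => /=.
  by move: l m e1 e2 => [x b] [y c] /= ->; case: b; case: c.
move=> /IH[w1 [w2 [x [b e]]]]; exists (l :: w1), w2, x, b.
by rewrite /= e.
Qed.

Lemma weval_cancel (T : Type) (f : T -> H) w1 w2 x b :
  weval f (w1 ++ (x, b) :: (x, ~~ b) :: w2) = weval f (w1 ++ w2).
Proof.
rewrite !weval_cat !weval_cons /=; congr (_ * _).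
by case: b; rewrite /= ?mulKVg ?mulKg.
Qed.

End FreeWords.

Section FreeGroups.
Local Open Scope group_scope.
Variable G : groupType.

Lemma word_evalE (w : seq (G * bool)) : word_eval w = weval id w.
Proof. by []. Qed.

(** Cancelling adjacent inverse letters leads from [w] to the empty word, and each cancellation is
    valid under every assignment [f]. This is the universal property of a basis, used without
    building the extended homomorphism. *)
Lemma free_basis_relation (X S : set G) (P : groupType) (f : G -> P) w :
  free_basis X S -> (forall l, l \in w -> X l.1) -> weval id w = 1 -> weval f w = 1.
Proof.
move=> [_ fX]; have [n] := ubnP (size w); elim: n w => // n IH w sw wX w1.
have [rw|/not_wreduced[w1' [w2 [x [b e]]]]] := boolP (wreduced w).
  by rewrite (fX w wX rw w1) weval_nil.
rewrite e weval_cancel; apply: IH.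
- by move: sw; rewrite e !size_cat /= !addnS !ltnS => /ltnW.
- move=> l; rewrite mem_cat => lw; apply: wX; rewrite e mem_cat !inE.
  by case/orP: lw => ->; rewrite ?orbT.
- by rewrite -(weval_cancel id w1' w2 x b) -e.
Qed.

Lemma is_subgroup1 (S : set G) : is_subgroup S -> S 1. Proof. by case. Qed.
Lemma is_subgroupV (S : set G) x : is_subgroup S -> S x -> S x^-1.
Proof. by move=> [S1 SM] Sx; rewrite -(mul1g x^-1); apply: SM. Qed.
Lemma is_subgroupM (S : set G) x y : is_subgroup S -> S x -> S y -> S (x * y).
Proof.
by move=> sS Sx Sy; rewrite -(invgK y); apply: sS.2 => //; exact: is_subgroupV.
Qed.

Lemma generated_subgroup (X : set G) : is_subgroup (generated X).
Proof.
split; first by move=> S [sS _]; exact: is_subgroup1.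
move=> x y gx gy S [sS XS]; apply: sS.2; [exact: gx|exact: gy].
Qed.

Lemma sub_generated (X : set G) : (X `<=` generated X)%classic.
Proof. by move=> x Xx S [_]; apply. Qed.

Lemma generated_min (X S : set G) : is_subgroup S -> (X `<=` S)%classic ->
  (generated X `<=` S)%classic.
Proof. by move=> sS XS x; apply. Qed.

Lemma centralizer_subgroup (a : G) : is_subgroup [set x | commute x a]%classic.
Proof.
split => [|x y /= xa ya]; first by rewrite /= /commute mul1g mulg1.
apply: commute_sym; apply: commuteM; first exact: commute_sym.
by apply: commuteV; exact: commute_sym.
Qed.

Lemma generated_commute (X : set G) :
  (forall x y, X x -> X y -> commute x y) ->
  forall x y, generated X x -> generated X y -> commute x y.
Proof.
move=> cX.
have h x y : X x -> generated X y -> commute y x.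
  by move=> Xx; apply: (generated_min (centralizer_subgroup x)) => z Xz; exact: cX.
move=> x y gx gy; move: gx; apply: (generated_min (centralizer_subgroup y)) => z Xz.
by apply: commute_sym; exact: h.
Qed.

Lemma generated_word (T : Type) (f : T -> G) (g : G) : generated (range f) g ->
  exists w : seq (T * bool), weval f w = g.
Proof.
move: g; apply: generated_min => [|_ [t _ <-]]; last first.
  by exists [:: (t, true)]; rewrite weval_cons weval_nil mulg1.
split => [|x y [u <-] [v <-]]; first by exists [::]; rewrite weval_nil.
by exists (u ++ winv v); rewrite weval_cat weval_inv.
Qed.

Lemma generated_word_in (X : set G) (g : G) : generated X g ->
  exists2 w : seq (G * bool), (forall l, l \in w -> X l.1) & weval id w = g.
Proof.
move: g; apply: generated_min => [|x Xx]; last first.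
  exists [:: (x, true)]; last by rewrite weval_cons weval_nil mulg1.
  by move=> l; rewrite inE => /eqP ->.
split => [|x y [u uX <-] [v vX <-]]; first by exists [::]; rewrite ?weval_nil.
exists (u ++ winv v); last by rewrite weval_cat weval_inv.
move=> l; rewrite mem_cat => /orP[/uX //|].
by rewrite /winv mem_rev => /mapP[m /vX Xm ->].
Qed.

Lemma rank_exists (X : {fset G}) :
  exists2 n, has_rank (generated [set` X]%classic) n & (n <= #|` X|)%N.
Proof.
pose P n := `[< exists2 Y : {fset G},
  generated [set` Y]%classic = generated [set` X]%classic & #|` Y| = n >].
have exP : exists n, P n by exists #|` X|; apply/asboolP; exists X.
have Pm := ex_minnP exP; case: Pm => n /asboolP[Y YX Yn] nmin.
exists n; last by apply: nmin; apply/asboolP; exists X.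
split; first by exists Y.
by move=> Z ZX; apply: nmin; apply/asboolP; exists Z.
Qed.

Lemma two_generated_free (k : nat) (a b : G) : (2 <= k)%N -> k_free G k ->
  exists X, free_basis X (generated [set a; b]%classic).
Proof.
move=> k2 kG; have [n hn nX] := rank_exists [fset a; b]%fset.
have e : [set` [fset a; b]%fset]%classic = [set a; b]%classic.
  apply/seteqP; split=> x /=; first by rewrite in_fset2 => /orP[] /eqP ->; [left|right].
  by move=> [->|->]; rewrite in_fset2 eqxx ?orbT.
rewrite e in hn; apply: (kG _ n) => //; first exact: generated_subgroup.
apply: leq_trans k2; apply: leq_trans nX _.
by rewrite cardfs2; case: (a != b).
Qed.

End FreeGroups.

(** An injection on [D] leaves out as many points as it misses, so the two complements can be
    matched by position in [enum]. *)
Lemma perm_extend (T : finType) (D : {set T}) (h : T -> T) :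
  {in D &, injective h} -> exists s : {perm T}, {in D, s =1 h}.
Proof.
move=> hinj.
have cD : #|~: D| = #|~: (h @: D)|.
  by apply/eqP; rewrite -(eqn_add2l #|D|) -{2}(card_in_imset hinj) !cardsC.
pose s x := if x \in D then h x else nth x (enum (~: (h @: D))) (index x (enum (~: D))).
have ix x : x \notin D -> (index x (enum (~: D)) < #|~: (h @: D)|)%N.
  by move=> xD; rewrite -cD cardE index_mem mem_enum inE.
have sD x : x \notin D -> s x \notin h @: D.
  move=> xD; rewrite /s (negbTE xD).
  have : nth x (enum (~: (h @: D))) (index x (enum (~: D))) \in enum (~: (h @: D)).
    by apply: mem_nth; rewrite -cardE; exact: ix.
  by rewrite mem_enum inE.
have sinj : injective s.
  move=> x y; have [xD|xD] := boolP (x \in D); have [yD|yD] := boolP (y \in D).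
  - by rewrite /s xD yD; exact: hinj.
  - move=> e; have := sD y yD; rewrite -e /s xD => /negP[]; exact: imset_f.
  - move=> e; have := sD x xD; rewrite e /s yD => /negP[]; exact: imset_f.
  - rewrite /s (negbTE xD) (negbTE yD) => e.
    have : index x (enum (~: D)) = index y (enum (~: D)).
      move: e; rewrite (set_nth_default y) -?cardE ?ix// => /eqP.
      by rewrite nth_uniq ?enum_uniq -?cardE ?ix// => /eqP.
    move=> /(congr1 (nth x (enum (~: D)))).
    by rewrite !nth_index ?mem_enum ?inE.
by exists (perm sinj) => x xD; rewrite permE /s xD.
Qed.

(* The prefixes of a reduced word label the vertices of a path on which each
   letter acts as a partial injection. *)
Lemma reduced_word_perm (T : eqType) (w : seq (T * bool)) : wreduced w -> w != [::] ->
  exists n, exists p : T -> 'S_n, weval p w != 1%g.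
Proof.
move=> rw w0; exists (size w).+1.
have [l0 _] : exists l : T * bool, true by case: w w0 {rw} => // l; exists l.
pose L := nth l0 w.
have redL i : (i.+1 < size w)%N -> ~~ (((L i).1 == (L i.+1).1) && ((L i).2 != (L i.+1).2)).
  by move: rw; rewrite /wreduced => /(sortedP l0) /(_ i).
(* Point [i] stands for the prefix of length [i]. A letter [(c, true)] at position [i] asks [c] to
   move [i] to [i.+1], and [(c, false)] asks it to move [i.+1] back to [i]; [D c] collects the
   points where [c] is prescribed. *)
pose D (c : T) : {set 'I_(size w).+1} :=
  [set j : 'I_(size w).+1 | ((j < size w)%N && (L j == (c, true))) || ((0 < j)%N && (L j.-1 == (c, false)))].
pose h (c : T) (j : 'I_(size w).+1) : 'I_(size w).+1 :=
  if (j < size w)%N && (L j == (c, true)) then inord j.+1 else inord j.-1.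
(* Distinct points can collide only when consecutive letters are mutually inverse, which reducedness
   excludes. *)
have hinj c : {in D c &, injective (h c)}.
  move=> i j; rewrite !inE /h.
  case: ifP => [/andP[isz /eqP Li] _|_ /= /andP[i0 /eqP Li]];
  case: ifP => [/andP[jsz /eqP Lj] _|_ /= /andP[j0 /eqP Lj]] /(congr1 val) /=.
  - by rewrite !inordK //; case=> ij; apply: val_inj.
  - have jsz := ltn_ord j.
    rewrite !inordK //; last by apply: leq_ltn_trans jsz; exact: leq_pred.
    move=> ij; have isz1 : (i.+1 < size w)%N by lia.
    by have := redL i isz1; rewrite Li ij Lj eqxx.
  - have isz := ltn_ord i.
    rewrite !inordK //; last by apply: leq_ltn_trans isz; exact: leq_pred.
    move=> ij; have jsz1 : (j.+1 < size w)%N by lia.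
    by have := redL j jsz1; rewrite Lj -ij Li eqxx.
  - have isz := ltn_ord i; have jsz := ltn_ord j.
    rewrite !inordK; [|by apply: leq_ltn_trans jsz; exact: leq_pred|by apply: leq_ltn_trans isz; exact: leq_pred].
    by move=> ij; apply: val_inj; rewrite /= -(prednK i0) -(prednK j0) ij.
have [p pE] := choice (fun c => perm_extend (hinj c)).
exists p.
(* [permM] applies the left factor first, so reading the word from the left walks along the path
   from [0]. *)
have step k : (k <= size w)%N -> weval p (take k w) ord0 = inord k.
  elim: k => [_|k IH ksz].
    by rewrite take0 weval_nil perm1; apply: val_inj; rewrite /= inordK.
  rewrite (take_nth l0) // -cats1 weval_cat permM IH ?(ltnW ksz)// weval_cons weval_nil mulg1.
  rewrite -/(L k); case Lk : (L k) => [c b] /=; case: b Lk => Lk.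
    have kk : nat_of_ord (inord k : 'I_(size w).+1) = k by rewrite inordK // ltnW.
    rewrite pE; last by rewrite !inE kk ksz Lk eqxx.
    by rewrite /h kk ksz Lk eqxx.
  have kk : nat_of_ord (inord k.+1 : 'I_(size w).+1) = k.+1 by rewrite inordK.
  apply: (canLR (permK _)); rewrite pE; last by rewrite !inE kk /= Lk eqxx orbT.
  rewrite /h kk ifF //; apply/negP => /andP[k1 /eqP Lk1].
  by have := redL k k1; rewrite Lk Lk1 eqxx.
apply/eqP => w1; have := step (size w) (leqnn _).
rewrite take_size w1 perm1 => /(congr1 val) /=; rewrite inordK // => /esym/eqP.
by rewrite size_eq0 (negbTE w0).
Qed.

Section FreePairs.
Local Open Scope group_scope.
Variable G : groupType.

(* Hopfian property: since [a, b] generate a group that is free on at least two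
   letters, every map from [a, b] to a finite group extends to a
   homomorphism, by counting. *)
Lemma noncommuting_pair_free (a b : G) (w : seq (bool * bool)) :
  k_free G 5 -> ~ commute a b -> wreduced w ->
  weval (fun c : bool => if c then a else b) w = 1 -> w = [::].
Proof.
move=> kG nab rw w1; apply/eqP/negP => /negP w0.
have [n [p pw]] := reduced_word_perm rw w0.
have [X fX] := two_generated_free a b (isT : 2 <= 5)%N kG.
set ab := fun c : bool => if c then a else b.
have rab : range ab = [set a; b]%classic.
  apply/seteqP; split=> [_ [[] _ <-]|x /= [->|->]]; [by left|by right| |].
    by exists true.
  by exists false.
have gX : generated X = generated [set a; b]%classic by case: fX.
have Hab c : generated X (ab c) by rewrite gX -rab; apply: sub_generated; exists c.
have hw c : exists u, (forall l, l \in u -> X l.1) /\ weval id u = ab c.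
  by have [u] := generated_word_in (Hab c); exists u.
have [s sab] := choice hw.
have substX u : forall l, l \in wsubst s u -> X l.1.
  elim: u => [//|[c b'] u IH] l; rewrite /wsubst /= mem_cat => /orP[|/IH //].
  case: b'; first exact: (sab c).1.
  by rewrite /winv mem_rev => /mapP[m /(sab c).1 Xm ->].
have substE u : weval id (wsubst s u) = weval ab u.
  rewrite weval_subst; have -> : (fun c => weval id (s c)) = ab => //.
  by apply: boolp.funext => c; exact: (sab c).2.
(* A basis with at most one letter would generate a commutative group. *)
have [x [y [Xx Xy xy]]] : exists x y, [/\ X x, X y & x != y].
  apply: contrapT => noxy; apply: nab.
  apply: (@generated_commute _ X) => [x y Xx Xy||].
  - have [->|xy] := eqVneq x y; first by [].
    by exfalso; apply: noxy; exists x, y.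
  - exact: (Hab true).
  - exact: (Hab false).
have wordX z : X z -> exists u, weval ab u = z.
  move=> Xz; apply: generated_word; rewrite rab -gX; exact: sub_generated.
have recover z u (P : groupType) (f : G -> P) : X z -> weval ab u = z ->
    f z = weval (fun c => weval f (s c)) u.
  move=> Xz uz.
  have : weval f (wsubst s u ++ [:: (z, false)]) = 1.
    apply: (free_basis_relation _ fX).
      move=> l; rewrite mem_cat => /orP[/substX //|].
      by rewrite inE => /eqP ->.
    by rewrite weval_cat substE uz weval_cons weval_nil mulg1 /= mulgV.
  rewrite weval_cat weval_cons weval_nil mulg1 /= weval_subst => e.
  by exact: (esym (divg1_eq e)).
(* A pair of permutations is assigned to the basis letters [x] and [y], all other letters going to
   [1]; [phi] reads off the images of [a] and [b]. As [x] and [y] are words in [a] and [b], [phi] is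
   an injective self-map of a finite set, so it reaches [(p true, p false)]. *)
pose f (st : 'S_n * 'S_n) (z : G) : 'S_n :=
  if z == x then st.1 else if z == y then st.2 else 1.
pose phi st := (weval (f st) (s true), weval (f st) (s false)).
have phi_inj : injective phi.
  move=> st st' e.
  have e' : (fun c => weval (f st) (s c)) = (fun c => weval (f st') (s c)).
    by apply: boolp.funext => c; move: e => [] e1 e2; case: c.
  have [ux uxE] := wordX x Xx; have [uy uyE] := wordX y Xy.
  have yx : y == x = false by rewrite eq_sym (negbTE xy).
  have := recover x ux _ (f st) Xx uxE; have := recover y uy _ (f st) Xy uyE.
  rewrite e' -(recover x ux _ (f st') Xx uxE) -(recover y uy _ (f st') Xy uyE).
  rewrite /f !eqxx yx => e2 e1.
  by move: st st' e1 e2 {e e'} => [? ?] [? ?] /= -> ->.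
have [psi _ psiK] := injF_bij phi_inj.
have := psiK (p true, p false); set st := psi _ => phist.
have : weval (f st) (wsubst s w) = 1.
  apply: (free_basis_relation _ fX); last by rewrite substE.
  exact: substX.
rewrite weval_subst => e; move/eqP: pw; apply; rewrite -e; congr (weval _ _).
by apply: boolp.funext => c; move: phist => [] e1 e2; case: c; rewrite ?e1 ?e2.
Qed.

Lemma weval_nseq (T : Type) (f : T -> G) x b n :
  weval f (nseq n (x, b)) = (if b then f x else (f x)^-1) ^+ n.
Proof.
elim: n => [|n IH]; first by rewrite weval_nil.
by rewrite /= weval_cons IH expgS.
Qed.

Lemma word_reduce (T : eqType) (w : seq (T * bool)) (f : T -> G) :
  exists2 u, wreduced u & weval f u = weval f w /\ {subset u <= w}.
Proof.
have [n] := ubnP (size w); elim: n w => // n IH w sw.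
have [rw|/not_wreduced[w1 [w2 [x [b e]]]]] := boolP (wreduced w); first by exists w => //; split.
have [|u ru [uE uw]] := IH (w1 ++ w2).
  by move: sw; rewrite e !size_cat /= !addnS !ltnS => /ltnW.
exists u => //; split; first by rewrite uE e weval_cancel.
move=> l /uw; rewrite e !mem_cat !inE => /orP[] ->; by rewrite ?orbT.
Qed.

Lemma wreduced_single (T : eqType) (x : T) (w : seq (T * bool)) :
  wreduced w -> (forall l, l \in w -> l.1 = x) -> exists b, w = nseq (size w) (x, b).
Proof.
case: w => [|[y b] w] rw wx; first by exists true.
have := wx (y, b) (mem_head _ _) => /= yx; subst y; exists b => /=; congr cons.
elim: w rw wx => [//|[y c] w IH] /= /andP[yc pw] wx.
have yx : y = x by apply: (wx (y, c)); rewrite !inE eqxx orbT.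
subst y; move: yc; rewrite eqxx /= negbK => /eqP bc; subst c.
congr cons; apply: IH => // l; rewrite inE => /orP[/eqP -> //|lw].
by apply: wx; rewrite !inE lw !orbT.
Qed.

(** The subgroup generated by [a] and [b] is free and commutative. Two distinct basis letters would
    have a nontrivial reduced word as commutator, so there is at most one letter, of which [a] and
    [b] are powers up to sign. *)
Lemma commuting_common_power (a b : G) : k_free G 5 -> a != 1 -> b != 1 ->
  commute a b -> exists m n (e : bool),
    [/\ (0 < m)%N, (0 < n)%N & a ^+ m = (if e then b else b^-1) ^+ n].
Proof.
move=> kG a1 b1 cab.
have [X fX] := two_generated_free a b (isT : 2 <= 5)%N kG.
have gX : generated X = generated [set a; b]%classic by case: fX.
have [x Xx] : exists x, (X `<=` [set x])%classic.
  have [[x Xx]|nX] := pselect (exists x, X x); last first.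
    by exists 1 => x Xx; exfalso; apply: nX; exists x.
  exists x => y Xy; apply: contrapT => /= /eqP yx.
  have cxy : commute x y.
    apply: (@generated_commute _ [set a; b]%classic).
    - by move=> u v [->|->] [->|->] //; exact: commute_sym.
    - by rewrite -gX; exact: sub_generated.
    - by rewrite -gX; exact: sub_generated.
  have xy : x == y = false by rewrite eq_sym; apply/negbTE.
  have : [:: (x, true); (y, true); (x, false); (y, false)] = [::].
    apply: fX.2.
    - by move=> l; rewrite !inE => /or4P[] /eqP ->.
    - by rewrite /reduced_word /= xy (eq_sym y) xy.
    - rewrite word_evalE !weval_cons weval_nil /= mulg1 mulgA cxy -mulgA.
      by rewrite mulKVg mulgV.
  by [].
have pw g : g != 1 -> generated X g -> exists i (e : bool),
    (0 < i)%N /\ g = (if e then x else x^-1) ^+ i.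
  move=> g1 /generated_word_in[w wX wg].
  have [u ru [uE uw]] := word_reduce w id.
  have [e ue] : exists e, u = nseq (size u) (x, e).
    by apply: wreduced_single => // l /uw /wX /Xx.
  have gE : g = (if e then x else x^-1) ^+ (size u).
    by rewrite -wg -uE ue weval_nseq size_nseq.
  exists (size u), e; split=> //; rewrite lt0n; apply: contra g1 => /eqP u0.
  by rewrite gE u0.
have [i [e [i0 aE]]] : exists i (e : bool), (0 < i)%N /\ a = (if e then x else x^-1) ^+ i.
  by apply: pw => //; rewrite gX; apply: sub_generated; left.
have [j [f [j0 bE]]] : exists i (e : bool), (0 < i)%N /\ b = (if e then x else x^-1) ^+ i.
  by apply: pw => //; rewrite gX; apply: sub_generated; right.
exists j, i, (e == f); split=> //; rewrite aE bE -expgM mulnC.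
by case: e {aE}; case: f {bE}; rewrite /= ?expVgn ?invgK -?expgM.
Qed.

(** Through [b], some positive power of [a] equals a power of [c] or of its inverse. This relation
    is a nonempty reduced word in [a] and [c], so these cannot be free generators. *)
Lemma commute_trans (a b c : G) : k_free G 5 -> a != 1 -> b != 1 -> c != 1 ->
  commute a b -> commute b c -> commute a c.
Proof.
move=> kG a1 b1 c1 cab cbc; apply: contrapT => nac.
have [m [n [e [m0 n0 E1]]]] := commuting_common_power kG a1 b1 cab.
have [k [l [f [k0 l0 E2]]]] := commuting_common_power kG b1 c1 cbc.
have E : a ^+ (m * k) = (if e == f then c else c^-1) ^+ (l * n).
  rewrite expgM E1 -expgM mulnC expgM.
  have -> : (if e then b else b^-1) ^+ k = ((if e == f then c else c^-1) ^+ l).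
    by move: E2; case: e {E1}; case: f => /= E2; rewrite ?expVgn E2 ?expVgn ?invgK.
  by rewrite expgM.
pose w := nseq (m * k) (true, true) ++ nseq (l * n) (false, e != f).
have : w = [::].
  apply: (@noncommuting_pair_free a c) => //.
    rewrite /w /wreduced; have : (0 < m * k)%N by rewrite muln_gt0 m0.
    case: (m * k)%N => [//|p] _ /=.
    rewrite cat_path; apply/andP; split.
      by elim: p => //= p ->.
    have -> : last (true, true) (nseq p (true, true)) = (true, true) by elim: p.
    case: (l * n)%N => [//|q] /=.
    by elim: q => //= q; rewrite !eqxx.
  rewrite weval_cat !weval_nseq /= E.
  by case: (e == f) => /=; rewrite ?expVgn ?mulgV // mulVg.
rewrite /w; have : (0 < m * k)%N by rewrite muln_gt0 m0.
by case: (m * k)%N.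
Qed.

End FreePairs.

Import numFieldNormedType.Exports.

Local Open Scope classical_set_scope.
Local Open Scope ring_scope.

(** * The hyperboloid model *)

Section Cosh.
Context {R : realType}.
Implicit Types x y u : R.

Definition ch x : R := (expR x + expR (- x)) / 2.
Definition sh x : R := (expR x - expR (- x)) / 2.

Lemma expR_mulVN x : expR x * expR (- x) = 1.
Proof. by rewrite -expRD subrr expR0. Qed.

Lemma ch2 x : ch x ^+ 2 = 1 + sh x ^+ 2.
Proof. by have := expR_mulVN x; rewrite /ch /sh; lra. Qed.

Lemma chD x y : ch (x + y) = ch x * ch y + sh x * sh y.
Proof. by rewrite /ch /sh opprD !expRD; lra. Qed.

Lemma sh_ge0 x : 0 <= x -> 0 <= sh x.
Proof.
move=> x0; rewrite /sh divr_ge0// subr_ge0 ler_expR; lra.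
Qed.

Lemma ch_gt0 x : 0 < ch x.
Proof. by rewrite /ch divr_gt0// addr_gt0 ?expR_gt0. Qed.

Lemma ch_lt x y : 0 <= x -> x < y -> ch x < ch y.
Proof.
move=> x0 xy; have e : y = x + (y - x) by ring.
have d0 : 0 < y - x by rewrite subr_gt0.
have s1 : 0 < sh (y - x).
  by rewrite /sh divr_gt0// subr_gt0 ltr_expR; lra.
have c1 : 1 < ch (y - x).
  have := ch2 (y - x); have := ch_gt0 (y - x); nra.
rewrite e chD; have := sh_ge0 x0; have := ch_gt0 x; nra.
Qed.

Lemma ch_ltE x y : 0 <= x -> 0 <= y -> (ch x < ch y) = (x < y).
Proof.
move=> x0 y0; have [xy|yx|->] := ltgtP x y; last by rewrite ltxx.
  by rewrite ch_lt.
by apply/negbTE; rewrite -leNgt; apply/ltW/ch_lt.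
Qed.

Lemma ch_leE x y : 0 <= x -> 0 <= y -> (ch x <= ch y) = (x <= y).
Proof. by move=> x0 y0; rewrite !leNgt ch_ltE. Qed.

Lemma ch0 : ch 0 = 1.
Proof. by rewrite /ch oppr0 expR0; lra. Qed.

Lemma expR_arcosh u : 1 <= u -> expR (arcosh u) = u + Num.sqrt (u ^+ 2 - 1).
Proof.
move=> u1; rewrite /arcosh lnK// posrE.
by have := sqrtr_ge0 (u ^+ 2 - 1); lra.
Qed.

Lemma arcosh_ge0 u : 1 <= u -> 0 <= arcosh u.
Proof.
move=> u1; rewrite -ler_expR expR0 expR_arcosh//.
by have := sqrtr_ge0 (u ^+ 2 - 1); lra.
Qed.

Lemma ch_arcosh u : 1 <= u -> ch (arcosh u) = u.
Proof.
move=> u1; rewrite /ch expRN expR_arcosh//.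
have s0 := sqrtr_ge0 (u ^+ 2 - 1).
have s2 : Num.sqrt (u ^+ 2 - 1) ^+ 2 = u ^+ 2 - 1 by rewrite sqr_sqrtr//; nra.
set s := Num.sqrt _ in s0 s2 *.
have -> : (u + s)^-1 = u - s.
  by apply: (mulfI (_ : u + s != 0)); [lra|rewrite divff; [lra|lra]].
lra.
Qed.

Lemma ch_eq1 x : 0 <= x -> ch x = 1 -> x = 0.
Proof.
move=> x0 c1; apply/eqP; rewrite eq_le x0 andbT -ch_leE//.
by rewrite c1 ch0.
Qed.

End Cosh.

Section Kappa.
Context {R : realType}.
Implicit Types p q r z : H3 R.

Definition kap p q : R :=
  1 + euclid_dist2 (coords p) (coords q) / (2 * height p * height q).

Lemma height_gt0 p : 0 < height p.
Proof. by rewrite /height /coords; case: p => p hp; exact: set_mem hp. Qed.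

Lemma kap_ge1 p q : 1 <= kap p q.
Proof.
rewrite /kap lerDl divr_ge0//; last by rewrite !mulr_ge0// ltW// height_gt0.
by rewrite /euclid_dist2 !addr_ge0 ?sqr_ge0.
Qed.

Lemma kapC p q : kap p q = kap q p.
Proof.
rewrite /kap mulrAC; congr (1 + _ / _); rewrite /euclid_dist2; ring.
Qed.

Lemma kapE p q : kap p q = ch (hdist p q).
Proof. by rewrite /hdist ch_arcosh// kap_ge1. Qed.

Lemma hdist_ge0 p q : 0 <= hdist p q.
Proof. by rewrite /hdist arcosh_ge0// kap_ge1. Qed.

Lemma hdistC p q : hdist p q = hdist q p.
Proof. by rewrite /hdist -!/(kap _ _) kapC. Qed.

Lemma hdist_kap p q p' q' : (hdist p q = hdist p' q') <-> (kap p q = kap p' q').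
Proof. by split => [e|e]; [rewrite !kapE e|rewrite /hdist -!/(kap _ _) e]. Qed.

Lemma hdist_lt_ch p q (r : R) : 0 <= r -> (hdist p q < r) = (kap p q < ch r).
Proof. by move=> r0; rewrite kapE ch_ltE// hdist_ge0. Qed.

Lemma hdist_le_ch p q (r : R) : 0 <= r -> (hdist p q <= r) = (kap p q <= ch r).
Proof. by move=> r0; rewrite kapE ch_leE// hdist_ge0. Qed.

Lemma H3_eq p q : coords p = coords q -> p = q.
Proof. exact: val_inj. Qed.

Lemma kap1 p q : kap p q = 1 -> p = q.
Proof.
move=> /(congr1 (fun u => u - 1)); rewrite subrr /kap addrAC subrr add0r => /eqP.
rewrite mulf_eq0 => /orP[|]; last first.
  by rewrite invr_eq0 !mulf_eq0 pnatr_eq0/= !gt_eqF// height_gt0.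
rewrite /euclid_dist2 !paddr_eq0 ?addr_ge0 ?sqr_ge0// !sqrf_eq0 !subr_eq0.
move=> /andP[/andP[/eqP e1 /eqP e2] /eqP e3]; apply: H3_eq.
by move: (coords p) (coords q) e1 e2 e3 => [[? ?] ?] [[? ?] ?] /= -> -> ->.
Qed.

Lemma kapxx p : kap p p = 1.
Proof. by rewrite /kap /euclid_dist2 !subrr expr0n/= !addr0 mul0r addr0. Qed.

Lemma hdistxx p : hdist p p = 0.
Proof. by apply: ch_eq1; rewrite ?hdist_ge0// -kapE kapxx. Qed.

Lemma hdist_eq0 p q : hdist p q = 0 -> p = q.
Proof. by move=> e; apply: kap1; rewrite kapE e ch0. Qed.

Lemma hdist_gt0 p q : p <> q -> 0 < hdist p q.
Proof.
move=> pq; rewrite lt_neqAle hdist_ge0 andbT eq_sym.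
by apply/eqP => /hdist_eq0.
Qed.

(** With the middle point at [(0, 0, 1)], the triples [A] and [B] are the spatial parts of the other
    two points on the hyperboloid, and [c - a * b] is minus their Euclidean product: the claim is
    the Cauchy-Schwarz inequality. *)
Lemma kap_triangle_alg (x y t x' y' t' a b c : R) : 0 < t -> 0 < t' ->
  a = (x ^+ 2 + y ^+ 2 + t ^+ 2 + 1) / (2 * t) ->
  b = (x' ^+ 2 + y' ^+ 2 + t' ^+ 2 + 1) / (2 * t') ->
  c = 1 + ((x - x') ^+ 2 + (y - y') ^+ 2 + (t - t') ^+ 2) / (2 * t * t') ->
  (c - a * b) ^+ 2 <= (a ^+ 2 - 1) * (b ^+ 2 - 1).
Proof.
move=> t0 t'0 aE bE cE.
pose A1 := x / t; pose A2 := y / t; pose A3 := (x ^+ 2 + y ^+ 2 + t ^+ 2 - 1) / (2 * t).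
pose B1 := x' / t'; pose B2 := y' / t'; pose B3 := (x' ^+ 2 + y' ^+ 2 + t' ^+ 2 - 1) / (2 * t').
have nt : t != 0 by rewrite gt_eqF.
have nt' : t' != 0 by rewrite gt_eqF.
have -> : a ^+ 2 - 1 = A1 ^+ 2 + A2 ^+ 2 + A3 ^+ 2 by rewrite aE /A1 /A2 /A3; field.
have -> : b ^+ 2 - 1 = B1 ^+ 2 + B2 ^+ 2 + B3 ^+ 2 by rewrite bE /B1 /B2 /B3; field.
have -> : c - a * b = - (A1 * B1 + A2 * B2 + A3 * B3).
  by rewrite aE bE cE /A1 /A2 /A3 /B1 /B2 /B3; field; rewrite nt nt'.
have := sqr_ge0 (A1 * B2 - A2 * B1); have := sqr_ge0 (A1 * B3 - A3 * B1).
have := sqr_ge0 (A2 * B3 - A3 * B2); nra.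
Qed.

Lemma kap_triangle p q r :
  (kap p r - kap p q * kap q r) ^+ 2 <= (kap p q ^+ 2 - 1) * (kap q r ^+ 2 - 1).
Proof.
have q0 := height_gt0 q; have p0 := height_gt0 p; have r0 := height_gt0 r.
have nq : height q != 0 by rewrite gt_eqF.
have np : height p != 0 by rewrite gt_eqF.
have nr : height r != 0 by rewrite gt_eqF.
apply: (@kap_triangle_alg (((coords p).1.1 - (coords q).1.1) / height q)
  (((coords p).1.2 - (coords q).1.2) / height q) (height p / height q)
  (((coords r).1.1 - (coords q).1.1) / height q)
  (((coords r).1.2 - (coords q).1.2) / height q) (height r / height q)).
- exact: divr_gt0.
- exact: divr_gt0.
- by rewrite /kap /euclid_dist2 -!/(height _); field; rewrite nq np.
- by rewrite /kap /euclid_dist2 -!/(height _); field; rewrite nq nr.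
- by rewrite /kap /euclid_dist2 -!/(height _); field; rewrite nq nr np.
Qed.

Lemma hdist_triangle q p r : hdist p r <= hdist p q + hdist q r.
Proof.
have d1 := hdist_ge0 p q; have d2 := hdist_ge0 q r.
rewrite -ch_leE ?hdist_ge0 ?addr_ge0// chD -!kapE.
have := kap_triangle p q r.
have -> : kap p q ^+ 2 - 1 = sh (hdist p q) ^+ 2 by rewrite kapE ch2; ring.
have -> : kap q r ^+ 2 - 1 = sh (hdist q r) ^+ 2 by rewrite kapE ch2; ring.
have := mulr_ge0 (sh_ge0 d1) (sh_ge0 d2).
set s := sh _ * sh _; rewrite -exprMn -/s.
move=> s0 h; rewrite -lerBlDl; apply: le_trans (ler_norm _) _.
by rewrite -(ger0_norm s0) -ler_sqr ?nnegrE// -!normrX !ger0_norm ?sqr_ge0.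
Qed.

Definition row4 (a b c d : R) : 'rV[R]_4 := \row_(i < 4) [:: a; b; c; d]`_i.

Definition i0 : 'I_4 := inord 0.
Definition i1 : 'I_4 := inord 1.
Definition i2 : 'I_4 := inord 2.
Definition i3 : 'I_4 := inord 3.

Lemma ord4P (P : 'I_4 -> Prop) : P i0 -> P i1 -> P i2 -> P i3 -> forall i, P i.
Proof.
move=> h0 h1 h2 h3 [[|[|[|[|//]]]] hi].
- by rewrite (_ : Ordinal hi = i0)//; apply: val_inj; rewrite /= inordK.
- by rewrite (_ : Ordinal hi = i1)//; apply: val_inj; rewrite /= inordK.
- by rewrite (_ : Ordinal hi = i2)//; apply: val_inj; rewrite /= inordK.
- by rewrite (_ : Ordinal hi = i3)//; apply: val_inj; rewrite /= inordK.
Qed.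

Lemma row4P (u v : 'rV[R]_4) : u ord0 i0 = v ord0 i0 -> u ord0 i1 = v ord0 i1 ->
  u ord0 i2 = v ord0 i2 -> u ord0 i3 = v ord0 i3 -> u = v.
Proof.
by move=> e0 e1 e2 e3; apply/rowP; apply: ord4P.
Qed.

Lemma row4E a b c d : (row4 a b c d ord0 i0 = a) * (row4 a b c d ord0 i1 = b) *
  (row4 a b c d ord0 i2 = c) * (row4 a b c d ord0 i3 = d).
Proof. by rewrite !mxE !inordK. Qed.

Lemma sum4 (V : nmodType) (F : 'I_4 -> V) : \sum_i F i = F i0 + F i1 + F i2 + F i3.
Proof.
rewrite !big_ord_recl big_ord0 addr0 !addrA; congr (_ + _ + _ + _); congr F;
by apply: val_inj; rewrite /= inordK.
Qed.

(* In the basis used here the Minkowski form is [a a' + b b' - (c d' + d c') / 2],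
   so that [(0, 0, 0, 1)] is the null vector of the point at infinity of the
   upper half-space. *)
Definition mform (u v : 'rV[R]_4) : R :=
  u ord0 i0 * v ord0 i0 + u ord0 i1 * v ord0 i1
  - (u ord0 i2 * v ord0 i3 + u ord0 i3 * v ord0 i2) / 2.

Lemma mformC u v : mform u v = mform v u.
Proof. by rewrite /mform; ring. Qed.
Lemma mformDl u u' v : mform (u + u') v = mform u v + mform u' v.
Proof. by rewrite /mform !mxE; ring. Qed.
Lemma mformZl a u v : mform (a *: u) v = a * mform u v.
Proof. by rewrite /mform !mxE; ring. Qed.
Lemma mformDr u v v' : mform u (v + v') = mform u v + mform u v'.
Proof. by rewrite /mform !mxE; ring. Qed.
Lemma mformZr a u v : mform u (a *: v) = a * mform u v.
Proof. by rewrite /mform !mxE; ring. Qed.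
Lemma mformNl u v : mform (- u) v = - mform u v.
Proof. by rewrite /mform !mxE; ring. Qed.
Lemma mformNr u v : mform u (- v) = - mform u v.
Proof. by rewrite /mform !mxE; ring. Qed.
Definition mformE := (mformDl, mformDr, mformNl, mformNr, mformZl, mformZr).

Lemma mform_suml (c : 'I_4 -> R) (f : 'I_4 -> 'rV[R]_4) v :
  mform (\sum_i c i *: f i) v = \sum_i c i * mform (f i) v.
Proof. by rewrite !sum4 !mformE. Qed.

(** The isometry from the upper half-space onto one sheet of the hyperboloid. Coordinate [i2] is the
    inverse height, so its positivity singles out the sheet. *)
Definition J p : 'rV[R]_4 :=
  row4 ((coords p).1.1 / height p) ((coords p).1.2 / height p) (height p)^-1
    (((coords p).1.1 ^+ 2 + (coords p).1.2 ^+ 2 + height p ^+ 2) / height p).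

Lemma mformJ p q : mform (J p) (J q) = - kap p q.
Proof.
rewrite /mform /J !row4E /kap /euclid_dist2 -!/(height _).
by field; rewrite !gt_eqF ?height_gt0.
Qed.

Lemma mformJJ p : mform (J p) (J p) = -1.
Proof. by rewrite mformJ kapxx. Qed.

Definition hyperboloid (u : 'rV[R]_4) := mform u u = -1 /\ 0 < u ord0 i2.

Lemma J_hyperboloid p : hyperboloid (J p).
Proof. by split; [exact: mformJJ|rewrite row4E invr_gt0 height_gt0]. Qed.

Definition of_J (u : 'rV[R]_4) : H3 R :=
  insubd (base_point : H3 R) (u ord0 i0 / u ord0 i2, u ord0 i1 / u ord0 i2, (u ord0 i2)^-1).

Lemma coords_of_J (u : 'rV[R]_4) : 0 < u ord0 i2 ->
  coords (of_J u) = (u ord0 i0 / u ord0 i2, u ord0 i1 / u ord0 i2, (u ord0 i2)^-1).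
Proof.
move=> u0; rewrite /coords /of_J val_insubd ifT//.
by apply/mem_set; rewrite /upper_half_space /= invr_gt0.
Qed.

Lemma of_JK u : hyperboloid u -> J (of_J u) = u.
Proof.
move=> [uu u0]; rewrite /J /height coords_of_J //=.
have n0 : u ord0 i2 != 0 by rewrite gt_eqF.
apply: row4P; rewrite row4E; try by field.
have e : u ord0 i0 ^+ 2 + u ord0 i1 ^+ 2 + 1 = u ord0 i2 * u ord0 i3.
  by move: uu; rewrite /mform; lra.
transitivity ((u ord0 i0 ^+ 2 + u ord0 i1 ^+ 2 + 1) / u ord0 i2); first by field.
by rewrite e; field.
Qed.

Lemma J_inj p q : J p = J q -> p = q.
Proof. by move=> e; apply: kap1; rewrite -[kap p q]opprK -mformJ e mformJ kapxx opprK. Qed.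

(** After multiplication by [u ord0 i2 ^+ 2] the two equations eliminate the last coordinates of [u]
    and [w], and a sum of three squares remains. *)
Lemma mform_orth_ge0 (u w : 'rV[R]_4) : hyperboloid u -> mform u w = 0 -> 0 <= mform w w.
Proof.
rewrite /hyperboloid /mform; move=> [uu u0] uw.
set a := u ord0 i0 in uu uw *; set b := u ord0 i1 in uu uw *.
set c := u ord0 i2 in uu u0 uw *; set d := u ord0 i3 in uu uw *.
rewrite -(pmulr_rge0 _ (exprn_gt0 2 u0)).
set x := w ord0 i0 in uw *; set y := w ord0 i1 in uw *.
set z := w ord0 i2 in uw *; set t := w ord0 i3 in uw *.
have -> : c ^+ 2 * (x * x + y * y - (z * t + t * z) / 2) =
  (c * x - z * a) ^+ 2 + (c * y - z * b) ^+ 2 + z ^+ 2.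
  have e1 : c * t = 2 * (a * x + b * y) - d * z by lra.
  have e2 : c * d = 1 + a ^+ 2 + b ^+ 2 by lra.
  transitivity (c ^+ 2 * (x ^+ 2 + y ^+ 2) - z * c * (c * t)); first by field.
  rewrite e1; transitivity (c ^+ 2 * (x ^+ 2 + y ^+ 2) - 2 * z * c * (a * x + b * y) + z ^+ 2 * (c * d)); first by ring.
  by rewrite e2; ring.
by rewrite !addr_ge0 ?sqr_ge0.
Qed.

Lemma mform_orth_eq0 (u w : 'rV[R]_4) : hyperboloid u -> mform u w = 0 -> mform w w = 0 -> w = 0.
Proof.
rewrite /hyperboloid /mform; move=> [uu u0] uw ww.
have n0 : u ord0 i2 != 0 by rewrite gt_eqF.
have e : (u ord0 i2 * w ord0 i0 - w ord0 i2 * u ord0 i0) ^+ 2 +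
  (u ord0 i2 * w ord0 i1 - w ord0 i2 * u ord0 i1) ^+ 2 + w ord0 i2 ^+ 2 = 0.
  rewrite -[RHS](mulr0 (u ord0 i2 ^+ 2)) -ww.
  set a := u ord0 i0 in uu uw *; set b := u ord0 i1 in uu uw *.
  set c := u ord0 i2 in uu u0 uw *; set d := u ord0 i3 in uu uw *.
  set x := w ord0 i0 in uw *; set y := w ord0 i1 in uw *.
  set z := w ord0 i2 in uw *; set t := w ord0 i3 in uw *.
  have e1 : c * t = 2 * (a * x + b * y) - d * z by lra.
  have e2 : c * d = 1 + a ^+ 2 + b ^+ 2 by lra.
  apply/esym; transitivity (c ^+ 2 * (x ^+ 2 + y ^+ 2) - z * c * (c * t)); first by field.
  rewrite e1; transitivity (c ^+ 2 * (x ^+ 2 + y ^+ 2) - 2 * z * c * (a * x + b * y) + z ^+ 2 * (c * d)); first by ring.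
  by rewrite e2; ring.
move/eqP: e; rewrite !paddr_eq0 ?addr_ge0 ?sqr_ge0// !sqrf_eq0.
move=> /andP[/andP[/eqP e1 /eqP e2] /eqP e3].
have f1 : w ord0 i0 = 0 by apply: (mulfI n0); move: e1; rewrite e3; lra.
have f2 : w ord0 i1 = 0 by apply: (mulfI n0); move: e2; rewrite e3; lra.
have f4 : w ord0 i3 = 0 by apply: (mulfI n0); move: uw; rewrite f1 f2 e3; lra.
by apply: row4P; rewrite ?f1 ?f2 ?e3 ?f4 mxE.
Qed.

End Kappa.

(** * Agreement of the metric and the Euclidean topology *)

Section Topology.
Context {R : realType}.
Implicit Types p q r z : H3 R.

Lemma coords_continuous : continuous (@coords R).
Proof. exact: initial_continuous. Qed.

Lemma height_continuous : continuous (@height R).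
Proof.
move=> z; apply: (@continuous_comp _ _ _ (@coords R) snd).
  exact: coords_continuous.
exact: cvg_snd.
Qed.

Lemma coord1_continuous : continuous (fun z : H3 R => (coords z).1.1).
Proof.
move=> z; apply: (@continuous_comp _ _ _ (fun z : H3 R => (coords z).1) fst).
  apply: (@continuous_comp _ _ _ (@coords R) fst); first exact: coords_continuous.
  exact: cvg_fst.
exact: cvg_fst.
Qed.

Lemma coord2_continuous : continuous (fun z : H3 R => (coords z).1.2).
Proof.
move=> z; apply: (@continuous_comp _ _ _ (fun z : H3 R => (coords z).1) snd).
  apply: (@continuous_comp _ _ _ (@coords R) fst); first exact: coords_continuous.
  exact: cvg_fst.
exact: cvg_snd.
Qed.

Lemma inv_height_continuous : continuous (fun z : H3 R => (height z)^-1).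
Proof.
move=> z; apply: continuousV; last exact: height_continuous.
by rewrite gt_eqF// height_gt0.
Qed.

Lemma J_continuous j : continuous (fun z : H3 R => J z ord0 j).
Proof.
have c1 := coord1_continuous; have c2 := coord2_continuous.
have c3 := height_continuous; have c4 := inv_height_continuous.
have e0 : (fun z => J z ord0 i0) = fun z => (coords z).1.1 / height z.
  by apply: funext => z; rewrite row4E.
have e1 : (fun z => J z ord0 i1) = fun z => (coords z).1.2 / height z.
  by apply: funext => z; rewrite row4E.
have e2 : (fun z => J z ord0 i2) = fun z => (height z)^-1.
  by apply: funext => z; rewrite row4E.
have e3 : (fun z => J z ord0 i3) = fun z =>
    ((coords z).1.1 ^+ 2 + (coords z).1.2 ^+ 2 + height z ^+ 2) / height z.
  by apply: funext => z; rewrite row4E.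
elim/ord4P: j; rewrite ?e0 ?e1 ?e2 ?e3 => z.
- exact: (continuousM (c1 z) (c4 z)).
- exact: (continuousM (c2 z) (c4 z)).
- exact: c4.
- exact: (continuousM (continuousD (continuousD (continuousM (c1 z) (c1 z))
    (continuousM (c2 z) (c2 z))) (continuousM (c3 z) (c3 z))) (c4 z)).
Qed.

Lemma mformJ_continuous (u : 'rV[R]_4) : continuous (fun z : H3 R => mform u (J z)).
Proof.
have k (x : R) : continuous (fun _ : H3 R => x) by exact: cst_continuous.
have c := J_continuous; move=> z.
exact: (continuousB
  (continuousD (continuousM (k (u ord0 i0) z) (c i0 z)) (continuousM (k (u ord0 i1) z) (c i1 z)))
  (continuousM (continuousD (continuousM (k (u ord0 i2) z) (c i3 z))
    (continuousM (k (u ord0 i3) z) (c i2 z))) (k 2^-1 z))).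
Qed.

Lemma nbhs_kap z e : 0 < e -> nbhs z [set w | kap z w < 1 + e].
Proof.
move=> e0; have := @mformJ_continuous (J z) z.
rewrite /continuous_at mformJ kapxx => /cvgrPdist_lt /(_ e e0).
apply: filterS => w /=; rewrite mformJ.
by rewrite ltr_norml => /andP[]; lra.
Qed.

Lemma nbhs_H3P z (U : set (H3 R)) :
  nbhs z U <-> exists2 e, 0 < e & forall w, kap z w < 1 + e -> U w.
Proof.
split; last first.
  by move=> [e e0 eU]; apply: filterS (nbhs_kap z e0) => w; exact: eU.
rewrite nbhsE => -[B [[A oA AB] Bz] BU].
have /nbhs_ballP[e /= e0 eA] : nbhs (coords z) A.
  by apply: open_nbhs_nbhs; split => //; move: Bz; rewrite -AB.
have t0 := height_gt0 z; set t := height z in t0.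
have et : 0 < e / t by rewrite divr_gt0.
pose d := Num.min 1 ((e / t) ^+ 2 / 16).
have d0 : 0 < d by rewrite lt_min ltr01 divr_gt0 ?exprn_gt0.
have d1 : d <= 1 by rewrite ge_min lexx.
have de : 8 * d * t ^+ 2 < e ^+ 2.
  have h : d <= (e / t) ^+ 2 / 16 by rewrite ge_min lexx orbT.
  have e2 : (e / t) ^+ 2 * t ^+ 2 = e ^+ 2 by rewrite -exprMn divfK ?gt_eqF.
  have : d * t ^+ 2 <= (e / t) ^+ 2 / 16 * t ^+ 2 by rewrite ler_wpM2r ?sqr_ge0.
  have : 0 < e ^+ 2 by rewrite exprn_gt0.
  lra.
exists d => // w; rewrite ltrD2l => kw; apply: BU.
have s0 := height_gt0 w; set s := height w in s0.
rewrite ltr_pdivrMr in kw; last by rewrite !mulr_gt0.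
have [h1 h2 h3] : [/\ ((coords z).1.1 - (coords w).1.1) ^+ 2 < e ^+ 2,
    ((coords z).1.2 - (coords w).1.2) ^+ 2 < e ^+ 2 & (t - s) ^+ 2 < e ^+ 2].
  move: kw; rewrite /euclid_dist2 -!/(height _) -/t -/s.
  have := sqr_ge0 ((coords z).1.1 - (coords w).1.1).
  have := sqr_ge0 ((coords z).1.2 - (coords w).1.2).
  set X := _ ^+ 2; set Y := _ ^+ 2 => Y0 X0 kw.
  (* The bound [d <= 1] first controls the ratio of heights; then one estimate of [d * (2 * t * s)]
     bounds all three coordinate differences. *)
  have st : s <= 4 * t.
    rewrite leNgt; apply/negP => ts.
    have : (t - s) ^+ 2 < 2 * (t * s) by nra.
    nra.
  have tt : d * (2 * t * s) <= 8 * d * t ^+ 2.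
    have : t * s <= 4 * t ^+ 2 by nra.
    nra.
  have := sqr_ge0 (t - s); split; lra.
have nrm x : x ^+ 2 < e ^+ 2 -> `|x| < e.
  by move=> h; rewrite -ltr_sqr ?nnegrE ?(ltW e0)// real_normK ?num_real.
rewrite -AB; apply: eA; split; first split; exact: nrm.
Qed.

Lemma nbhs_hdist z e : 0 < e -> nbhs z [set w | hdist z w < e].
Proof.
move=> e0; apply/nbhs_H3P; exists (ch e - 1).
  by rewrite subr_gt0 -(@ch0 R) ch_lt.
by move=> w /=; rewrite hdist_lt_ch ?ltW//; lra.
Qed.

Lemma nbhs_hdistP z (U : set (H3 R)) :
  nbhs z U <-> exists2 e, 0 < e & forall w, hdist z w < e -> U w.
Proof.
split; last by move=> [e e0 eU]; apply: filterS (nbhs_hdist z e0) => w; exact: eU.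
move=> /nbhs_H3P[e e0 eU]; exists (arcosh (1 + e)).
  rewrite lt_neqAle arcosh_ge0 ?andbT; last lra.
  by apply/eqP => h; have := ch_arcosh (_ : 1 <= 1 + e); rewrite -h ch0; lra.
move=> w; rewrite hdist_lt_ch ?arcosh_ge0; try lra.
by rewrite ch_arcosh; [exact: eU|lra].
Qed.

Lemma isometry_continuous (g : H3 R -> H3 R) :
  (forall p q, hdist (g p) (g q) = hdist p q) -> continuous g.
Proof.
move=> ig z U /nbhs_hdistP[e e0 eU]; apply/nbhs_hdistP; exists e => // w zw.
by apply: eU; rewrite ig.
Qed.

End Topology.

(** * Isometries as matrices preserving the Minkowski form *)

Section Isometries.
Context {R : realType}.
Implicit Types p q r z : H3 R.
Implicit Types g h : H3 R -> H3 R.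

Definition preserves_dist g := forall p q, hdist (g p) (g q) = hdist p q.

Lemma preserves_kap g p q : preserves_dist g -> kap (g p) (g q) = kap p q.
Proof. by move=> ig; apply/hdist_kap. Qed.

(** Four points of the hyperboloid forming a basis of the ambient space; the rows of [frame_coef]
    express the standard basis in them. *)
Definition frame_vec (i : 'I_4) : 'rV[R]_4 :=
  nth 0 [:: row4 0 0 1 1; row4 0 0 2^-1 2; row4 1 0 1 2; row4 0 1 1 2] i.

Definition frame (i : 'I_4) : H3 R := of_J (frame_vec i).

Definition frame_coef : 'M[R]_4 := \matrix_(i < 4)
  nth 0 [:: row4 (- 2/3) (- 2/3) 1 0; row4 (- 2/3) (- 2/3) 0 1;
            row4 (4/3) (- 2/3) 0 0; row4 (- 1/3) (2/3) 0 0] i.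

Lemma J_frame i : J (frame i) = frame_vec i.
Proof.
by apply: of_JK; elim/ord4P: i; rewrite /frame_vec inordK //=; split;
  rewrite /mform ?row4E //; lra.
Qed.

Lemma frame_decomposition (u : 'rV[R]_4) :
  u = \sum_i (u *m frame_coef) ord0 i *: J (frame i).
Proof.
rewrite sum4 !J_frame !mxE !sum4.
by apply: row4P; rewrite !mxE /frame_vec !inordK //= !row4E; field.
Qed.

Definition lin g : 'M[R]_4 := frame_coef *m \matrix_(i < 4) J (g (frame i)).

Lemma lin_sum g (u : 'rV[R]_4) :
  u *m lin g = \sum_i (u *m frame_coef) ord0 i *: J (g (frame i)).
Proof. by rewrite mulmxA mulmx_sum_row; apply: eq_bigr => i _; rewrite rowK. Qed.

Lemma lin_mform g (u v : 'rV[R]_4) : preserves_dist g ->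
  mform (u *m lin g) (v *m lin g) = mform u v.
Proof.
move=> ig; rewrite !lin_sum {2}(frame_decomposition u) {2}(frame_decomposition v).
rewrite !mform_suml; apply: eq_bigr => i _; congr (_ * _).
rewrite mformC [RHS]mformC !mform_suml; apply: eq_bigr => j _; congr (_ * _).
by rewrite !mformJ preserves_kap.
Qed.

(** The difference of the two sides is orthogonal to every [J (g p)], and both sides are
    combinations of such vectors. It is therefore null and orthogonal to the timelike [J (g z)],
    hence zero. *)
Lemma lin_J g z : preserves_dist g -> J z *m lin g = J (g z).
Proof.
move=> ig; apply/eqP; rewrite -subr_eq0; apply/eqP.
have orth p : mform (J (g p)) (J z *m lin g - J (g z)) = 0.
  rewrite mformC mformDl mformNl lin_sum mform_suml.
  rewrite (eq_bigr (fun i => (J z *m frame_coef) ord0 i * mform (J (frame i)) (J p))).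
    by rewrite -mform_suml -frame_decomposition !mformJ preserves_kap// subrr.
  by move=> i _; rewrite !mformJ preserves_kap.
apply: (mform_orth_eq0 (J_hyperboloid (g z))) => //.
set w := J z *m lin g - J (g z) in orth *.
have -> : mform w w = mform (J z *m lin g) w - mform (J (g z)) w.
  by rewrite -mformNl -mformDl.
rewrite orth subr0 lin_sum mform_suml big1// => i _.
by rewrite orth mulr0.
Qed.

Lemma lin_comp g h : preserves_dist g -> lin (g \o h) = lin h *m lin g.
Proof.
move=> ig; rewrite /lin -mulmxA; congr (_ *m _); apply/row_matrixP => i.
by rewrite row_mul !rowK -/(lin g) lin_J.
Qed.

Lemma kap_mformB p q : mform (J p - J q) (J p - J q) = 2 * (kap p q - 1).
Proof. by rewrite !mformE !mformJ !kapxx (kapC q p); ring. Qed.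

Lemma J_bound z (r : R) j : kap (frame i0) z <= r -> `|J z ord0 j| <= 2 * r.
Proof.
have [] := J_hyperboloid z.
have : mform (J (frame i0)) (J z) = - kap (frame i0) z by exact: mformJ.
rewrite J_frame /frame_vec inordK //= /mform !(row4E 0 0 1 1) => e1 e2 u0 kr.
have r1 : 1 <= r := le_trans (kap_ge1 _ _) kr.
set a := J z ord0 i0 in e1 e2 *; set b := J z ord0 i1 in e1 e2 *.
set c := J z ord0 i2 in e1 e2 u0 *; set d := J z ord0 i3 in e1 e2 *.
have d0 : 0 < d.
  have : 0 < c * d by have := sqr_ge0 a; have := sqr_ge0 b; lra.
  by rewrite pmulr_rgt0.
have cd : c + d <= 2 * r by lra.
have sq x : x ^+ 2 <= (2 * r) ^+ 2 -> `|x| <= 2 * r.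
  by move=> h; rewrite -ler_sqr ?nnegrE ?normr_ge0// ?real_normK ?num_real//; lra.
have := sqr_ge0 a; have := sqr_ge0 b => b2 a2.
have cdr : c * d <= (2 * r) ^+ 2 by nra.
by elim/ord4P: j; apply: sq; rewrite -/a -/b -/c -/d; nra.
Qed.

End Isometries.

(** * Proper discontinuity and freeness of the deck action *)

Section ProperDiscontinuity.
Context {R : realType}.
Implicit Types p q z : H3 R.

Lemma finite_set_inj (T U : Type) (A : set T) (B : set U) (f : T -> U) :
  finite_set B -> (forall x, A x -> B (f x)) ->
  (forall x y, A x -> A y -> f x = f y -> x = y) -> finite_set A.
Proof.
move=> fB AB fi; have [x0|nA] := pselect (exists x, A x); last first.
  by apply: sub_finite_set (finite_set0 T) => x Ax; apply: nA; exists x.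
have ex y : exists u : T, (exists2 x, A x & f x = y) -> A u /\ f u = y.
  have [[x Ax xy]|ny] := pselect (exists2 x, A x & f x = y); first by exists x.
  by have [x _] := x0; exists x.
have [h hE] := choice ex.
apply: sub_finite_set (finite_image h fB) => x Ax; exists (f x); first exact: AB.
have [Ah fh] := hE (f x) (ex_intro2 _ _ x Ax erefl).
exact: fi.
Qed.

Lemma frame_isometry_close z e : 0 < e -> exists2 d, 0 < d &
  forall g : H3 R -> H3 R, preserves_dist g ->
    (forall i, kap (frame i) (g (frame i)) < 1 + d) -> hdist z (g z) < e.
Proof.
move=> e0; pose c i := `|(J z *m frame_coef) ord0 i|.
pose C := 1 + \sum_i c i.
have C0 : 0 < C by rewrite ltr_pwDl// sumr_ge0// => i _; rewrite normr_ge0.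
have che : 0 < ch e - 1 by rewrite subr_gt0 -(@ch0 R) ch_lt.
have [x x0 xe] : exists2 x : R, 0 < x & 3 * (C * x) ^+ 2 < 2 * (ch e - 1).
  pose y := Num.min 1 ((ch e - 1) / 2).
  have y0 : 0 < y by rewrite lt_min ltr01 divr_gt0.
  have y1 : y <= 1 by rewrite ge_min lexx.
  have y2 : y <= (ch e - 1) / 2 by rewrite ge_min lexx orbT.
  exists (y / C); first by rewrite divr_gt0.
  by have -> : C * (y / C) = y by [rewrite mulrCA divff ?mulr1// gt_eqF]; nra.
have [d d0 dx] : exists2 d, 0 < d & forall i w, kap (frame i) w < 1 + d ->
    forall j, `|J (frame i) ord0 j - J w ord0 j| < x.
  have hi i : exists d, 0 < d /\ forall w, kap (frame i) w < 1 + d ->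
      forall j, `|J (frame i) ord0 j - J w ord0 j| < x.
    have : nbhs (frame i) [set w | forall j, `|J (frame i) ord0 j - J w ord0 j| < x].
      have ent j : nbhs (frame i) [set w | `|J (frame i) ord0 j - J w ord0 j| < x].
        by have := @J_continuous R j (frame i); move=> /cvgrPdist_lt /(_ x x0).
      apply: filterS (filterI (filterI (ent i0) (ent i1)) (filterI (ent i2) (ent i3))).
      by move=> w [[w0 w1] [w2 w3]]; exact: ord4P.
    by move=> /nbhs_H3P[d d0 h]; exists d.
  have [d hd] := choice hi.
  exists (\big[Num.min/1]_i d i).
    by apply: lt_bigmin => // i _; exact: (hd i).1.
  move=> i w kw; apply: (hd i).2; apply: lt_le_trans kw _.
  by rewrite lerD2l; exact: bigmin_le_cond.
exists d => // g ig gd; rewrite hdist_lt_ch ?ltW//.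
set w := J (g z) - J z.
have wj j : `|w ord0 j| <= C * x.
  have -> : w = \sum_i (J z *m frame_coef) ord0 i *: (J (g (frame i)) - J (frame i)).
    rewrite /w -lin_J// lin_sum {2}(frame_decomposition (J z)) -sumrB.
    by apply: eq_bigr => i _; rewrite scalerBr.
  rewrite summxE; apply: le_trans (ler_norm_sum _ _ _) _.
  apply: (@le_trans _ _ (\sum_i c i * x)); last first.
    by rewrite -mulr_suml ler_wpM2r ?(ltW x0)// /C lerDr ler01.
  apply: ler_sum => i _; rewrite mxE [X in _ * X]mxE [X in _ + X]mxE normrM.
  rewrite ler_wpM2l ?normr_ge0//.
  by rewrite distrC ltW// dx.
have := kap_mformB (g z) z; rewrite -/w => kw.
have : mform w w <= 3 * (C * x) ^+ 2.
  rewrite /mform; have Cx : 0 <= C * x by rewrite mulr_ge0// ltW.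
  have := wj i0; have := wj i1; have := wj i2; have := wj i3.
  rewrite !ler_norml => /andP[? ?] /andP[? ?] /andP[? ?] /andP[? ?]; nra.
by rewrite kw (kapC (g z)); lra.
Qed.

(** Isometries are equicontinuous: closeness to the identity at a point spreads to a neighbourhood,
    and compactness of [K] makes it uniform. *)
Lemma isometries_near_id (F : set_system (H3 R -> H3 R)) : Filter F ->
  (\forall g \near F, preserves_dist g) ->
  (forall d, 0 < d -> \forall g \near F, forall i, kap (frame i) (g (frame i)) < 1 + d) ->
  (F : set_system {compact-open, H3 R -> H3 R}) --> (idfun : {compact-open, H3 R -> H3 R}).
Proof.
move=> FF Fi Fd; apply/compact_open_cvgP => K O cK oO KO.
have : \near F, K `<=` (fun z => O ((F : H3 R -> H3 R) z)).
  apply: ((compact_near_coveringP K).1 cK _ F (fun g z => O (g z)) FF) => z Kz.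
  have /nbhs_hdistP[e e0 eO] : nbhs z O.
    by apply: open_nbhs_nbhs; split => //; apply: KO; exists z.
  have e2 : 0 < e / 2 by rewrite divr_gt0.
  have [d d0 dz] := frame_isometry_close z e2.
  exists ([set w | hdist z w < e / 2],
    [set g | preserves_dist g /\ forall i, kap (frame i) (g (frame i)) < 1 + d]).
    split => /=; first exact: nbhs_hdist.
    exact: filterI Fi (Fd d d0).
  move=> [w g] /= [zw [ig gd]]; apply: eO.
  apply: le_lt_trans (hdist_triangle (g z) _ _) _.
  by rewrite ig; have := dz g ig gd; lra.
by apply: filterS => g gO _ [z Kz <-]; exact: gO.
Qed.

Variable M : hyperbolic_3_manifold R.

Lemma deck_preserves_dist g : deck M g -> preserves_dist g.
Proof. by move=> /deck_isometry[]. Qed.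

(** Otherwise the nontrivial deck elements that nearly fix the frame generate a proper filter
    converging to [idfun] in the compact-open topology, against discreteness. *)
Lemma deck_moves_frame : exists2 d, 0 < d &
  forall g, deck M g -> (forall i, kap (frame i) (g (frame i)) < 1 + d) -> g = idfun.
Proof.
apply: contrapT => nd.
pose B d := [set g | [/\ deck M g, g <> idfun & forall i, kap (frame i) (g (frame i)) < 1 + d]].
have B0 d : 0 < d -> B d !=set0.
  move=> d0; apply: contrapT => Bd; apply: nd; exists d => // g Mg gd.
  by apply: contrapT => gid; apply: Bd; exists g.
pose F := filter_from [set d : R | 0 < d] B.
have FF : ProperFilter F.
  apply: filter_from_proper => //; apply: filter_from_filter; first by exists 1 => /=.
  move=> d d' d0 d'0; exists (Num.min d d') => /=; first by rewrite lt_min; apply/andP.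
  move=> g [Mg gid gd]; split; split => // i; apply: lt_le_trans (gd i) _;
    by rewrite lerD2l ge_min lexx ?orbT.
have cF : (F : set_system {compact-open, H3 R -> H3 R}) --> (idfun : {compact-open, H3 R -> H3 R}).
  apply: isometries_near_id.
    by exists 1 => //= g [Mg _ _]; exact: deck_preserves_dist.
  by move=> d d0; exists d => //= g [].
have [_ [V Vid VM]] := deck_discrete (deck_id M).
have [d /= d0 dV] : F V by exact: cF.
have [g Bg] := B0 d d0; have [Mg gid _] := Bg.
by apply: gid; have : [set (idfun : {compact-open, H3 R -> H3 R})] g by rewrite -VM; split => //; exact: dV.
Qed.

(** Pigeonhole: the images of the frame stay in a bounded region, cut into small boxes by [f]. Two
    elements with the same boxes differ by one that nearly fixes the frame, hence by the
    identity. *)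
Lemma deck_finite z (r : R) : finite_set [set g | deck M g /\ hdist z (g z) <= r].
Proof.
have [d d0 dM] := deck_moves_frame.
set A := [set g | _].
have s0 : forall i, hdist (frame i0) z + `|r| + hdist z (frame i) <= \sum_i (hdist (frame i0) z + `|r| + hdist z (frame i)).
  by move=> i; rewrite (bigD1 i)//= lerDl sumr_ge0// => j _; rewrite !addr_ge0 ?hdist_ge0.
set S := \sum_i _ in s0.
have S0 : 0 <= S by apply: sumr_ge0 => i _; rewrite !addr_ge0 ?hdist_ge0.
pose b := 2 * ch S.
have Jb g : A g -> forall i j, `|J (g (frame i)) ord0 j| <= b.
  move=> [Mg gr] i j; apply: J_bound; rewrite -hdist_le_ch//.
  apply: le_trans (s0 i); apply: le_trans (hdist_triangle z _ _) _.
  rewrite -addrA lerD2l; apply: le_trans (hdist_triangle (g z) _ _) _.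
  by rewrite (deck_preserves_dist Mg) lerD2r (le_trans gr)// ler_norm.
have b0 : 0 <= b by rewrite mulr_ge0// ltW// ch_gt0.
(* For boxes of side [K^-1], the form of the difference of two image vectors is at most
   [3 * K^-1 ^+ 2], which this choice puts below the gap [d]. *)
have [K K0 md] : exists2 K : R, 0 < K & 3 < d * K ^+ 2.
  have h1 : 3 / d * d = 3 by rewrite divfK// gt_eqF.
  have h2 : 0 < 3 / d by rewrite divr_gt0.
  exists (3 / d + 1); [lra|nra].
pose N := Num.truncn (K * (b + b)).
pose f (g : H3 R -> H3 R) : {ffun 'I_4 * 'I_4 -> 'I_N.+1} :=
  [ffun ij => inord (Num.truncn (K * (J (g (frame ij.1)) ord0 ij.2 + b)))].
apply: (@finite_set_inj _ _ _ _ f (@finite_finset {ffun 'I_4 * 'I_4 -> 'I_N.+1} setT)) => //.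
move=> g h Ag Ah fgh.
have [k Mk hk] := deck_inv Ah.1.
have Mkg : deck M (k \o g) by apply: deck_comp => //; exact: Ag.1.
have ik := deck_preserves_dist Mk.
have kh : k \o g = idfun.
  apply: dM => // i; have -> : kap (frame i) ((k \o g) (frame i)) = kap (h (frame i)) (g (frame i)).
    by rewrite -(preserves_kap (h (frame i)) (g (frame i)) ik) hk.
  have close j : `|J (h (frame i)) ord0 j - J (g (frame i)) ord0 j| <= K^-1.
    move/ffunP: fgh => /(_ (i, j)); rewrite !ffunE /= => /(congr1 val) /=.
    have := Jb g Ag i j; have := Jb h Ah i j; rewrite !ler_norml.
    set x := J (h _) ord0 j; set y := J (g _) ord0 j => /andP[x1 x2] /andP[y1 y2].
    have x0 : 0 <= K * (x + b) by rewrite mulr_ge0//; lra.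
    have y0 : 0 <= K * (y + b) by rewrite mulr_ge0//; lra.
    rewrite !inordK ?ltnS; last 2 first.
    - by apply: le_truncn; rewrite ler_pM2l //; lra.
    - by apply: le_truncn; rewrite ler_pM2l //; lra.
    have /andP[] := truncn_itv x0; have /andP[] := truncn_itv y0 => /[swap].
    move=> q1 q2 q3 q4 e; rewrite e in q1 q2.
    rewrite -natr1 in q2 q4.
    have e1 : K * (x - y) <= 1 by lra.
    have e2 : -1 <= K * (x - y) by lra.
    apply/andP; split; rewrite -(ler_pM2l K0) ?mulrN mulfV ?gt_eqF//.
  have := kap_mformB (h (frame i)) (g (frame i)).
  have : mform (J (h (frame i)) - J (g (frame i))) (J (h (frame i)) - J (g (frame i))) <= 3 * K^-1 ^+ 2.
    have m0 : (0 : R) <= K^-1 by rewrite invr_ge0 ltW.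
    have := close i0; have := close i1; have := close i2; have := close i3.
    rewrite /mform; rewrite !mxE !ler_norml => /andP[? ?] /andP[? ?] /andP[? ?] /andP[? ?]; nra.
  have : 3 * K^-1 ^+ 2 < d by rewrite exprVn ltr_pdivrMr ?exprn_gt0 .
  lra.
apply: funext => z'; have := hk (h z').
have hinj : injective k by move=> u v uv; have := ik u v; rewrite uv hdistxx => /esym/hdist_eq0.
by move=> _; apply: hinj; rewrite hk -[RHS]/(idfun z') -kh.
Qed.

(** All powers of [g] fix [z], and [deck_finite] with radius [0] leaves finitely many of them; so
    [g] has finite order. *)
Lemma deck_free g z : deck M g -> g z = z -> g = idfun.
Proof.
move=> Mg gz.
have itM n : deck M (iter n g).
  elim: n => [|n IH]; first exact: deck_id.
  by have := deck_comp Mg IH.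
have itz n : iter n g z = z by elim: n => //= n ->.
have [n [m [nm e]]] : exists n m, (n < m)%N /\ iter n g = iter m g.
  apply: contrapT => nope; apply: infinite_nat.
  apply: (finite_set_inj (deck_finite z 0) (f := fun n => iter n g)).
    by move=> n _ /=; split; [exact: itM|rewrite itz hdistxx].
  move=> n m _ _ e; have [nm|mn|//] := ltngtP n m; exfalso; apply: nope.
    by exists n, m.
  by exists m, n.
apply: (@deck_torsion_free _ M g (m - n)) => //; first by rewrite subn_gt0.
move=> w; have [h Mh hK] := deck_inv (itM n).
have ih := deck_preserves_dist Mh.
have inj : injective (iter n g).
  by move=> u v uv; have := hK u; rewrite uv hK.
by apply: inj; rewrite -iterD subnKC ?(ltnW nm)// -e.
Qed.

End ProperDiscontinuity.

(** * The action of the fundamental group on hyperbolic space *)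

Section LocallyConstant.
Context {R : realType}.

Lemma finite_pos_lb (T : Type) (A : set T) (f : T -> R) : finite_set A ->
  (forall x, A x -> 0 < f x) -> exists2 e, 0 < e & forall x, A x -> e <= f x.
Proof.
move=> fA fpos; have /finite_seqP[s sE] := finite_image f fA.
have [e e0 eP] : exists2 e, 0 < e & forall y, y \in s -> 0 < y -> e <= y.
  elim: s {sE} => [|y s [e e0 eP]]; first by exists 1.
  have [y0|y0] := ltP 0 y.
    exists (Num.min e y); first by rewrite lt_min e0.
    move=> z; rewrite inE ge_min => /orP[/eqP ->|zs z0]; first by rewrite lexx orbT.
    by rewrite eP.
  exists e => // z; rewrite inE => /orP[/eqP ->|]; last exact: eP.
  by rewrite ltNge y0.
exists e => // x Ax; apply: eP; last exact: fpos.
have : (f @` A) (f x) by exists x.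
by rewrite sE.
Qed.

Lemma min_cst_continuous (b : R) : continuous (fun s : R => Num.min s b).
Proof.
have h : continuous ((@idfun R) \min (cst b : R -> R)).
  by apply: min_fun_continuous => t; [exact: cvg_id|exact: cvg_cst].
exact: h.
Qed.

Lemma truncate_continuous (a b : R) : continuous (fun s : R => Num.max a (Num.min s b)).
Proof.
have h : continuous ((cst a : R -> R) \max ((@idfun R) \min (cst b : R -> R))).
  apply: max_fun_continuous; first by move=> t; exact: cvg_cst.
  by apply: min_fun_continuous => t; [exact: cvg_id|exact: cvg_cst].
exact: h.
Qed.

Lemma locally_constant (P : R -> Prop) :
  (forall t, exists2 e, 0 < e & forall s, `|t - s| < e -> P s <-> P t) ->
  forall s t, P s -> P t.
Proof.
move=> lc s t Ps.
have oP : open [set t | P t].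
  rewrite openE => u Pu; have [e e0 h] := lc u.
  by apply/nbhs_ballP; exists e => // v uv; exact: (h v uv).2 Pu.
have oN : open (~` [set t | P t]).
  rewrite openE => u Pu; have [e e0 h] := lc u.
  by apply/nbhs_ballP; exists e => // v uv Pv; apply: Pu; exact: (h v uv).1 Pv.
have cR : connected [set: R] by apply/connected_intervalP.
have : [set t | P t] = setT.
  apply: cR; first by exists s.
    by exists [set t | P t]; rewrite ?setTI.
  by exists [set t | P t]; rewrite ?setTI// -[X in closed X]setCK closedC.
by move=> /seteqP[_] /(_ t I).
Qed.

End LocallyConstant.

Section Covering.
Context {R : realType} (M : hyperbolic_3_manifold R).
Implicit Types (p q z w : H3 R) (g h : H3 R -> H3 R).
Local Open Scope quotient_scope.

Local Notation X := (manifold_space M).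
Local Notation pr := (\pi_X : H3 R -> X).

Lemma prP z w : pr z = pr w <-> exists2 g, deck M g & g z = w.
Proof.
split=> [e|[g Mg gzw]].
  by have /asboolP := introT (@eqmodP _ (same_orbit_rel M) z w) e.
by apply: (elimT (@eqmodP _ (same_orbit_rel M) z w)); apply/asboolP; exists g.
Qed.

Lemma pr_deck g z : deck M g -> pr (g z) = pr z.
Proof. by move=> Mg; apply/esym/prP; exists g. Qed.

Lemma pr_continuous : continuous pr.
Proof. exact: pi_continuous. Qed.

Lemma deck_continuous g : deck M g -> continuous g.
Proof. by move=> Mg; apply: isometry_continuous; exact: (deck_preserves_dist Mg). Qed.

Lemma pr_nbhs z (U : set (H3 R)) : nbhs z U -> nbhs (pr z) (pr @` U).
Proof.
rewrite nbhsE => -[V [oV Vz] VU]; apply: (@filterS _ _ _ (pr @` V)).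
  by move=> _ [w Vw <-]; exists w => //; exact: VU.
apply: open_nbhs_nbhs; split; last by exists z.
rewrite /open /= /quotient_open openE => w [z' Vz' /esym/prP[g Mg gw]].
have : nbhs w (g @^-1` V).
  by apply: deck_continuous => //; rewrite gw; exact: open_nbhs_nbhs.
by apply: filterS => v Vgv; exists (g v) => //; exact: pr_deck.
Qed.

Lemma injectivity_radius z : exists2 r, 0 < r &
  forall g, deck M g -> hdist z (g z) < r -> g = idfun.
Proof.
have fin : finite_set [set g | (deck M g /\ hdist z (g z) <= 1) /\ g <> idfun].
  by apply: sub_finite_set (deck_finite M z 1) => g [].
have [|e e0 eP] := finite_pos_lb (f := fun g => hdist z (g z)) fin.
  by move=> g [[Mg _] gid]; apply: hdist_gt0 => zg; apply: gid; exact: (deck_free Mg (esym zg)).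
exists (Num.min e 1); first by rewrite lt_min e0 ltr01.
move=> g Mg; rewrite lt_min => /andP[ge g1]; apply: contrapT => gid.
by have := eP g (conj (conj Mg (ltW g1)) gid); rewrite leNgt ge.
Qed.

Lemma close_lift_unique (r : R) z w w' :
  (forall g, deck M g -> hdist z (g z) < r -> g = idfun) ->
  hdist z w < r / 2 -> hdist z w' < r / 2 -> pr w = pr w' -> w = w'.
Proof.
move=> zr zw zw' /prP[g Mg gw].
have gid : g = idfun.
  apply: zr => //; apply: le_lt_trans (hdist_triangle w' _ _) _.
  have -> : hdist w' (g z) = hdist w z by rewrite -gw (deck_preserves_dist Mg).
  by rewrite (hdistC w); lra.
by rewrite -gw gid.
Qed.

(* The lift of [c] is first constructed for the path stopped at time [t]; the
   set of admissible [t] is open and closed. *)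
Lemma path_lifting (c : R -> X) (x0 : H3 R) : continuous c ->
  (forall t, t <= 0 -> c t = pr x0) -> exists L : R -> H3 R,
  [/\ continuous L, (forall t, t <= 0 -> L t = x0) & forall t, t <= 1 -> pr (L t) = c t].
Proof.
move=> cc c0.
pose P t := exists L : R -> H3 R, [/\ continuous L, (forall s, s <= 0 -> L s = x0) &
  forall s, pr (L s) = c (Num.min s t)].
have Pneg t : t <= 0 -> P t.
  move=> t0; exists (fun=> x0); split => // [|s]; first exact: cst_continuous.
  by rewrite c0// ge_min t0 orbT.
suff : P 1 by move=> [L [cL L0 LE]]; exists L; split => // t t1; rewrite LE min_l.
apply: (@locally_constant _ _ _ 0); last exact: Pneg.
move=> t0; set z0 := repr (c t0).
have prz0 : pr z0 = c t0 by exact: reprK.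
have [r r0 zr] := injectivity_radius z0.
have r2 : 0 < r / 2 by rewrite divr_gt0.
have h0 : nbhs (c t0) (pr @` [set w | hdist z0 w < r / 2]).
  by rewrite -prz0; apply: pr_nbhs; exact: nbhs_hdist.
have /nbhs_ballP[e /= e0 ce] := cc t0 _ h0; exists e => //.
(* A local section of the covering, chosen pointwise; its continuity comes afterwards from
   [close_lift_unique]. *)
have [sig sigP] : {sig : R -> H3 R & forall s, `|t0 - s| < e ->
    hdist z0 (sig s) < r / 2 /\ pr (sig s) = c s}.
  have ex s : exists w, `|t0 - s| < e -> hdist z0 w < r / 2 /\ pr w = c s.
    have [h|h] := pselect (`|t0 - s| < e); last by exists z0.
    by have [w] := ce s h; exists w.
  by have [sig sigP] := choice ex; exists sig.
have mono a b : b <= a -> P a -> P b.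
  move=> ba [L [cL L0 LE]]; have [b0|b0] := leP b 0; first exact: Pneg.
  exists (fun s => L (Num.min s b)); split.
  - move=> s; apply: (@continuous_comp _ _ _ (fun s => Num.min s b) L); last exact: cL.
    exact: min_cst_continuous.
  - by move=> s s0; apply: L0; rewrite ge_min s0.
  - by move=> s; rewrite LE -minA (min_l ba).
have step a b : 0 <= a -> a <= b -> `|t0 - a| < e -> `|t0 - b| < e -> P a -> P b.
  move=> a0 ab ta tb [L [cL L0 LE]].
  have [g Mg gL] : exists2 g, deck M g & g (sig a) = L a.
    by apply/prP; rewrite LE minxx; exact: (sigP a ta).2.
  pose k s := Num.max a (Num.min s b).
  have ck : continuous k by exact: truncate_continuous.
  have ke s : `|t0 - k s| < e.
    have : a <= k s <= b by rewrite /k le_max lexx ge_max ab ge_min lexx orbT.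
    by move: ta tb; rewrite !ltr_norml => /andP[? ?] /andP[? ?] /andP[? ?]; lra.
  have csig : continuous (sig \o k).
    move=> s U /nbhs_hdistP[d d0 dU]; have [z1 z2] := sigP (k s) (ke s).
    have h1 : nbhs (c (k s)) (pr @` [set w | hdist (sig (k s)) w < d /\ hdist z0 w < r / 2]).
      rewrite -z2; apply: pr_nbhs; apply: filterI; first exact: nbhs_hdist.
      apply/nbhs_hdistP; exists (r / 2 - hdist z0 (sig (k s))); first by rewrite subr_gt0.
      by move=> w hw; apply: le_lt_trans (hdist_triangle (sig (k s)) _ _) _; lra.
    have h2 := ck s _ (cc (k s) _ h1).
    apply: (@filterS _ (nbhs s) _ _ ((sig \o k) @^-1` U) _ h2) => u [w [w1 w2] wc]; apply: dU => /=.
    have [v1 v2] := sigP (k u) (ke u).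
    by rewrite (_ : sig (k u) = w)//; apply: (close_lift_unique zr) => //; rewrite wc.
  (* Past [a] the lift follows the translate by [g] of the local section, [g] being the deck element
     that makes it agree with [L] at [a]. *)
  exists (fun s => if s - a <= 0 then L s else g (sig (k s))); split.
  - apply: Defs.glue_continuous => //.
    + exact: Defs.shift_continuous.
    + by move=> s; apply: (@continuous_comp _ _ _ (sig \o k) g); [exact: csig|exact: deck_continuous].
    + move=> s /eqP; rewrite subr_eq0 => /eqP ->.
      by rewrite /k (min_l ab) maxxx gL.
  - by move=> s s0; rewrite ifT ?L0//; lra.
  - move=> s; rewrite subr_le0; case: leP => [sa|sa].
      by rewrite LE (min_l sa) (min_l (le_trans sa ab)).
    rewrite pr_deck// (sigP _ (ke s)).2; congr c.
    by rewrite /k max_r// le_min ltW.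
move=> s ts; have tt : `|t0 - t0| < e by rewrite subrr normr0.
have key a b : `|t0 - a| < e -> `|t0 - b| < e -> P a -> P b.
  move=> ta tb Pa; have [b0|b0] := leP b 0; first exact: Pneg.
  have [ba|ab] := leP b a; first exact: mono ba Pa.
  have [a0|a0] := leP 0 a; first exact: step (ltW ab) ta tb Pa.
  apply: (step 0 b) => //; first exact: ltW.
    by move: ta tb; rewrite !ltr_norml => /andP[? ?] /andP[? ?]; lra.
  exact: Pneg.
by split; exact: key.
Qed.

End Covering.

Section Segments.
Context {R : realType}.
Implicit Types (p q z w : H3 R).

Definition seg_coords (s : R) p q : R * R * R :=
  ((1 - s) * (coords p).1.1 + s * (coords q).1.1,
   (1 - s) * (coords p).1.2 + s * (coords q).1.2,
   (1 - s) * height p + s * height q).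

Lemma seg_height_gt0 (s : R) p q : 0 <= s <= 1 -> 0 < (1 - s) * height p + s * height q.
Proof.
move=> /andP[s0 s1]; have hp := height_gt0 p; have hq := height_gt0 q.
have [->|sn] := eqVneq s 0; first by rewrite subr0 mul1r mul0r addr0.
have : 0 < s by rewrite lt_neqAle eq_sym sn.
nra.
Qed.

(** A Euclidean segment rather than a geodesic: convexity of the half-space is all that the lifts
    and homotopies require. The clamp keeps it inside, so the default of [insubd] is never taken. *)
Definition hseg (s : R) p q : H3 R :=
  insubd (base_point : H3 R) (seg_coords (clamp_val s) p q).

Lemma clamp_val_itv (s : R) : 0 <= clamp_val s <= 1.
Proof. by rewrite -uvalE; exact: uval_bound. Qed.

Lemma coords_hseg s p q : coords (hseg s p q) = seg_coords (clamp_val s) p q.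
Proof.
rewrite /coords /hseg val_insubd ifT//; apply/mem_set.
by rewrite /upper_half_space /=; apply: seg_height_gt0; exact: clamp_val_itv.
Qed.

Lemma hseg_le0 s p q : s <= 0 -> hseg s p q = p.
Proof.
move=> s0; apply: H3_eq; rewrite coords_hseg.
have -> : clamp_val s = 0 by rewrite -uvalE clamp_le0// uvalE clamp_valE.
rewrite /seg_coords !subr0 !mul1r !mul0r !addr0 /height.
by case: (coords p) => -[].
Qed.

Lemma hseg_ge1 s p q : 1 <= s -> hseg s p q = q.
Proof.
move=> s0; apply: H3_eq; rewrite coords_hseg.
have -> : clamp_val s = 1 by rewrite -uvalE clamp_ge1// uvalE clamp_valE.
rewrite /seg_coords !subrr !mul1r !mul0r !add0r /height.
by case: (coords q) => -[].
Qed.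

Lemma hsegxx s p : hseg s p p = p.
Proof.
apply: H3_eq; rewrite coords_hseg /seg_coords -!mulrDl !subrK !mul1r /height.
by case: (coords p) => -[].
Qed.

Lemma clamp_val_continuous : continuous (@clamp_val R).
Proof.
move=> s; apply: (@continuous_comp _ _ _ clamp uval).
  exact: clamp_continuous.
exact: uval_continuous.
Qed.

Lemma hseg_continuous (U : topologicalType) (a : U -> R) (f g : U -> H3 R) :
  continuous a -> continuous f -> continuous g ->
  continuous (fun u => hseg (a u) (f u) (g u)).
Proof.
move=> ca cf cg; apply: continuous_comp_initial.
have cA : continuous (fun u => clamp_val (a u)).
  by move=> u; apply: (@continuous_comp _ _ _ a (@clamp_val R)); [exact: ca|exact: clamp_val_continuous].
have cB : continuous (fun u => 1 - clamp_val (a u)).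
  by move=> u; exact: (continuousB (@cst_continuous _ _ (1 : R) u) (cA u)).
have cc (h : H3 R -> R) (k : U -> H3 R) : continuous h -> continuous k -> continuous (fun u => h (k u)).
  by move=> ch ck u; apply: (@continuous_comp _ _ _ k h); [exact: ck|exact: ch].
have lin (h : H3 R -> R) : continuous h ->
    continuous (fun u => (1 - clamp_val (a u)) * h (f u) + clamp_val (a u) * h (g u)).
  move=> ch u.
  exact: (continuousD (continuousM (cB u) (cc h f ch cf u)) (continuousM (cA u) (cc h g ch cg u))).
have -> : set_val \o (fun u => hseg (a u) (f u) (g u)) =
    fun u => seg_coords (clamp_val (a u)) (f u) (g u).
  by apply: funext => u; exact: coords_hseg.
move=> u; exact: (cvg_pair (cvg_pair (lin _ (@coord1_continuous R) u)
  (lin _ (@coord2_continuous R) u)) (lin _ (@height_continuous R) u)).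
Qed.

End Segments.

Section Monodromy.
Context {R : realType} (M : hyperbolic_3_manifold R) (x : manifold_space M).
Implicit Types (p q z w : H3 R) (g h : H3 R -> H3 R).
Local Open Scope quotient_scope.

Local Notation X := (manifold_space M).
Local Notation pr := (\pi_X : H3 R -> X).
Local Notation I := (unit_interval R).
Local Notation loop := (@loop R X x).

Definition base_lift : H3 R := repr x.

Lemma pr_base_lift : pr base_lift = x.
Proof. exact: reprK. Qed.

(** Compactness of the segment gives one radius along all of [L0]. The lift of a nearby path then
    stays in the same sheet as [L0], and the end points, which lie over the same point, coincide. *)
Lemma lift_locally_constant (c : R -> R -> X) (s0 : R) (L0 : R -> H3 R) :
  continuous (fun st : R * R => c st.1 st.2) -> continuous L0 ->
  (forall t, t <= 1 -> pr (L0 t) = c s0 t) ->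
  (forall s, c s 1 = c s0 1) ->
  exists2 e : R, 0 < e & forall (s : R) (L : R -> H3 R), `|s0 - s| < e -> continuous L -> L 0 = L0 0 ->
    (forall t, t <= 1 -> pr (L t) = c s t) -> L 1 = L0 1.
Proof.
move=> cc cL0 L0c cend.
have K01 : compact `[0%R, 1%R : R] by exact: segment_compact.
have NC := (compact_near_coveringP _).1 K01.
have [r r0 rL] : exists2 r, 0 < r & forall t, 0 <= t <= 1 ->
    forall g, deck M g -> hdist (L0 t) (g (L0 t)) < 4 * r -> g = idfun.
  have := NC _ (0^'+ : set_system R) (fun r t => forall g, deck M g ->
    hdist (L0 t) (g (L0 t)) < 4 * r -> g = idfun) _ _.
  move=> /(_ _) h; have : \forall r \near 0^'+, `[0%R, 1%R : R] `<=` (fun t => forall g, deck M g ->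
      hdist (L0 t) (g (L0 t)) < 4 * r -> g = idfun).
    apply: h => t _; have [rho rho0 rhoP] := injectivity_radius M (L0 t).
    exists ([set t' | hdist (L0 t) (L0 t') < rho / 4], [set r | r < rho / 8]).
      split => /=; last by apply: nbhs_right_lt; rewrite divr_gt0.
      by apply: (cL0 t [set w | hdist (L0 t) w < rho / 4]); apply: nbhs_hdist; rewrite divr_gt0.
    move=> [t' r] /= [tt' rr] g Mg gr; apply: rhoP => //.
    apply: le_lt_trans (hdist_triangle (L0 t') _ _) _.
    have := hdist_triangle (g (L0 t')) (L0 t') (g (L0 t)).
    by rewrite (deck_preserves_dist Mg) (hdistC (L0 t') (L0 t)); lra.
  move=> hn; have [r [r0 hr]] := filter_ex (filterI (nbhs_right_gt (0 : R)) hn).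
  by exists r => // t t01; apply: hr; rewrite /= in_itv.
have [e e0 eP] : exists2 e, 0 < e & forall s, `|s0 - s| < e -> forall t, 0 <= t <= 1 ->
    exists2 w, hdist (L0 t) w < r & pr w = c s t.
  have : \forall s \near s0, `[0%R, 1%R : R] `<=` (fun t => exists2 w, hdist (L0 t) w < r & pr w = c s t).
    apply: (NC _ (nbhs s0)) => t; rewrite /= in_itv /= => /andP[t0 t1].
    have r2 : 0 < r / 2 by rewrite divr_gt0.
    have h1 : nbhs (c s0 t) (pr @` [set w | hdist (L0 t) w < r / 2]).
      by rewrite -L0c//; apply: pr_nbhs; exact: nbhs_hdist.
    have [[A B] /= [As Bt] AB] := cc (s0, t) _ h1.
    exists (B `&` [set t' | hdist (L0 t) (L0 t') < r / 2], A).
      split => //=; apply: filterI => //.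
      by apply: (cL0 t [set w | hdist (L0 t) w < r / 2]); exact: nbhs_hdist.
    move=> [t' s] /= [[Bt' tt'] As']; have [w zw wc] := AB (s, t') (conj As' Bt').
    exists w => //; apply: le_lt_trans (hdist_triangle (L0 t) _ _) _.
    by move: zw => /= zw; rewrite (hdistC (L0 t')); lra.
  move=> /nbhs_ballP[e /= e0 eP]; exists e; first by []. move=> s se t t01.
  by apply: (eP s se); rewrite /= in_itv.
exists e => // s L se cL LL0 Lc.
have tau (t : R) : 0 <= clamp_val t <= 1 by exact: clamp_val_itv.
have cl (N : R -> H3 R) : continuous N -> continuous (fun t => N (clamp_val t)).
  by move=> cN t; apply: (@continuous_comp _ _ _ (@clamp_val R) N); [exact: clamp_val_continuous|exact: cN].
pose P t := hdist (L0 (clamp_val t)) (L (clamp_val t)) < r.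
(* Nontrivial translates move [L0 t] by at least [4 * r], so a distance below [3 * r] is already
   below [r]. This gap makes [P] locally constant. *)
have sheet t : 0 <= t <= 1 -> hdist (L0 t) (L t) < 3 * r -> hdist (L0 t) (L t) < r.
  move=> t01 h3; have [w zw wc] := eP s se t t01.
  have /prP[g Mg gw] : pr w = pr (L t) by rewrite wc Lc//; case/andP: t01.
  have gid : g = idfun.
    apply: (rL t t01) => //; apply: le_lt_trans (hdist_triangle (L t) _ _) _.
    have -> : hdist (L t) (g (L0 t)) = hdist w (L0 t) by rewrite -gw (deck_preserves_dist Mg).
    by rewrite (hdistC w); lra.
  by rewrite -gw gid.
have P0 : P 0 by rewrite /P clamp_valE// LL0 hdistxx.
have : P 1.
  apply: (@locally_constant R P _ 0 1 P0) => t.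
  have r8 : 0 < r / 2 by rewrite divr_gt0.
  have : nbhs t ([set t' | hdist (L0 (clamp_val t)) (L0 (clamp_val t')) < r / 2] `&`
                 [set t' | hdist (L (clamp_val t)) (L (clamp_val t')) < r / 2]).
    apply: filterI.
      by apply: (cl _ cL0 t [set w | hdist (L0 (clamp_val t)) w < r / 2]); exact: nbhs_hdist.
    by apply: (cl _ cL t [set w | hdist (L (clamp_val t)) w < r / 2]); exact: nbhs_hdist.
  move=> /nbhs_ballP[d /= d0 dP]; exists d => // t' tt'; have [h1 h2] := dP t' tt'.
  have tri a b a' b' : hdist a b <= hdist a a' + hdist a' b' + hdist b' b :> R.
    apply: le_trans (hdist_triangle b' _ _) _; rewrite lerD2r; exact: hdist_triangle.
  have := tri (L0 (clamp_val t)) (L (clamp_val t)) (L0 (clamp_val t')) (L (clamp_val t')).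
  have := tri (L0 (clamp_val t')) (L (clamp_val t')) (L0 (clamp_val t)) (L (clamp_val t)).
  rewrite (hdistC (L0 (clamp_val t')) (L0 (clamp_val t))) (hdistC (L (clamp_val t')) (L (clamp_val t))).
  move: h1 h2 => /= h1 h2 q1 q2; split => hP.
    by apply: (sheet (clamp_val t) (tau t)); move: hP; rewrite /P; lra.
  by apply: (sheet (clamp_val t') (tau t')); move: hP; rewrite /P; lra.
rewrite /P clamp_valE// => h1.
have l11 : (1 : R) <= 1 by [].
have /prP[g Mg gL] : pr (L0 1) = pr (L 1) by rewrite L0c// Lc.
have -> : L 1 = g (L0 1) by [].
rewrite (rL 1 _ g Mg) ?lexx ?ler01// gL; lra.
Qed.

Definition loop_fun (p : loop) : I -> X := (p : {path I from x to x in X}).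

Definition lifts_to (p : loop) (L : R -> H3 R) : Prop :=
  [/\ continuous L, L 0 = base_lift & forall t, 0 <= t <= 1 -> pr (L t) = loop_fun p (clamp t)].

(** Every stage of the homotopy is lifted separately; the end point of the lift is locally constant
    in the stage, hence constant. *)
Lemma homotopic_lifts (p q : loop) (A B : R -> H3 R) :
  homotopic p q -> lifts_to p A -> lifts_to q B -> A 1 = B 1.
Proof.
move=> [H [cH He Hx]] [cA A0 Ap] [cB B0 Bq].
pose c (s t : R) := H (clamp s, clamp t).
have cc : continuous (fun st : R * R => c st.1 st.2).
  apply: (@Defs.comp_pair _ _ _ _ H (fun st : R * R => clamp st.1) (fun st => clamp st.2)) => //.
    move=> st; apply: (@continuous_comp _ _ _ fst clamp); last exact: clamp_continuous.
    exact: cvg_fst.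
  move=> st; apply: (@continuous_comp _ _ _ snd clamp); last exact: clamp_continuous.
  exact: cvg_snd.
have c0 s t : t <= 0 -> c s t = pr base_lift.
  by move=> t0; rewrite /c (clamp_le0 t0) pr_base_lift; exact: (Hx _).1.
have c1 s : c s 1 = x by exact: (Hx _).2.
pose islift (s : R) (L : R -> H3 R) := [/\ continuous L, L 0 = base_lift & forall t, t <= 1 -> pr (L t) = c s t].
have exl (s : R) : exists L, islift s L.
  have cs : continuous (c s).
    move=> t; apply: (@continuous_comp _ _ _ (fun t : R => (s, t)) (fun st : R * R => c st.1 st.2)); last exact: cc.
    exact: (cvg_pair (cvg_cst _) cvg_id).
  have [L [cL L0 Lc]] := path_lifting cs (c0 s).
  by exists L; split => //; exact: L0.
have ext (k : loop) (s : R) (N : R -> H3 R) : (forall t, c s t = loop_fun k (clamp t)) -> lifts_to k N ->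
    islift s (fun t => N (clamp_val t)).
  move=> ck [cN N0 Nk]; split.
  - by move=> t; apply: (@continuous_comp _ _ _ (@clamp_val R) N); [exact: clamp_val_continuous|exact: cN].
  - by rewrite clamp_valE.
  - move=> t _; rewrite Nk; last exact: clamp_val_itv.
    by rewrite ck; congr (loop_fun k _); rewrite -[RHS]clampK uvalE.
have lA : islift 0 (fun t => A (clamp_val t)).
  by apply: (ext p) => // t; exact: (He _).1.
have lB : islift 1 (fun t => B (clamp_val t)).
  by apply: (ext q) => // t; exact: (He _).2.
have loc (s0 : R) (L0 : R -> H3 R) : islift s0 L0 -> exists2 e : R, 0 < e & forall (s : R) (L : R -> H3 R), `|s0 - s| < e -> islift s L -> L 1 = L0 1.
  move=> [cL0 L00 L0c]; have [|e e0 eP] := @lift_locally_constant c s0 L0 cc cL0 L0c.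
    by move=> s; rewrite !c1.
  exists e => // s L se [cL LL Lc]; apply: (eP s) => //.
  by rewrite LL L00.
pose P (s : R) := exists2 L, islift s L & L 1 = A 1.
have : P 1.
  apply: (@locally_constant R P _ 0); last by exists (fun t => A (clamp_val t)); rewrite ?clamp_valE.
  move=> s0; have [L0 lL0] := exl s0; have [e e0 eP] := loc s0 L0 lL0.
  have ss : `|s0 - s0| < e by rewrite subrr normr0.
  exists e => // s se; split => -[L lL L1].
    by exists L0 => //; rewrite -(eP s L).
  have [L' lL'] := exl s; exists L' => //.
  by rewrite (eP s L')// -(eP s0 L).
move=> [L lL L1]; have [e e0 eP] := loc 1 L lL.
have ss : `|1 - 1 : R| < e by rewrite subrr normr0.
by have := eP 1 _ ss lB; rewrite clamp_valE// L1.
Qed.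

End Monodromy.

Section DeckAction.
Context {R : realType} (M : hyperbolic_3_manifold R) (x : manifold_space M).
Implicit Types (z w : H3 R) (g h : H3 R -> H3 R).
Local Open Scope quotient_scope.

Local Notation X := (manifold_space M).
Local Notation pr := (\pi_X : H3 R -> X).
Local Notation I := (unit_interval R).
Local Notation loop := (@loop R X x).
Local Notation base := (base_lift x).

Definition represents (a : pi1 R x) g : Prop :=
  deck M g /\ exists2 p : loop, a = \pi_(pi1 R x) p & exists2 A, lifts_to p A & A 1 = g base.

Lemma pi1_homotopic (p q : loop) : \pi_(pi1 R x) p = \pi_(pi1 R x) q -> homotopic p q.
Proof.
move=> e; apply: (homotopic_trans (homotopic_sym (pi1_reprP p))).
by rewrite e; exact: pi1_reprP.
Qed.

Lemma represents_exists a : exists g, represents a g.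
Proof.
pose p : loop := repr a.
have cc : continuous (fun t => loop_fun p (clamp t)).
  move=> t; apply: (@continuous_comp _ _ _ clamp (loop_fun p)); first exact: clamp_continuous.
  exact: cts_fun.
have [t t0|L [cL L0 Lc]] := @path_lifting R M _ base cc.
  by rewrite pr_base_lift clamp_le0//; exact: path_zero.
have /esym/prP[g Mg gL] : pr (L 1) = pr base.
  by rewrite Lc// pr_base_lift; exact: path_one.
exists g; split => //; exists p; first by rewrite /p reprK.
exists L => //; split => // [|t /andP[_ t1]]; first exact: L0.
exact: Lc.
Qed.

Lemma represents_uniq a g h : represents a g -> represents a h -> g = h.
Proof.
move=> [Mg [p ap [A pA Ag]]] [Mh [q aq [B qB Bh]]].
have e : g base = h base.
  by rewrite -Ag -Bh; apply: (homotopic_lifts _ pA qB); apply: pi1_homotopic; rewrite -ap -aq.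
have [k Mk hk] := deck_inv Mh; have ik := deck_preserves_dist Mk.
have kg : k \o g = idfun.
  by apply: (deck_free (deck_comp Mk Mg) (z := base)) => /=; rewrite e hk.
apply: funext => z; have kinj : injective k.
  by move=> u v uv; apply: hdist_eq0; rewrite -ik uv hdistxx.
by apply: kinj; rewrite hk -[LHS]/((k \o g) z) kg.
Qed.

(** Two lifts with the same end points are joined by segments upstairs, and this homotopy is
    projected. *)
Lemma represents_inj a b g : represents a g -> represents b g -> a = b.
Proof.
move=> [_ [p -> [A [cA A0 Ap] Ag]]] [_ [q -> [B [cB B0 Bq] Bg]]].
apply: pi1P; exists (fun st => pr (hseg (uval st.1) (A (uval st.2)) (B (uval st.2)))).
have cu (k : I * I -> I) (N : R -> H3 R) : continuous k -> continuous N ->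
    continuous (fun st => N (uval (k st))).
  move=> ck cN st; apply: (@continuous_comp _ _ _ (fun st => uval (k st)) N); last exact: cN.
  by apply: (@continuous_comp _ _ _ k uval); [exact: ck|exact: uval_continuous].
split.
- move=> st; apply: (@continuous_comp _ _ _ (fun st => hseg (uval st.1) (A (uval st.2)) (B (uval st.2))) pr); last exact: pr_continuous.
  apply: hseg_continuous.
  + move=> {}st; apply: (@continuous_comp _ _ _ fst uval); last exact: uval_continuous.
    exact: cvg_fst.
  + by apply: cu => // {}st; exact: cvg_snd.
  + by apply: cu => // {}st; exact: cvg_snd.
- move=> t /=; rewrite uval0 uval1 hseg_le0// hseg_ge1//.
  have := uval_bound t => t01.
  by rewrite Ap// Bq// !clampK.
- move=> s /=; rewrite uval0 uval1 A0 B0 Ag Bg !hsegxx pr_base_lift; split => //.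
  have /andP[l0 _] : 0 <= (1 : R) <= 1 by rewrite ler01 lexx.
  by rewrite -Ag Ap ?ler01 ?lexx//; exact: path_one.
Qed.

(** The second loop is lifted from the end point [g base] of the first lift, that is by the
    translate [g \o B]. The order of composition agrees with that of concatenation, so the action is
    on the left. *)
Lemma represents_mul a b g h : represents a g -> represents b h -> represents (a * b)%g (g \o h).
Proof.
move=> [Mg [p -> [A [cA A0 Ap] Ag]]] [Mh [q -> [B [cB B0 Bq] Bh]]].
split; first exact: deck_comp.
exists (concat p q); first exact: pi1_mulE.
exists (fun t => if t - 2^-1 <= 0 then A (2 * t) else g (B (2 * t - 1))); last first.
  by rewrite /= ifF; [rewrite mulr1 (_ : 2 - 1 = 1 :> R) ?Bh//; lra|lra].
split.
- apply: Defs.glue_continuous.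
  + exact: Defs.shift_continuous.
  + move=> t; apply: (@continuous_comp _ _ _ (fun t : R => 2 * t) A); last exact: cA.
    exact: Defs.double_continuous.
  + move=> t; apply: (@continuous_comp _ _ _ (fun t : R => B (2 * t - 1)) g); last exact: (deck_continuous Mg).
    apply: (@continuous_comp _ _ _ (fun t : R => 2 * t - 1) B); last exact: cB.
    exact: Defs.double_shift_continuous.
  + move=> t /eqP; rewrite subr_eq0 => /eqP ->.
    by rewrite mulfV ?pnatr_eq0// Ag subrr B0.
- by rewrite ifT ?mulr0//; lra.
- move=> t /andP[t0 t1].
  have -> : loop_fun (concat p q) (clamp t) = (concat p q : {path I from x to x in X}) (clamp t) by [].
  rewrite concatE uvalE clamp_valE// subr_le0.
  case: (leP t 2^-1) => t2.
    by rewrite Ap//; lra.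
  by rewrite pr_deck// Bq//; lra.
Qed.

Lemma represents_surj g : deck M g -> exists a, represents a g.
Proof.
move=> Mg; pose A t := hseg t base (g base).
have cA : continuous A.
  by apply: hseg_continuous; [move=> t; exact: cvg_id|exact: cst_continuous|exact: cst_continuous].
pose f (t : I) : X := pr (A (uval t)).
have cf : continuous f.
  move=> t; apply: (@continuous_comp _ _ _ (fun t => A (uval t)) pr); last exact: pr_continuous.
  by apply: (@continuous_comp _ _ _ uval A); [exact: uval_continuous|exact: cA].
have f0 : f zero = x by rewrite /f /A uval0 hseg_le0// pr_base_lift.
have f1 : f one = x by rewrite /f /A uval1 hseg_ge1// pr_deck// pr_base_lift.
pose p : loop := mk_path cf f0 f1.
exists (\pi_(pi1 R x) p); split => //; exists p => //; exists A; last by rewrite /A hseg_ge1.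
split => //; first by rewrite /A hseg_le0.
by move=> t t01; rewrite /loop_fun /p /= /mk_path /f uvalE clamp_valE//; case/andP: t01.
Qed.

Lemma deck_action : exists act : pi1 R x -> H3 R -> H3 R,
  [/\ (forall a, deck M (act a)), (forall a b, act (a * b)%g = act a \o act b),
      injective act & forall g, deck M g -> exists a, act a = g].
Proof.
have [act actP] := choice represents_exists; exists act; split.
- by move=> a; have [] := actP a.
- by move=> a b; apply: (represents_uniq (actP _)); exact: represents_mul.
- by move=> a b e; apply: (represents_inj (actP a)); rewrite e.
- move=> g Mg; have [a ag] := represents_surj Mg; exists a.
  exact: represents_uniq (actP a) ag.
Qed.

End DeckAction.

(** * Volumes of balls *)

Section DiscArea.
Context {R : realType}.
Implicit Types (p q z w : H3 R).
Local Notation lam := (@lebesgue_measure R).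
Local Notation R2 := (measurableTypeR R * measurableTypeR R)%type.
Local Notation R3 := (measurableTypeR R * measurableTypeR R * measurableTypeR R)%type.

(** Up to the factor pi, the density of ball volume at height [t]: a slice is a disc whose squared
    radius is the first factor, and the volume form contributes the inverse cube. Here [t0] is the
    height of the centre and [k] the hyperbolic cosine of the radius. *)
Definition slice_weight (k t0 t : R) : R := (2 * k * t0 * t - t0 ^+ 2 - t ^+ 2) * (t^-1) ^+ 3.
Definition slice_primitive (k t0 t : R) : R :=
  - (2 * k * t0) * t^-1 + t0 ^+ 2 / 2 * (t^-1) ^+ 2 - ln t.

Lemma slice_primitive_derive (c k t0 t : R) : 0 < t ->
  is_derive t 1 (fun u => c * slice_primitive k t0 u) (c * slice_weight k t0 t).
Proof.
move=> t_gt0; have tn0 : t != 0 by rewrite gt_eqF.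
have dV : is_derive t 1 (fun u : R => u^-1) (- t ^- 2).
  apply: (is_derive_eq (is_deriveV (f := idfun) tn0 (is_derive_id t 1))).
  by rewrite /= /GRing.scale /= mulr1.
have dl := is_derive1_ln t_gt0.
rewrite /slice_primitive.
apply: is_derive_eq; rewrite /slice_weight /GRing.scale /=.
by field.
Qed.

Lemma slice_weight_continuous (c k t0 : R) (t : R) : 0 < t ->
  {for t, continuous (fun u => c * slice_weight k t0 u)}.
Proof.
move=> t_gt0.
have cV : {for t, continuous (fun u : R => u^-1)} by apply: inv_continuous; rewrite gt_eqF.
have ci : {for t, continuous (fun u : R => u)} by exact: cvg_id.
have cc (x : R) : {for t, continuous (fun _ : R => x)} by exact: cvg_cst.
rewrite /slice_weight.
exact: (continuousM (cc c) (continuousM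
  (continuousB (continuousB (continuousM (cc _) ci) (cc _)) (continuousM ci ci))
  (continuousM cV (continuousM cV cV)))).
Qed.

Lemma slice_integral (c k t0 a b : R) : 0 < a -> a < b ->
  (\int[lam]_(t in `[a, b]) (c * slice_weight k t0 t)%:E =
   (c * slice_primitive k t0 b)%:E - (c * slice_primitive k t0 a)%:E)%E.
Proof.
move=> a0 ab; have b0 := lt_trans a0 ab.
have pos t : t \in `[a, b] -> 0 < t by rewrite in_itv /= => /andP[at_ _]; exact: lt_le_trans at_.
apply: (@continuous_FTC2 R (fun t => c * slice_weight k t0 t) (fun t => c * slice_primitive k t0 t)) => //.
- apply: continuous_in_subspaceT => t /set_mem /= tab.
  by apply: slice_weight_continuous; exact: pos.
- have cont t : 0 < t -> {for t, continuous (fun u => c * slice_primitive k t0 u)}.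
    move=> tp; apply: differentiable_continuous; apply/derivable1_diffP.
    exact: (@ex_derive _ _ _ _ _ _ _ (slice_primitive_derive c k t0 tp)).
  split.
  + move=> t; rewrite in_itv /= => /andP[at_ _].
    exact: (@ex_derive _ _ _ _ _ _ _ (slice_primitive_derive c k t0 (lt_trans a0 at_))).
  + exact: (cvg_at_right_filter (cont a a0)).
  + exact: (cvg_at_left_filter (cont b b0)).
- move=> t; rewrite in_itv /= => /andP[at_ _]; rewrite derive1E.
  exact: (@derive_val _ _ _ _ _ _ _ (slice_primitive_derive c k t0 (lt_trans a0 at_))).
Qed.

Lemma slice_primitive_diff (k t0 r : R) : 0 < t0 -> k = ch r ->
  slice_primitive k t0 (t0 * expR r) - slice_primitive k t0 (t0 * expR (- r)) = sh (2 * r) - 2 * r.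
Proof.
move=> t00 ->; rewrite /slice_primitive !lnM ?posrE ?expR_gt0// !expRK.
have e2 : expR (2 * r) = expR r ^+ 2 by rewrite mulr_natl mulr2n expRD expr2.
have En : expR r != 0 by rewrite gt_eqF// expR_gt0.
have tn : t0 != 0 by rewrite gt_eqF.
rewrite /ch /sh [expR (- (2 * r))]expRN e2 expRN.
by field; rewrite En tn.
Qed.

Lemma rectangle_measure (a b c d : R) (s1 s2 s3 s4 : bool) : a <= b -> c <= d ->
  ((lam \x lam) ([set` Interval (BSide s1 a) (BSide s2 b)] `*`
     [set` Interval (BSide s3 c) (BSide s4 d)]) = ((b - a) * (d - c))%:E)%E.
Proof.
move=> ab cd; rewrite product_measure1E//; try exact: measurable_itv.
have len (u v : R) (t1 t2 : bool) : u <= v ->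
    lebesgue_measure ([set` Interval (BSide t1 u) (BSide t2 v)] : set R) = (v - u)%:E.
  move=> uv; rewrite lebesgue_measure_itv /= lte_fin.
  have [uv'|vu|->] := ltgtP u v; last by rewrite subrr.
    by rewrite EFinB.
  by move: uv; rewrite leNgt vu.
by rewrite EFinM; congr (_ * _)%E; exact: len.
Qed.

Definition disc (x0 y0 s : R) : set R2 := [set u | (u.1 - x0) ^+ 2 + (u.2 - y0) ^+ 2 < s].

Lemma measurable_disc x0 y0 s : measurable (disc x0 y0 s).
Proof.
have m1 : measurable_fun [set: R2] (fun u : R2 => u.1 : R) by exact: measurable_fst.
have m2 : measurable_fun [set: R2] (fun u : R2 => u.2 : R) by exact: measurable_snd.
have mf : measurable_fun [set: R2] (fun u : R2 => (u.1 - x0) ^+ 2 + (u.2 - y0) ^+ 2 : R).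
  exact: (measurable_funD (measurable_funX 2 (measurable_funB m1 (@measurable_cst _ _ _ _ _ x0)))
    (measurable_funX 2 (measurable_funB m2 (@measurable_cst _ _ _ _ _ y0)))).
have := mf measurableT _ (measurable_itv `]-oo, s[); rewrite setTI.
by congr measurable; apply/seteqP; split=> u; rewrite /disc /= in_itv.
Qed.

Lemma disc_le (x0 y0 s : R) : 0 <= s -> ((lam \x lam) (disc x0 y0 s) <= (4 * s)%:E)%E.
Proof.
move=> s0; set r := Num.sqrt s.
have r0 : 0 <= r := sqrtr_ge0 s; have rs : r ^+ 2 = s by rewrite sqr_sqrtr.
rewrite (_ : 4 * s = (x0 + r - (x0 - r)) * (y0 + r - (y0 - r))); last by rewrite -rs; ring.
rewrite -(@rectangle_measure _ _ _ _ true false true false); [|lra|lra].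
apply: le_measure; rewrite ?inE; [exact: measurable_disc| |].
  by apply: measurableX; exact: measurable_itv.
move=> u; rewrite /disc /= !in_itv /= => us.
have := sqr_ge0 (u.1 - x0); have := sqr_ge0 (u.2 - y0) => u2 u1.
by split; apply/andP; split; nra.
Qed.

(** One step of a staircase inscribed in a disc: a rectangle of half-width [c] is put above [U] and
    one below. The vertical intervals are half-open so that the pieces are disjoint and areas
    add. *)
Lemma stack_rectangles (U : set R2) (x0 y0 b b' c : R) : measurable U ->
  (forall u, U u -> y0 - b <= u.2 < y0 + b) -> 0 <= b -> b <= b' -> 0 <= c ->
  exists U' : set R2, [/\ measurable U', forall u, U' u -> y0 - b' <= u.2 < y0 + b',
    ((lam \x lam) U' = (lam \x lam) U + (4 * c * (b' - b))%:E)%E &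
    forall u, U' u -> U u \/ (x0 - c < u.1 < x0 + c /\ y0 - b' <= u.2 < y0 + b')].
Proof.
move=> mU Ub b0 bb' c0.
pose B : set R2 := [set` `]x0 - c, x0 + c[] `*` [set` `[y0 + b, y0 + b'[].
pose C : set R2 := [set` `]x0 - c, x0 + c[] `*` [set` `[y0 - b', y0 - b[].
have mB : measurable B by apply: measurableX; exact: measurable_itv.
have mC : measurable C by apply: measurableX; exact: measurable_itv.
exists (U `|` B `|` C); split.
- by apply: measurableU => //; exact: measurableU.
- move=> [u v] [[/Ub|]|] /=; rewrite ?in_itv /=.
  + by move=> /andP[? ?]; apply/andP; split; lra.
  + by move=> [_ /=]; rewrite in_itv /= => /andP[? ?]; apply/andP; split; lra.
  + by move=> [_ /=]; rewrite in_itv /= => /andP[? ?]; apply/andP; split; lra.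
- rewrite measureU//; last 2 first.
  + exact: measurableU.
  + apply/seteqP; split=> // -[u v] [[/Ub|[_]] /= + [_]] /=; rewrite ?in_itv /=.
      by move=> /andP[? ?] /andP[? ?]; lra.
    by move=> /andP[? ?] /andP[? ?]; lra.
  rewrite measureU//; last first.
    apply/seteqP; split=> // -[u v] [/Ub /= + [_]] /=; rewrite ?in_itv /=.
    by move=> /andP[? ?] /andP[? ?]; lra.
  rewrite -addeA; congr (_ + _)%E.
  transitivity (((x0 + c - (x0 - c)) * (y0 + b' - (y0 + b)))%:E +
      ((x0 + c - (x0 - c)) * (y0 - b - (y0 - b')))%:E)%E; last first.
    by rewrite -!EFinD; congr EFin; ring.
  by congr (_ + _)%E; apply: rectangle_measure; lra.
- move=> [u v] [[Uu|[]]|[]] /=; rewrite ?in_itv /=; first by left.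
    by move=> ? /andP[? ?]; right; split => //; apply/andP; split; lra.
  by move=> ? /andP[? ?]; right; split => //; apply/andP; split; lra.
Qed.

(* The staircase with corners at the Pythagorean points (12/13, 5/13) and
   (4/5, 3/5) and their mirror images has area 2348/845 > 25/9; the final
   numerical comparison needs a constant above 2.76. *)
Lemma disc_ge (x0 y0 s : R) : 0 <= s -> ((25 / 9 * s)%:E <= (lam \x lam) (disc x0 y0 s))%E.
Proof.
move=> s0; set r := Num.sqrt s.
have r0 : 0 <= r := sqrtr_ge0 s; have rs : r ^+ 2 = s by rewrite sqr_sqrtr.
have [p1 p2 p3 p4] : [/\ 0 <= 5 / 13 * r, 0 <= 3 / 5 * r, 0 <= 4 / 5 * r & 0 <= 12 / 13 * r] by split; lra.
have [q1 q2 q3] : [/\ 5 / 13 * r <= 3 / 5 * r, 3 / 5 * r <= 4 / 5 * r & 4 / 5 * r <= 12 / 13 * r] by split; lra.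
have b0 : forall u : R2, set0 u -> y0 - 0 <= u.2 < y0 + 0 by [].
have [U1 [m1 b1 e1 h1]] := stack_rectangles x0 measurable0 b0 (lexx 0) p1 p4.
have [U2 [m2 b2 e2 h2]] := stack_rectangles x0 m1 b1 p1 q1 p3.
have [U3 [m3 b3 e3 h3]] := stack_rectangles x0 m2 b2 p2 q2 p2.
have [U4 [m4 b4 e4 h4]] := stack_rectangles x0 m3 b3 p3 q3 p1.
apply: (@le_trans _ _ ((lam \x lam)%E U4)).
  rewrite e4 e3 e2 e1 measure0 add0e -!EFinD lee_fin -rs.
  clear e1 e2 e3 e4; nra.
clear e1 e2 e3 e4; apply: le_measure; rewrite ?inE//; first exact: measurable_disc.
move=> [u v] /h4[/h3[/h2[/h1[//|]|]|]|]; rewrite /disc /= -rs => -[/andP[? ?] /andP[? ?]]; nra.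
Qed.

End DiscArea.

Section SliceFormula.
Context d1 d2 (T1 : measurableType d1) (T2 : measurableType d2) {R : realType}.
Variables (m1 : {sigma_finite_measure set T1 -> \bar R}) (m2 : {sigma_finite_measure set T2 -> \bar R}).
Local Open Scope ereal_scope.

Lemma integral_slices (D : set (T1 * T2)) (g : T2 -> R) (mu1 : T2 -> \bar R) :
  measurable D -> measurable_fun D (fun v : T1 * T2 => g v.2) ->
  (forall v, D v -> 0 <= g v.2)%R -> (forall t, mu1 t = m1 [set u | D (u, t)]) ->
  measurable_fun setT (fun t => (g t)%:E * mu1 t) /\
  \int[m1 \x m2]_(v in D) (g v.2)%:E = \int[m2]_t ((g t)%:E * mu1 t).
Proof.
move=> mD mg g0 mu1E; rewrite integral_mkcond.
set f := (X in X \_ D).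
have fD0 v : 0 <= (f \_ D) v.
  by rewrite /patch; case: ifPn => // /set_mem /g0 v0; rewrite /f lee_fin.
have mf : measurable_fun setT (f \_ D).
  by apply/(measurable_restrictT _ mD); apply/measurable_EFinP.
have mS t : measurable [set u | D (u, t)].
  have -> : [set u | D (u, t)] = ysection D t.
    by apply/seteqP; split=> u; rewrite /ysection /= inE.
  exact: measurable_ysection.
have GE : fubini_G m1 (f \_ D) = (fun t => (g t)%:E * mu1 t).
  apply: funext => t; rewrite /fubini_G.
  rewrite (_ : (fun x => (f \_ D) (x, t)) = (cst (g t)%:E) \_ [set u | D (u, t)]); last first.
    apply: funext => u; rewrite /patch.
    have -> // : ((u, t) \in D) = (u \in [set u | D (u, t)]).
    by apply/idP/idP => h; apply/mem_set; exact: (set_mem h).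
  by rewrite -integral_mkcond integral_cst// mu1E.
rewrite -GE; split; first exact: measurable_fun_fubini_tonelli_G.
exact: fubini_tonelli2.
Qed.

End SliceFormula.

Section PlaneMeasure.
Context {R : realType}.
Local Notation R2 := (measurableTypeR R * measurableTypeR R)%type.

(* The library declares no canonical sigma-finite structure on a product of
   sigma-finite measures, hence this alias. *)
Definition plane_measure : set R2 -> \bar R := (lebesgue_measure \x lebesgue_measure)%E.

HB.instance Definition _ := Measure.on plane_measure.

Lemma plane_measure_sigma_finite : sigma_finite setT plane_measure.
Proof.
exists (fun n => [set` `[- n%:R, n%:R]] `*` [set` `[- n%:R, n%:R]]).
  apply/esym/seteqP; split=> // -[x y] _; exists (Num.truncn (`|x| + `|y|)).+1 => //.
  have h := truncnS_gt (`|x| + `|y|); rewrite /= !in_itv /=.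
  have hx := normr_ge0 x; have hy := normr_ge0 y.
  by rewrite -!ler_norml; split; apply: ltW; apply: le_lt_trans h; rewrite ?lerDl ?lerDr.
move=> n; split; first by apply: measurableX; exact: measurable_itv.
have n0 : (0 : R) <= n%:R by [].
rewrite /plane_measure rectangle_measure ?ltry//; lra.
Qed.

HB.instance Definition _ := Measure_isSigmaFinite.Build _ _ _ plane_measure
  plane_measure_sigma_finite.

End PlaneMeasure.

Section BallVolume.
Context {R : realType}.
Implicit Types (p q z w : H3 R).
Local Notation lam := (@lebesgue_measure R).
Local Notation R2 := (measurableTypeR R * measurableTypeR R)%type.
Local Notation R3 := (measurableTypeR R * measurableTypeR R * measurableTypeR R)%type.

Definition hball p (r : R) : set (H3 R) := [set z | hdist p z < r].

(** The inequality [kap < ch r] with denominators cleared: a polynomial on the whole space, hence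
    measurable, whose positivity forces positive height. *)
Definition ball_fun p (r : R) (v : R3) : R :=
  2 * (ch r - 1) * height p * v.2 - euclid_dist2 (coords p) v.

Lemma ball_fun_height p r (v : R3) : 0 < r -> 0 < ball_fun p r v -> 0 < v.2.
Proof.
move=> r0; rewrite /ball_fun => h.
have k1 : 0 < ch r - 1 by rewrite subr_gt0 -(@ch0 R) ch_lt.
have e0 : 0 <= euclid_dist2 (coords p) v by rewrite /euclid_dist2 !addr_ge0 ?sqr_ge0.
have kh : 0 < 2 * (ch r - 1) * height p by rewrite !mulr_gt0 ?height_gt0.
by rewrite -(pmulr_rgt0 _ kh); lra.
Qed.

Lemma coords_hball p r : 0 < r -> coords @` hball p r = [set v | 0 < ball_fun p r v].
Proof.
move=> r0; apply/seteqP; split=> [_ [z zr <-]|v vr].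
  move: zr; rewrite /hball /= hdist_lt_ch ?ltW// /kap /ball_fun => zr.
  have hz := height_gt0 z; have hp := height_gt0 p.
  have : euclid_dist2 (coords p) (coords z) / (2 * height p * height z) < ch r - 1 by lra.
  rewrite ltr_pdivrMr ?mulr_gt0// -/(height z); lra.
have v0 := ball_fun_height r0 vr.
have vs : v \in @upper_half_space R by apply/mem_set.
exists (exist _ v vs) => //; rewrite /hball /= hdist_lt_ch ?ltW// /kap.
have hp := height_gt0 p; set z : H3 R := exist _ v vs.
have hz := height_gt0 z.
have : euclid_dist2 (coords p) (coords z) / (2 * height p * height z) < ch r - 1.
  rewrite ltr_pdivrMr ?mulr_gt0//; move: vr; rewrite /ball_fun /=.
  have -> : v.2 = height z by [].
  have -> : euclid_dist2 (coords p) v = euclid_dist2 (coords p) (coords z) by [].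
  lra.
lra.
Qed.

Lemma measurable_ball_fun p r : measurable_fun [set: R3] (ball_fun p r).
Proof.
have m1 : measurable_fun [set: R3] (fun v : R3 => v.1.1 : R).
  exact: (measurableT_comp (@measurable_fst _ _ _ _) (@measurable_fst _ _ _ _)).
have m2 : measurable_fun [set: R3] (fun v : R3 => v.1.2 : R).
  exact: (measurableT_comp (@measurable_snd _ _ _ _) (@measurable_fst _ _ _ _)).
have m3 : measurable_fun [set: R3] (fun v : R3 => v.2 : R) by exact: measurable_snd.
have c (x : R) : measurable_fun [set: R3] (fun _ => x) by exact: measurable_cst.
rewrite /ball_fun /euclid_dist2.
exact: (measurable_funB (measurable_funM (c _) m3)
  (measurable_funD (measurable_funD (measurable_funX 2 (measurable_funB (c _) m1))
  (measurable_funX 2 (measurable_funB (c _) m2))) (measurable_funX 2 (measurable_funB (c _) m3)))).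
Qed.

Lemma hmeasurable_hball p r : 0 < r -> hmeasurable (hball p r).
Proof.
move=> r0; rewrite /hmeasurable coords_hball//.
have := measurable_ball_fun p r measurableT (measurable_itv `]0, +oo[); rewrite setTI.
by congr measurable; apply/seteqP; split=> u; rewrite /= in_itv /= andbT.
Qed.

Lemma slice_disc p r (t : R) :
  [set u : R2 | 0 < ball_fun p r (u, t)] =
  disc (coords p).1.1 (coords p).1.2 (2 * ch r * height p * t - height p ^+ 2 - t ^+ 2).
Proof.
apply/seteqP; split=> u; rewrite /disc /ball_fun /euclid_dist2 /= -/(height p); lra.
Qed.

Lemma measurable_inv_cube_itv : measurable_fun [set` `]0 : R, +oo[] (fun x : R => x ^- 3).
Proof.
apply: open_continuous_measurable_fun; first exact: interval_open.
move=> x; rewrite inE /= in_itv /= andbT => x0.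
have xn : x != 0 by rewrite gt_eqF.
have ci : {for x, continuous (fun u : R => u)} by exact: cvg_id.
exact: (@continuousV _ _ (fun u : R => u ^+ 3) x (expf_neq0 3 xn) (continuousM ci (continuousM ci ci))).
Qed.

Lemma measurable_inv_cube p r : 0 < r ->
  measurable_fun [set v : R3 | 0 < ball_fun p r v] (fun v : R3 => (v.2 ^- 3 : R)).
Proof.
move=> r0; have m3 : measurable_fun [set: R3] (fun v : R3 => v.2 : R) by exact: measurable_snd.
apply: (measurable_comp (measurable_itv `]0, +oo[) _ measurable_inv_cube_itv (measurable_funTS m3)).
by move=> _ [v vD <-]; rewrite /= in_itv /= andbT; exact: (ball_fun_height r0 vD).
Qed.

Definition slice_volume p (r t : R) : \bar R := ((t ^- 3)%:E * (lam \x lam)%E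
    (disc (coords p).1.1 (coords p).1.2 (2 * ch r * height p * t - height p ^+ 2 - t ^+ 2)))%E.

Lemma hvolume_hball p r : 0 < r ->
  measurable_fun setT (slice_volume p r) /\
  (hvolume (hball p r) = \int[lam]_t slice_volume p r t)%E.
Proof.
move=> r0; rewrite /hvolume coords_hball//.
have := @integral_slices _ _ _ _ R plane_measure lam
  [set v | 0 < ball_fun p r v] (fun t => t ^- 3) (fun t => (lam \x lam)%E (disc (coords p).1.1
  (coords p).1.2 (2 * ch r * height p * t - height p ^+ 2 - t ^+ 2))).
case.
- by rewrite -coords_hball//; exact: hmeasurable_hball.
- exact: measurable_inv_cube.
- by move=> v /(ball_fun_height r0) v0; rewrite invr_ge0 exprn_ge0// ltW.
- by move=> t; rewrite slice_disc.
- move=> H1 H2; split.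
    exact: H1.
  exact: H2.
Qed.

Lemma slice_factor (k t0 r t : R) : k = ch r ->
  2 * k * t0 * t - t0 ^+ 2 - t ^+ 2 = (t - t0 * expR (- r)) * (t0 * expR r - t).
Proof. by move=> ->; have := expR_mulVN r; rewrite /ch => e; nra. Qed.

Lemma slice_weightE (k t0 t : R) :
  slice_weight k t0 t = t ^- 3 * (2 * k * t0 * t - t0 ^+ 2 - t ^+ 2).
Proof. by rewrite /slice_weight exprVn mulrC. Qed.

Lemma slice_nonpos p r t : 0 < r ->
  t \notin `[height p * expR (- r), height p * expR r] -> slice_volume p r t = 0%E.
Proof.
move=> r0; rewrite in_itv /= negb_and -!ltNge => h.
rewrite /slice_volume (slice_factor _ _ erefl).
have hp := height_gt0 p.
have ab : height p * expR (- r) < height p * expR r by rewrite ltr_pM2l// ltr_expR; lra.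
rewrite (_ : disc _ _ _ = set0) ?measure0 ?mule0//.
apply/seteqP; split=> // u; rewrite /disc /=.
have := sqr_ge0 (u.1 - (coords p).1.1); have := sqr_ge0 (u.2 - (coords p).1.2).
move: h; set a := height p * expR (- r) in ab *; set b := height p * expR r in ab *.
move=> /orP[h|h]; nra.
Qed.

Lemma slice_volume_bounds p r t : 0 < r ->
  t \in `[height p * expR (- r), height p * expR r] ->
  ((25 / 9 * slice_weight (ch r) (height p) t)%:E <= slice_volume p r t)%E /\
  (slice_volume p r t <= (4 * slice_weight (ch r) (height p) t)%:E)%E.
Proof.
move=> r0; rewrite in_itv /= => /andP[ta tb]; have hp := height_gt0 p.
have a0 : 0 < height p * expR (- r) by rewrite mulr_gt0 ?expR_gt0.
have t0 : 0 < t := lt_le_trans a0 ta.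
have w0 : 0 <= t ^- 3 by rewrite invr_ge0 exprn_ge0// ltW.
have s0 : 0 <= 2 * ch r * height p * t - height p ^+ 2 - t ^+ 2.
  by rewrite (slice_factor _ _ erefl) mulr_ge0// subr_ge0.
rewrite /slice_volume slice_weightE; set s := _ - t ^+ 2 in s0 *.
rewrite (mulrCA (25 / 9)) (mulrCA 4) !(EFinM (t ^- 3)).
by split; apply: lee_wpmul2l; rewrite ?lee_fin//; [exact: disc_ge|exact: disc_le].
Qed.

(** The exact volume is pi times [sh (2 * r) - 2 * r]. Slicewise bounds on disc areas replace pi;
    the lower one enters all packings, the upper one serves the growth rate of balls. *)
Lemma hvolume_hball_bounds p r : 0 < r ->
  ((25 / 9 * (sh (2 * r) - 2 * r))%:E <= hvolume (hball p r))%E /\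
  (hvolume (hball p r) <= (4 * (sh (2 * r) - 2 * r))%:E)%E.
Proof.
move=> r0; have [mG ->] := hvolume_hball p r0; have hp := height_gt0 p.
set a := height p * expR (- r); set b := height p * expR r.
have a0 : 0 < a by rewrite mulr_gt0 ?expR_gt0.
have ab : a < b by rewrite ltr_pM2l// ltr_expR; lra.
have vE (c : R) : (\int[lam]_(t in `[a, b]) (c * slice_weight (ch r) (height p) t)%:E =
    (c * (sh (2 * r) - 2 * r))%:E)%E.
  by rewrite slice_integral// -EFinB -mulrBr slice_primitive_diff.
have mw (c : R) : measurable_fun [set` `[a, b]] (fun t => (c * slice_weight (ch r) (height p) t)%:E).
  apply/measurable_EFinP; apply: subspace_continuous_measurable_fun => //.
  apply: continuous_in_subspaceT => t /set_mem /=; rewrite in_itv /= => /andP[ta _].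
  by apply: slice_weight_continuous; exact: lt_le_trans ta.
have w0 (c t : R) : 0 <= c -> t \in `[a, b] -> (0 <= (c * slice_weight (ch r) (height p) t)%:E)%E.
  rewrite in_itv /= lee_fin slice_weightE => c0 /andP[ta tb].
  rewrite !mulr_ge0 ?invr_ge0 ?exprn_ge0//; first by rewrite ltW// (lt_le_trans a0).
  by rewrite (slice_factor _ _ erefl) mulr_ge0// subr_ge0.
have G0 t : (0 <= slice_volume p r t)%E.
  have [tab|tab] := boolP (t \in `[a, b]); last by rewrite slice_nonpos.
  by apply: le_trans (slice_volume_bounds r0 tab).1; apply: w0.
have -> : (\int[lam]_t slice_volume p r t = \int[lam]_(t in `[a, b]) slice_volume p r t)%E.
  rewrite [RHS]integral_mkcond; apply: eq_integral => t _; rewrite /patch; case: ifPn => // tab.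
  by rewrite slice_nonpos//; apply: contra tab => h; exact/mem_set.
have mG' := measurable_funTS (D := [set` `[a, b]]) mG.
split; rewrite -vE.
  apply: ge0_le_integral => //.
  - by move=> t tab; apply: w0.
  - exact: mw.
  - by move=> t tab; exact: (slice_volume_bounds r0 tab).1.
apply: ge0_le_integral => //; first exact: mw.
by move=> t tab; exact: (slice_volume_bounds r0 tab).2.
Qed.

Lemma hball_packing (n : nat) (c : 'I_n -> H3 R) (r : R) (A : set (H3 R)) :
  0 < r -> (forall i j, i != j -> 2 * r <= hdist (c i) (c j)) ->
  (forall i, hball (c i) r `<=` A) -> hmeasurable A ->
  ((n%:R * (25 / 9 * (sh (2 * r) - 2 * r)))%:E <= hvolume A)%E.
Proof.
move=> r0 sep cA mA.
pose B i : set R3 := coords @` hball (c i) r.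
have mB i : measurable (B i) by exact: hmeasurable_hball.
have tB : trivIset [set` enum 'I_n] B.
  move=> i j _ _ [_ [[z zi <-] [w wj /H3_eq zw]]]; apply/eqP; apply: contraT => ij.
  have := sep i j ij; rewrite leNgt => /negP[].
  apply: le_lt_trans (hdist_triangle z _ _) _.
  by move: zi wj; rewrite /hball /= zw => zi wj; rewrite (hdistC z); lra.
have pos (D : set (H3 R)) : forall v, (coords @` D) v -> (0 <= ((v.2 : R) ^- 3)%:E)%E.
  by move=> _ [z _ <-]; rewrite lee_fin invr_ge0 exprn_ge0// ltW// height_gt0.
have mfA : measurable_fun (coords @` A : set R3) (fun v : R3 => ((v.2 : R) ^- 3)%:E).
  apply/measurable_EFinP.
  have m3 : measurable_fun [set: R3] (fun v : R3 => v.2 : R) by exact: measurable_snd.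
  apply: (measurable_comp (measurable_itv `]0, +oo[) _ measurable_inv_cube_itv (measurable_funTS m3)).
  by move=> _ [v [z _ <-] <-]; rewrite /= in_itv /= andbT; exact: height_gt0.
have sub : \big[setU/set0]_(i <- enum 'I_n) B i `<=` coords @` A.
  move=> v; rewrite -bigcup_seq => -[i _ [z zi <-]]; exists z => //; exact: cA zi.
have mU : measurable (\big[setU/set0]_(i <- enum 'I_n) B i) by apply: bigsetU_measurable.
apply: le_trans (ge0_subset_integral _ mU mA mfA (pos A) sub).
rewrite ge0_integral_bigsetU//; last 3 first.
- exact: enum_uniq.
- exact: measurable_funS mfA.
- by move=> v /sub; exact: pos.
rewrite EFinM -[X in (X%:R)%:E](size_enum_ord n).
elim: (enum 'I_n) => [|i s IH]; first by rewrite big_nil mul0e.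
rewrite big_cons /= -natr1 EFinD muleDl// mul1e addeC; apply: leeD => //.
exact: (hvolume_hball_bounds (c i) r0).1.
Qed.

End BallVolume.

(** * Elements of small displacement commute *)

Section SinhBound.
Context {R : realType}.

Lemma sh_gt (x : R) : 0 < x -> x < sh x.
Proof.
move=> x0.
have d1 (t : R) : is_derive t 1 (fun u : R => expR (- u)) (expR (- t) * - 1).
  exact: (is_derive1_comp (is_derive_expR (- t)) (is_deriveN (is_derive_id t 1))).
have d (t : R) : is_derive t 1 (fun u : R => sh u - u) (ch t - 1).
  by have dt := d1 t; rewrite /sh; apply: is_derive_eq; rewrite /ch /GRing.scale /=; field.
have dc : {within `[0, x], continuous (fun u => sh u - u)}.
  apply: continuous_subspaceT => t; apply: differentiable_continuous.
  by apply/derivable1_diffP; exact: (@ex_derive _ _ _ _ _ _ _ (d t)).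
have [c c01 ce] := @MVT R (fun u => sh u - u) (fun u => ch u - 1) 0 x x0 (fun t _ => d t) dc.
have c0 : 0 < c by move: c01; rewrite in_itv /= => /andP[].
have : 1 < ch c by rewrite -(@ch0 R) ch_lt.
by move: ce; rewrite {2}/sh oppr0 expR0; nra.
Qed.

End SinhBound.

Section ReducedWords.

Lemma wreduced_winv (T : eqType) (w : seq (T * bool)) : wreduced w -> wreduced (winv w).
Proof.
rewrite /wreduced /winv rev_sorted sorted_map; apply: sub_sorted => -[x b] [y c] /=.
by rewrite eq_sym; case: b; case: c.
Qed.

Variable G : groupType.

(** Once common initial letters are removed, the inverse of [u] followed by [v] has no cancellation
    at the junction, so it is a nonempty reduced word of value [1]. *)
Lemma weval_reduced_inj (T : eqType) (f : T -> G) :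
  (forall w, wreduced w -> weval f w = 1%g -> w = [::]) ->
  forall u v, wreduced u -> wreduced v -> weval f u = weval f v -> u = v.
Proof.
move=> free; elim=> [|[x b] u IH] v ru rv.
  by rewrite weval_nil => /esym v1; rewrite (free v).
case: v rv => [|[y c] v] rv; first by rewrite weval_nil; exact: free.
have tl (w : seq (T * bool)) l : wreduced (l :: w) -> wreduced w.
  by rewrite /wreduced /=; exact: path_sorted.
have [[<- <-]|ne] := eqVneq (x, b) (y, c).
  by rewrite !weval_cons => /mulgI e; congr cons; apply: IH => //; [exact: tl ru|exact: tl rv].
move=> e; have : wreduced (winv ((x, b) :: u) ++ (y, c) :: v).
  have := wreduced_winv ru; rewrite /winv /= rev_cons /wreduced sorted_cat_cons => h.
  apply/andP; split; last by [].
  move: h ne; move: (rev _) => s h ne; rewrite -!cats1 -catA /=.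
  case: s h => [|l s] /=; rewrite ?andbT.
    by move=> _; move: ne; rewrite xpair_eqE; case: (x == y) => //=; case: (b); case: (c).
  rewrite !rcons_path cat_path /= => /andP[-> ->] /=; rewrite andbT.
  by move: ne; rewrite xpair_eqE; case: (x == y) => //=; case: (b); case: (c).
move=> /free; rewrite weval_cat weval_inv e mulVg => /(_ erefl).
by move=> /(congr1 size); rewrite size_cat /= addnS.
Qed.

End ReducedWords.

Section WordCount.

(* The three letters that may follow [l] in a reduced word. *)
Definition next_letter (l : bool * bool) (i : 'I_3) : bool * bool :=
  if i == 0 :> nat then l else (~~ l.1, i == 1 :> nat).

Fixpoint word_of (l : bool * bool) (s : seq 'I_3) : seq (bool * bool) :=
  if s is i :: s' then next_letter l i :: word_of (next_letter l i) s' else [::].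

Lemma word_of_path l s :
  path (fun l m => ~~ ((l.1 == m.1) && (l.2 != m.2))) l (word_of l s).
Proof.
elim: s l => //= i s IH l; rewrite IH andbT /next_letter.
by case: ifP => _ /=; [rewrite !eqxx|case: l.1].
Qed.

Lemma word_of_reduced l s : wreduced (word_of l s).
Proof. exact: path_sorted (word_of_path l s). Qed.

Lemma word_of_inj l : injective (word_of l).
Proof.
move=> s; elim: s l => [|i s IH] l [|j t] //= [e1 e2].
have ij : i = j.
  apply: val_inj; move: e1; rewrite /next_letter /=.
  case: l {e2 IH} => [[] []] /=; case: i => [[|[|[|//]]]] ?; case: j => [[|[|[|//]]]] ? //=.
by rewrite ij; congr cons; apply: (IH (next_letter l j)); rewrite -{1}ij.
Qed.

Lemma size_word_of l s : size (word_of l s) = size s.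
Proof. by elim: s l => //= i s IH l; rewrite IH. Qed.

End WordCount.

Section Action.
Context {R : realType} (G : groupType) (act : G -> H3 R -> H3 R).
Implicit Types (z w : H3 R).

(** What the geometric argument retains of the deck group: from here the group is abstract.
    [act_finite] is proper discontinuity. *)
Record good_action : Prop := GoodAction {
  act1 : act 1%g = idfun;
  actM : forall a b, act (a * b)%g = act a \o act b;
  act_dist : forall a, preserves_dist (act a);
  act_finite : forall z (r : R), finite_set [set a | hdist z (act a z) <= r];
  act_free : forall a z, act a z = z -> a = 1%g;
  act_torsion : forall (a : G) (n : nat), (0 < n)%N -> (a ^+ n)%g = 1%g -> a = 1%g;
  act_kfree : k_free G 5
}.

Hypothesis HA : good_action.

Lemma actV a z w : hdist (act a^-1%g z) w = hdist z (act a w).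
Proof.
rewrite -[RHS](act_dist HA a^-1%g) -[act _ (act a w)]/((act a^-1%g \o act a) w) -(actM HA).
by rewrite mulVg (act1 HA).
Qed.

Lemma act_displacementV a z : hdist z (act a^-1%g z) = hdist z (act a z).
Proof. by rewrite hdistC actV. Qed.

Lemma act_separated z : exists2 r : R, 0 < r & forall a, a != 1%g -> 2 * r <= hdist z (act a z).
Proof.
have fin : finite_set [set a | hdist z (act a z) <= 1 /\ a != 1%g].
  by apply: sub_finite_set (act_finite HA z 1) => a [].
have [|e e0 eP] := finite_pos_lb (f := fun a => hdist z (act a z)) fin.
  move=> a [_ a1]; apply: hdist_gt0 => za.
  by move/eqP: a1; apply; exact: (act_free HA (esym za)).
exists (Num.min (e / 2) (1 / 2)); first by rewrite lt_min !divr_gt0.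
move=> a a1; have [h|h] := leP (hdist z (act a z)) 1.
  have := eP a (conj h a1).
  have : Num.min (e / 2) (1 / 2) <= e / 2 by rewrite ge_min lexx.
  lra.
have : Num.min (e / 2) (1 / 2) <= 1 / 2 by rewrite ge_min lexx orbT.
lra.
Qed.

Lemma weval_displacement (a b : G) z (d : R) (w : seq (bool * bool)) :
  hdist z (act a z) <= d -> hdist z (act b z) <= d ->
  hdist z (act (weval (fun c : bool => if c then a else b) w) z) <= (size w)%:R * d.
Proof.
move=> ha hb; elim: w => [|[c e] w IH]; first by rewrite weval_nil (act1 HA) hdistxx mul0r.
rewrite weval_cons (actM HA) /= -natr1 mulrDl mul1r addrC.
apply: le_trans (hdist_triangle (act (if e then if c then a else b else (if c then a else b)^-1)%g z) _ _) _.
rewrite (act_dist HA); apply: lerD => //.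
by case: e; rewrite ?act_displacementV; case: c.
Qed.

(* The orbit of [z] under the [3^n] words of length [n] lies in a ball of radius
   [n d], whose volume grows like [exp (2 n d)]. *)
Lemma short_elements_commute (a b : G) z :
  expR (2 * hdist z (act a z)) < 3 -> expR (2 * hdist z (act b z)) < 3 -> commute a b.
Proof.
move=> a3 b3; apply: contrapT => nab.
pose d := Num.max (hdist z (act a z)) (hdist z (act b z)).
have ad : hdist z (act a z) <= d by rewrite le_max lexx.
have bd : hdist z (act b z) <= d by rewrite le_max lexx orbT.
have d0 : 0 <= d := le_trans (hdist_ge0 _ _) ad.
have d3 : expR (2 * d) < 3 by rewrite /d maxEle; case: ifP.
have [r r0 sep] := act_separated z.
pose ab := fun c : bool => if c then a else b.
pose l0 := (true, true).
have v0 : 0 < 25 / 9 * (sh (2 * r) - 2 * r).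
  by rewrite mulr_gt0// subr_gt0 sh_gt// mulr_gt0.
set v := 25 / 9 * _ in v0.
have free (w : seq (bool * bool)) : wreduced w -> weval ab w = 1%g -> w = [::].
  by apply: noncommuting_pair_free => //; exact: act_kfree.
have count n : (3 ^ n)%:R * v <= 2 * expR (4 * r) * expR (2 * d) ^+ n.
  pose c (i : 'I_#|{: n.-tuple 'I_3}|) := act (weval ab (word_of l0 (enum_val i))) z.
  have nd0 : 0 <= n%:R * d by rewrite mulr_ge0.
  have Rn : 0 < n%:R * d + 2 * r by rewrite ltr_wpDl// mulr_gt0.
  have pack : ((#|{: n.-tuple 'I_3}|%:R * v)%:E <= hvolume (hball z (n%:R * d + 2 * r)%R))%E.
    apply: (@hball_packing _ _ c) => //.
    - move=> i j ij; rewrite /c -actV -[act _ (act _ z)]/((act _ \o act _) z) -(actM HA).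
      rewrite hdistC; apply: sep; apply: contra ij => /eqP e1; apply/eqP.
      have /(weval_reduced_inj free) e2 : weval ab (word_of l0 (enum_val i)) = weval ab (word_of l0 (enum_val j)).
        by rewrite -[LHS](mulKVg (weval ab (word_of l0 (enum_val j)))) e1 mulg1.
      apply: enum_val_inj; apply: val_inj; apply: (@word_of_inj l0).
      by apply: e2; exact: word_of_reduced.
    - move=> i w; rewrite /hball /= => wi.
      apply: le_lt_trans (hdist_triangle (c i) _ _) _.
      have := @weval_displacement a b z d (word_of l0 (enum_val i)) ad bd.
      rewrite size_word_of size_tuple -/ab -/(c i); lra.
    - exact: hmeasurable_hball.
  have [_ up] := hvolume_hball_bounds z Rn.
  have := le_trans pack up; rewrite lee_fin card_tuple card_ord => h.
  apply: le_trans h _.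
  have e : expR (2 * (n%:R * d + 2 * r)) = expR (4 * r) * expR (2 * d) ^+ n.
    by rewrite -expRM_natl -expRD; congr expR; ring.
  rewrite -mulrA -e /sh; set x := 2 * (n%:R * d + 2 * r).
  have : 0 < x by rewrite mulr_gt0.
  have := expR_gt0 (- x); lra.
(* By the Bernoulli inequality [(1 + h) ^+ n] is at least [1 + n * h], which outgrows the constant
   bound left by [count]. *)
pose h := 3 / expR (2 * d) - 1.
have e0 := expR_gt0 (2 * d).
have h0 : 0 < h by rewrite /h subr_gt0 ltr_pdivlMr ?mul1r.
have pw n : 1 + n%:R * h <= (3 / expR (2 * d)) ^+ n.
  have -> : 3 / expR (2 * d) = 1 + h by rewrite /h; lra.
  elim: n => [|n IH]; first by rewrite mul0r addr0 expr0.
  rewrite exprS -natr1; have n0 : (0 : R) <= n%:R by [].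
  have : 0 <= n%:R * h by rewrite mulr_ge0// ltW.
  nra.
pose K := 2 * expR (4 * r) / v.
have bound n : n%:R * h <= K.
  apply: le_trans (_ : 1 + n%:R * h <= _); first by rewrite lerDr.
  apply: le_trans (pw n) _; rewrite expr_div_n ler_pdivrMr ?exprn_gt0//.
  rewrite /K mulrAC ler_pdivlMr//; have := count n; rewrite natrX //.
have [N NK] : exists N : nat, K / h < N%:R.
  by exists (Num.truncn (K / h)).+1; exact: truncnS_gt.
have := bound N; rewrite leNgt => /negP[]; rewrite -ltr_pdivrMr//.
Qed.

End Action.

(** * Fixed points at infinity *)

Section NullVectors.
Context {R : realType}.
Implicit Types (p q z : H3 R) (u v w : 'rV[R]_4).

(** On the opposite sheet [c * c'] is negative, and the identity [e] then makes the product with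
    [J p] positive. *)
Lemma hyperboloid_intro u p : mform u u = -1 -> mform (J p) u < 0 -> hyperboloid u.
Proof.
move=> uu pu; split => //; rewrite ltNge; apply/negP => u2.
have [] := J_hyperboloid p; move: uu pu; rewrite /mform.
set a := u ord0 i0; set b := u ord0 i1; set c := u ord0 i2 in u2 *; set d := u ord0 i3.
set a' := J p ord0 i0; set b' := J p ord0 i1; set c' := J p ord0 i2; set d' := J p ord0 i3.
move=> uu pu pp c'0.
have cd : c * d = 1 + a ^+ 2 + b ^+ 2 by lra.
have cd' : c' * d' = 1 + a' ^+ 2 + b' ^+ 2 by lra.
have c0 : c < 0.
  rewrite lt_neqAle u2 andbT; apply/eqP => ce; move: cd; rewrite ce mul0r.
  by have := sqr_ge0 a; have := sqr_ge0 b; lra.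
have h : 0 < c' ^+ 2 + c ^+ 2 + (c' * a - c * a') ^+ 2 + (c' * b - c * b') ^+ 2.
  by have := sqr_ge0 (c' * a - c * a'); have := sqr_ge0 (c' * b - c * b'); nra.
have e : c' ^+ 2 + c ^+ 2 + (c' * a - c * a') ^+ 2 + (c' * b - c * b') ^+ 2 =
    c * c' * (c * d' + c' * d - 2 * (a * a' + b * b')).
  transitivity (c' ^+ 2 * (1 + a ^+ 2 + b ^+ 2) + c ^+ 2 * (1 + a' ^+ 2 + b' ^+ 2)
    - 2 * c * c' * (a * a' + b * b')); first by ring.
  by rewrite -cd -cd'; ring.
have cc : c * c' < 0 by rewrite nmulr_rlt0.
move: h; rewrite e nmulr_rgt0// => h; lra.
Qed.

(** A point at infinity with a scale: [- mform (J p) v] is the exponential of a Busemann function of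
    [p]. *)
Definition nullv v := mform v v = 0 /\ forall p, mform (J p) v < 0.

(** If the sign failed at [p], some combination of [J z] and [J p] orthogonal to [v] would be
    timelike; a null vector orthogonal to a timelike one vanishes. *)
Lemma nullv_intro v z : mform v v = 0 -> mform (J z) v < 0 -> nullv v.
Proof.
move=> vv zv; split => // p; rewrite ltNge; apply/negP => pv.
set x := mform (J z) v in zv; set y := mform (J p) v in pv.
pose q := y *: J z - x *: J p.
have qv : mform q v = 0 by rewrite /q !mformE -/x -/y; ring.
have qq : mform q q = - (x ^+ 2 + y ^+ 2 - 2 * x * y * kap z p).
  by rewrite /q !mformE !mformJ !kapxx (kapC p z); ring.
have k1 := kap_ge1 z p.
have N0 : 0 < x ^+ 2 + y ^+ 2 - 2 * x * y * kap z p.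
  have : x * y <= 0 by rewrite nmulr_rle0.
  have : 0 < x ^+ 2 by rewrite lt_neqAle eq_sym sqrf_eq0 sqr_ge0 andbT lt_eqF.
  have := sqr_ge0 y; nra.
set N := x ^+ 2 + _ - _ in qq N0.
have s0 : 0 < Num.sqrt N by rewrite sqrtr_gt0.
have ss : Num.sqrt N ^+ 2 = N by rewrite sqr_sqrtr// ltW.
pose u := (Num.sqrt N)^-1 *: q.
have hu : hyperboloid u.
  apply: (@hyperboloid_intro u z).
    rewrite /u mformZl mformZr qq mulrA -invfM -expr2 ss mulrN mulVf// gt_eqF//.
  rewrite /u mformZr pmulr_rlt0 ?invr_gt0//.
  rewrite /q !mformE !mformJ kapxx; nra.
have v0 : v = 0.
  by apply: (mform_orth_eq0 hu) => //; rewrite /u mformZl qv mulr0.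
by move: zv; rewrite /x v0 /mform !mxE !mulr0 addr0 mul0r subr0 ltxx.
Qed.

Lemma nullv_mform v w : nullv v -> nullv w -> mform v w <= 0.
Proof.
move=> [vv pv] [ww pw]; pose p : H3 R := base_point.
have v0 := pv p; have w0 := pw p; set b := mform _ v in v0; set g := mform _ w in w0.
pose u := g *: v - b *: w.
have : 0 <= mform u u.
  by apply: (mform_orth_ge0 (J_hyperboloid p)); rewrite /u !mformE -/b -/g; ring.
rewrite /u !mformE vv ww (mformC w v).
have bg : 0 < b * g by rewrite nmulr_rgt0.
nra.
Qed.

Lemma nullv_parallel v w : nullv v -> nullv w -> mform v w = 0 ->
  exists2 s, 0 < s & w = s *: v.
Proof.
move=> [vv pv] [ww pw] vw; pose p : H3 R := base_point.
have v0 := pv p; have w0 := pw p; set b := mform _ v in v0; set g := mform _ w in w0.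
pose u := g *: v - b *: w.
have u0 : u = 0.
  apply: (mform_orth_eq0 (J_hyperboloid p)); first by rewrite /u !mformE -/b -/g; ring.
  by rewrite /u !mformE vv ww (mformC w v) vw; ring.
have bn : b != 0 by rewrite lt_eqF.
exists (g / b); first by rewrite nmulr_rgt0 ?invr_lt0.
move/eqP: u0; rewrite /u subr_eq0 => /eqP h.
by rewrite mulrC -scalerA h scalerA mulVf// scale1r.
Qed.

End NullVectors.

Section Eigenvectors.
Context {R : realType} (G : groupType) (act : G -> H3 R -> H3 R).
Hypothesis HA : good_action act.
Implicit Types (p q z : H3 R) (u v w : 'rV[R]_4) (a b c : G).

Local Notation L a := (lin (act a)).

Lemma linM a b : L (a * b)%g = L b *m L a.
Proof. by rewrite (actM HA) lin_comp//; exact: act_dist. Qed.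

Lemma lin_nullv a v : nullv v -> nullv (v *m L a).
Proof.
move=> [vv pv]; apply: (@nullv_intro _ _ (act a base_point)).
  by rewrite lin_mform//; exact: act_dist.
by rewrite -lin_J ?lin_mform//; exact: (act_dist HA).
Qed.

(** For vectors that are not parallel, invariance of [mform v w] forces [r = 1]. The normalized sum
    [v + w] is then a point of the hyperboloid fixed by [a], which freeness excludes. *)
Lemma null_eigen_unique a v w (r : R) : a != 1%g -> nullv v -> nullv w ->
  v *m L a = r *: v -> w *m L a = r *: w -> exists2 s, 0 < s & w = s *: v.
Proof.
move=> a1 nv nw va wa.
have [vw|vw] := eqVneq (mform v w) 0; first exact: nullv_parallel.
have vw0 : mform v w < 0 by rewrite lt_neqAle vw nullv_mform.
have r2 : r ^+ 2 = 1.
  apply: (mulIf vw); rewrite mul1r -[RHS](lin_mform v w (act_dist HA a)) va wa.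
  by rewrite mformZl mformZr; ring.
have r0 : 0 < r.
  have [_ /(_ base_point)] := lin_nullv a nv; rewrite va mformZr.
  have := nv.2 base_point; nra.
have r1 : r = 1 by have : (r - 1) * (r + 1) = 0; [lra|move/eqP; rewrite mulf_eq0 => /orP[/eqP|/eqP]; lra].
have e0 : 0 < - 2 * mform v w by lra.
have s0 : 0 < Num.sqrt (- 2 * mform v w) by rewrite sqrtr_gt0.
have ss : Num.sqrt (- 2 * mform v w) ^+ 2 = - 2 * mform v w by rewrite sqr_sqrtr// ltW.
pose u := (Num.sqrt (- 2 * mform v w))^-1 *: (v + w).
have hu : hyperboloid u.
  apply: (@hyperboloid_intro _ u base_point); last first.
    rewrite /u mformZr mformDr pmulr_rlt0 ?invr_gt0//.
    by have := nv.2 base_point; have := nw.2 base_point; lra.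
  rewrite /u mformZl mformZr mformDl !mformDr nv.1 nw.1 (mformC w v) add0r addr0.
  rewrite mulrA -invfM -expr2 ss.
  by field; rewrite vw.
exfalso; move/eqP: a1; apply; apply: (act_free HA (z := of_J u)).
apply: J_inj; rewrite -lin_J ?of_JK//; last exact: (act_dist HA).
by rewrite /u -scalemxAl mulmxDl va wa r1 !scale1r.
Qed.

Lemma commuting_eigen a b v (r : R) : a != 1%g -> commute a b -> nullv v ->
  v *m L a = r *: v -> exists2 s, 0 < s & v *m L b = s *: v.
Proof.
move=> a1 cab nv va; apply: (null_eigen_unique a1 nv (lin_nullv b nv) va).
by rewrite -mulmxA -linM cab linM mulmxA va -scalemxAl.
Qed.

End Eigenvectors.

Section NullEigenvector.
Context {R : realType}.

Lemma finite_argmax (T : Type) (A : set T) (f : T -> R) x0 : finite_set A -> A x0 ->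
  exists2 x, A x & forall y, A y -> f y <= f x.
Proof.
move=> fA Ax0; have /finite_seqP[s sE] := finite_image f fA.
have [m ms mP] : exists2 m, (m \in s) || (m == f x0) & forall y, y \in s -> y <= m.
  elim: s {sE} => [|y s [m ms mP]]; first by exists (f x0); rewrite ?eqxx.
  have [my|ym] := leP m y.
    exists y; first by rewrite mem_head.
    move=> u; rewrite inE => /orP[/eqP -> //|/mP um]; exact: le_trans my.
  exists m; first by rewrite inE -orbA ms orbT.
  by move=> u; rewrite inE => /orP[/eqP ->|/mP //]; exact: ltW.
have fs x : A x -> f x \in s by move=> Ax; have : (f @` A) (f x) by [exists x]; rewrite sE.
have {}ms : m \in s by case/orP: ms => // /eqP ->; exact: fs.
have : [set` s] m by [].
by rewrite -sE => -[x Ax fx]; exists x => // y /fs /mP; rewrite fx.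
Qed.

Lemma near_oo_imply (P Q : nat -> Prop) : (\forall n \near \oo, P n) ->
  (forall n, P n -> Q n) -> \forall n \near \oo, Q n.
Proof. by move=> [N N0 NP] PQ; exists N => // n /NP; exact: PQ. Qed.

(** Compactness yields only a cluster point; a scalar quantity converging along the sequence still
    takes its limit there. *)
Lemma cluster_limit (T : topologicalType) (u : nat -> T) (v : T) (f : T -> R) (l : R) :
  cluster (u @ \oo) v -> {for v, continuous f} ->
  (forall e, 0 < e -> \forall n \near \oo, `|f (u n) - l| < e) -> f v = l.
Proof.
move=> cv cf fl; apply/eqP; rewrite -subr_eq0 -normr_eq0; apply/eqP.
apply: contrapT => /eqP ne.
have n0 : 0 < `|f v - l| / 2 by rewrite divr_gt0// lt_neqAle eq_sym ne normr_ge0.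
have /cvgrPdist_lt /(_ _ n0) cf' := cf.
have [w [fw vw]] := cv [set w | `|f w - l| < `|f v - l| / 2] _ (fl _ n0) cf'.
have : `|f v - l| <= `|f v - f w| + `|f w - l|.
  by rewrite (_ : f v - l = (f v - f w) + (f w - l)) ?ler_normD//; ring.
have w1 : `|f w - l| < `|f v - l| / 2 by exact: fw.
have w2 : `|f v - f w| < `|f v - l| / 2 by exact: vw.
lra.
Qed.

End NullEigenvector.

Section EigenvectorExistence.
Context {R : realType} (G : groupType) (act : G -> H3 R -> H3 R).
Hypothesis HA : good_action act.
Implicit Types (p q z : H3 R) (u v w : 'rV[R]_4) (a b c : G).

Lemma orbit_escapes a (z : H3 R) (K : R) : a != 1%g ->
  \forall n \near \oo, K < hdist z (act (a ^+ n)%g z).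
Proof.
move=> a1; pose A := [set n | hdist z (act (a ^+ n)%g z) <= K].
have fA : finite_set A.
  apply: (finite_set_inj (act_finite HA z K) (f := fun n => (a ^+ n)%g)) => // n m _ _ e.
  wlog nm : n m e / (n <= m)%N.
    by move=> h; have [nm|mn] := leqP n m; [exact: h|apply/esym/h => //; exact: ltnW].
  apply/eqP; rewrite eqn_leq nm leqNgt; apply/negP => lnm.
  move/eqP: a1; apply; apply: (act_torsion HA (n := m - n)); first by rewrite subn_gt0.
  by apply: (mulgI (a ^+ n)%g); rewrite mulg1 -expgnDr subnKC// e.
have [N NP] : exists N, forall n, A n -> (n <= N)%N.
  have [[n0 An0]|nA] := pselect (exists n, A n); last by exists 0%N => n An; exfalso; apply: nA; exists n.
  have [N _ NP] := finite_argmax (fun n => n%:R : R) fA An0.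
  by exists N => n /NP; rewrite ler_nat.
exists N.+1 => // n /= Nn; rewrite ltNge; apply/negP => /NP; by rewrite leqNgt Nn.
Qed.

(** The vectors [J (z n)], divided by their growing size [H n], cluster at some [v]. Since [a]
    commutes with its powers, the product of [u n] with its image is minus the constant
    [kap o (act a o)] over [H n ^+ 2]. In the limit [v] is null and orthogonal to its image, hence
    parallel to it. *)
Lemma null_eigenvector a : a != 1%g -> exists2 v, nullv v &
  exists2 r, 0 < r & v *m lin (act a) = r *: v.
Proof.
move=> a1; pose o : H3 R := frame i0; pose z n := act (a ^+ n)%g o.
pose H n := kap o (z n); pose u n := (H n)^-1 *: J (z n).
have H1 n : 1 <= H n := kap_ge1 _ _.
have Hp n : 0 < H n := lt_le_trans ltr01 (H1 n).
have Hinf (K : R) : \forall n \near \oo, K < H n.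
  apply: (near_oo_imply (orbit_escapes o (2 * `|K|) a1)) => n; rewrite -/(z n) => h.
  rewrite /H kapE /ch; have := expR_ge1Dx (hdist o (z n)).
  by have := expR_gt0 (- hdist o (z n)); have := ler_norm K; lra.
have small (k e : R) : 0 <= k -> 0 < e -> \forall n \near \oo, k * (H n)^-1 ^+ 2 < e.
  move=> k0 e0; apply: (near_oo_imply (Hinf (k / e))) => n h.
  have Hi1 : (H n)^-1 <= 1 by rewrite invf_le1.
  have Hi0 : 0 < (H n)^-1 by rewrite invr_gt0.
  have : k * (H n)^-1 < e by rewrite ltr_pdivrMr// mulrC -ltr_pdivrMr.
  nra.
pose K := [set v : 'rV[R]_4 | forall j, [set` `[(-2 : R), 2]] (v ord0 j)].
have cK : compact K by exact: (@rV_compact R 4 (fun=> [set` `[(-2 : R), 2]]) (fun=> @segment_compact R (-2) 2)).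
have uK n : K (u n).
  move=> j; rewrite /= in_itv /= -ler_norml /u mxE normrM ger0_norm ?invr_ge0 ?(ltW (Hp n))//.
  by rewrite mulrC ler_pdivrMr//; exact: J_bound.
have FK : (u @ \oo) K by exists 0%N => // n _; exact: uK.
have [v [Kv cv]] := cK (u @ \oo) _ FK.
have c j : continuous (fun u : 'rV[R]_4 => u ord0 j) by exact: coord_continuous.
have cst (x : R) : continuous (fun _ : 'rV[R]_4 => x) by exact: cst_continuous.
have cM (N : 'M[R]_4) j : continuous (fun u : 'rV[R]_4 => (u *m N) ord0 j).
  have -> : (fun u : 'rV[R]_4 => (u *m N) ord0 j) = fun u => u ord0 i0 * N i0 j + u ord0 i1 * N i1 j
      + u ord0 i2 * N i2 j + u ord0 i3 * N i3 j.
    by apply: funext => w; rewrite mxE sum4.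
  move=> w; exact: (continuousD (continuousD (continuousD (continuousM (c i0 w) (cst _ w))
    (continuousM (c i1 w) (cst _ w))) (continuousM (c i2 w) (cst _ w))) (continuousM (c i3 w) (cst _ w))).
have cB (f g : 'I_4 -> 'rV[R]_4 -> R) w : (forall j, continuous (f j)) -> (forall j, continuous (g j)) ->
    {for w, continuous (fun u => f i0 u * g i0 u + f i1 u * g i1 u - (f i2 u * g i3 u + f i3 u * g i2 u) / 2)}.
  move=> cf cg.
  exact: (continuousB (continuousD (continuousM (cf _ w) (cg _ w)) (continuousM (cf _ w) (cg _ w)))
    (continuousM (continuousD (continuousM (cf _ w) (cg _ w)) (continuousM (cf _ w) (cg _ w))) (cst 2^-1 w))).
have vv : mform v v = 0.
  apply: (cluster_limit cv (f := fun u => mform u u)); first exact: (cB (fun j u => u ord0 j) (fun j u => u ord0 j)).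
  move=> e e0; apply: (near_oo_imply (small 1 e ler01 e0)) => n h.
  rewrite subr0 /u mformZl mformZr mformJJ mulrN1 mulrN normrN; rewrite mul1r in h.
  by rewrite ger0_norm -?expr2 ?sqr_ge0.
have vo : mform (J o) v = -1.
  apply: (cluster_limit cv (f := fun u => mform (J o) u)).
    exact: (cB (fun j u => J o ord0 j) (fun j u => u ord0 j)).
  move=> e e0; near=> n; rewrite /u mformZr mformJ -/(H n) mulrN mulVf ?gt_eqF//.
  by rewrite subrr normr0.
have nv : nullv v by apply: (nullv_intro vv (z := o)); rewrite vo; lra.
have vw : mform v (v *m lin (act a)) = 0.
  apply: (cluster_limit cv (f := fun u => mform u (u *m lin (act a)))).
    exact: (cB (fun j u => u ord0 j) (fun j u => (u *m lin (act a)) ord0 j)).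
  have k0 : 0 <= kap o (act a o) := le_trans ler01 (kap_ge1 _ _).
  move=> e e0; apply: (near_oo_imply (small _ e k0 e0)) => n h.
  rewrite subr0 /u -scalemxAl mformZl mformZr lin_J; last exact: (act_dist HA).
  have -> : act a (z n) = act (a ^+ n)%g (act a o).
    by rewrite /z -[LHS]/((act a \o act _) o) -(actM HA) -[RHS]/((act _ \o act a) o) -(actM HA) -expgS -expgSr.
  rewrite mformJ preserves_kap; last exact: (act_dist HA).
  rewrite !mulrN normrN mulrA mulrC -expr2 ger0_norm//.
  by rewrite mulr_ge0 ?sqr_ge0.
have [r r0 vr] := nullv_parallel nv (lin_nullv HA a nv) vw.
by exists v => //; exists r.
Unshelve. all: by end_near.
Qed.

End EigenvectorExistence.

(** * Connectedness of the thick part *)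

Section Chords.
Context {R : realType}.
Implicit Types (p q z : H3 R) (u v w : 'rV[R]_4) (P : H3 R -> Prop).

Definition on_chord z z' p := exists c d : R, [/\ 0 <= c, 0 <= d & J p = c *: J z + d *: J z'].

Definition loc_const_at P p := exists2 e : R, 0 < e & forall y, hdist p y < e -> (P y <-> P p).

Lemma on_chord_norm z z' p (c d : R) : J p = c *: J z + d *: J z' ->
  c ^+ 2 + d ^+ 2 + 2 * c * d * kap z z' = 1.
Proof.
move=> e; have := mformJJ p; rewrite e mformDl !mformDr !mformZl !mformZr !mformJ !kapxx (kapC z' z).
by move=> h; lra.
Qed.

Lemma on_chord_dist z z' p : on_chord z z' p -> hdist z p <= hdist z z'.
Proof.
move=> [c [d [c0 d0 e]]]; have n := on_chord_norm e.
rewrite hdist_le_ch ?hdist_ge0// -kapE.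
have -> : kap z p = c + d * kap z z'.
  by apply: oppr_inj; rewrite -mformJ e mformDr !mformZr !mformJ kapxx; ring.
have k1 := kap_ge1 z z'; set k := kap z z' in n k1 *.
have cd : 0 <= c * d * k by rewrite mulr_ge0 ?mulr_ge0// (le_trans ler01).
have d1 : d ^+ 2 <= 1 by have := sqr_ge0 c; lra.
rewrite -ler_sqr ?nnegrE; last 2 first.
- by rewrite addr_ge0// mulr_ge0// (le_trans ler01).
- by rewrite (le_trans ler01).
have k2 : 0 <= k ^+ 2 - 1 by rewrite subr_ge0 exprn_ege1.
have h : d ^+ 2 * (k ^+ 2 - 1) <= k ^+ 2 - 1 by rewrite ler_piMl.
have -> : (c + d * k) ^+ 2 = c ^+ 2 + d ^+ 2 + 2 * c * d * k + d ^+ 2 * (k ^+ 2 - 1) by ring.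
rewrite n; lra.
Qed.

(** The straight segment [u], rescaled by [r] onto the hyperboloid, is a continuous path covering
    the chord, so that [locally_constant] applies. *)
Lemma chord_connect P z z' : (forall p, on_chord z z' p -> loc_const_at P p) -> P z -> P z'.
Proof.
move=> lc; have k1 := kap_ge1 z z'; set k := kap z z' in k1.
pose u (s : R) := (1 - s) *: J z + s *: J z'.
pose N (s : R) := 1 + 2 * (s * (1 - s)) * (k - 1).
have uu s t : mform (u s) (u t) = - ((N s + N t) / 2 + (s - t) ^+ 2 * (k - 1)).
  rewrite /u mformDl !mformDr !mformZl !mformZr !mformJ !kapxx (kapC z' z) -/k /N.
  by field.
pose I s := (0 <= s) && (s <= 1 :> R).
have N1 s : I s -> 1 <= N s.
  move=> /andP[s0 s1]; rewrite /N lerDl; apply: mulr_ge0; last by rewrite subr_ge0.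
  by rewrite mulr_ge0// mulr_ge0// subr_ge0.
pose r (s : R) := Num.sqrt (N s).
have rr s : I s -> r s ^+ 2 = N s by move=> Is; rewrite sqr_sqrtr// (le_trans ler01 (N1 s Is)).
have r1 s : I s -> 1 <= r s.
  by move=> Is; rewrite -sqrtr1 ler_wsqrtr// N1.
have r0 s : I s -> 0 < r s by move=> Is; exact: lt_le_trans ltr01 (r1 s Is).
have hu s : I s -> hyperboloid ((r s)^-1 *: u s).
  move=> Is; apply: (@hyperboloid_intro _ _ z).
    rewrite mformZl mformZr uu subrr mulrA -invfM -expr2 rr//.
    have := lt_le_trans ltr01 (N1 s Is); move: (N s) => n n0.
    by field; rewrite gt_eqF.
  rewrite mformZr pmulr_rlt0 ?invr_gt0 ?r0// /u mformDr !mformZr !mformJ kapxx -/k.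
  by move/andP: Is => [s0 s1]; nra.
pose q (t : R) := of_J ((r (clamp_val t))^-1 *: u (clamp_val t)).
have Ic t : I (clamp_val t).
  by have := uval_bound (clamp t); rewrite uvalE.
have q0 : q 0 = z.
  apply: J_inj; rewrite of_JK; last exact: hu.
  have -> : clamp_val (0 : R) = 0 by rewrite /clamp_val min_l// maxxx.
  by rewrite /u /r /N subr0 !mul0r mulr0 mul0r addr0 sqrtr1 invr1 !scale1r scale0r addr0.
have q1 : q 1 = z'.
  apply: J_inj; rewrite of_JK; last exact: hu.
  have -> : clamp_val (1 : R) = 1 by rewrite /clamp_val minxx max_r.
  by rewrite /u /r /N subrr mulr0 mulr0 mul0r addr0 sqrtr1 invr1 !scale1r scale0r add0r.
have qc t : on_chord z z' (q t).
  have It := Ic t; have /andP[s0 s1] := It.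
  exists ((r (clamp_val t))^-1 * (1 - clamp_val t)), ((r (clamp_val t))^-1 * clamp_val t); split.
  - by apply: mulr_ge0; rewrite ?subr_ge0// invr_ge0 ltW// r0.
  - by apply: mulr_ge0 => //; rewrite invr_ge0 ltW// r0.
  - by rewrite of_JK; [rewrite /u scalerDr !scalerA|exact: hu].
have clip (s t : R) : `|clamp_val s - clamp_val t| <= `|s - t|.
  have := ler_norm (s - t); have := ler_norm (- (s - t)); rewrite normrN => a1 a2.
  have cs (x : R) : x <= 0 /\ clamp_val x = 0 \/ 0 <= x <= 1 /\ clamp_val x = x \/ 1 <= x /\ clamp_val x = 1.
    rewrite /clamp_val; have [x1|x1] := leP x 1.
      by have [x0|x0] := leP x 0; [left|right; left]; rewrite ?(ltW x0).
    by right; right; rewrite max_r// ltW.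
  rewrite ler_norml.
  case: (cs s) => [[s0 ->]|[[/andP[s0 s1] ->]|[s1 ->]]];
    case: (cs t) => [[t0 ->]|[[/andP[t0 t1] ->]|[t1 ->]]]; apply/andP; split; lra.
(* The first term bounds half the squared difference of the norms [r], the second is the quadratic
   term of [uu]; both are relative to the squared difference of the parameters. *)
pose K := (k - 1) ^+ 2 / 2 + (k - 1).
have K0 : 0 <= K by rewrite addr_ge0 ?subr_ge0// mulr_ge0 ?sqr_ge0// invr_ge0.
have kq s t : kap (q s) (q t) <= 1 + K * (clamp_val s - clamp_val t) ^+ 2.
  have -> : kap (q s) (q t) = (r (clamp_val s))^-1 * (r (clamp_val t))^-1 *
     ((N (clamp_val s) + N (clamp_val t)) / 2 + (clamp_val s - clamp_val t) ^+ 2 * (k - 1)).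
    by apply: oppr_inj; rewrite -mformJ !of_JK; [rewrite mformZl mformZr uu; ring|exact: hu|exact: hu].
  move: (Ic s) (Ic t); set x := clamp_val s; set y := clamp_val t => Ix Iy.
  have /andP[x0 x1] := Ix; have /andP[y0 y1] := Iy.
  have rx := r1 x Ix; have ry := r1 y Iy.
  rewrite -(rr x Ix) -(rr y Iy).
  have h : (r x - r y) ^+ 2 <= (k - 1) ^+ 2 * (x - y) ^+ 2.
    have e : (r x - r y) * (r x + r y) = 2 * (k - 1) * (x - y) * (1 - x - y).
      by rewrite -subr_sqr !rr// /N; ring.
    have : ((r x - r y) * (r x + r y)) ^+ 2 <= (2 * (k - 1) * (x - y)) ^+ 2.
      rewrite e exprMn ler_piMr ?sqr_ge0//.
      by rewrite -[leRHS](expr1n _ 2%N) -real_normK ?num_real// ler_sqr ?nnegrE// ler_norml; apply/andP; split; lra.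
    rewrite exprMn => h'.
    have : (r x - r y) ^+ 2 * 4 <= (r x - r y) ^+ 2 * (r x + r y) ^+ 2.
      by rewrite ler_wpM2l ?sqr_ge0//; nra.
    by rewrite !exprMn in h' *; lra.
  rewrite -invfM mulrC ler_pdivrMr; last by rewrite mulr_gt0 ?r0.
  have rxy : 1 <= r x * r y by nra.
  have : 0 <= K * (x - y) ^+ 2 * (r x * r y - 1).
    by rewrite mulr_ge0 ?subr_ge0// mulr_ge0 ?sqr_ge0.
  rewrite /K; lra.
move=> Pz; rewrite -q1; apply: (@locally_constant _ (fun t => P (q t)) _ 0); last by rewrite q0.
move=> t; have [e e0 he] := lc _ (qc t).
have th0 : 0 < ch e - 1 by rewrite subr_gt0 -ch0 ch_lt.
exists (Num.min 1 ((ch e - 1) / (K + 1))).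
  by rewrite lt_min ltr01 divr_gt0// ltr_wpDl.
move=> s; rewrite lt_min => /andP[s1 s2]; apply: he; rewrite hdist_lt_ch ?ltW//.
apply: le_lt_trans (kq t s) _; rewrite addrC -ltrBrDr.
have h := clip t s; set x := clamp_val t - _ in h *.
have {}s2 : `|t - s| * (K + 1) < ch e - 1 by rewrite -ltr_pdivlMr// ltr_wpDl.
rewrite -[x ^+ 2]real_normK ?num_real//.
have x0 := normr_ge0 x; set y := `|x| in h x0 *; set d := `|t - s| in s1 s2 h.
have h1 : 0 <= K * (y * (1 - y)) by rewrite mulr_ge0// mulr_ge0// subr_ge0; lra.
have h2 : 0 <= K * (d - y) by rewrite mulr_ge0// subr_ge0.
lra.
Qed.

(** An open [P] fails to be locally constant somewhere on a chord that leaves it, and such a point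
    is a frontier point no farther from [z'] than [z] is. *)
Lemma chord_boundary P z z' : P z -> ~ P z' ->
  (forall p, P p -> exists2 e : R, 0 < e & forall y, hdist p y < e -> P y) ->
  exists p, [/\ hdist z' p <= hdist z' z, ~ P p &
    forall e : R, 0 < e -> exists2 y, hdist p y < e & P y].
Proof.
move=> Pz nPz' oP; apply: contrapT => h; apply: nPz'.
apply: (@chord_connect P z) => // p pc.
have [Pp|nPp] := pselect (P p).
  by have [e e0 he] := oP p Pp; exists e => // y /he.
apply: contrapT => nlc; apply: h; exists p; split => //.
  have [c [d [c0 d0 e]]] := pc; apply: on_chord_dist; exists d, c; split => //.
  by rewrite addrC.
move=> e e0; apply: contrapT => h; apply: nlc; exists e => // y py; split => // Py.
by exfalso; apply: h; exists y.
Qed.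

End Chords.

Section Flow.
Context {R : realType} (v : 'rV[R]_4) (nv : nullv v).
Implicit Types (p q z w : H3 R).

(* [W z] spans the second null line of the plane of [v] and [J z], and [flow]
   moves [z] along the geodesic of that plane; it tends to [v] as [s] tends
   to [0]. *)
Definition beta z := - mform (J z) v.
Definition W z := J z - (2 * beta z)^-1 *: v.
Definition flow (s : R) z := of_J (s *: W z + (2 * beta z * s)^-1 *: v).

Lemma mform_comb (a b c d : R) (x y : 'rV[R]_4) :
  mform (a *: x + b *: v) (c *: y + d *: v) =
  a * c * mform x y + a * d * mform x v + b * c * mform y v.
Proof.
by rewrite mformDl !mformDr !mformZl !mformZr nv.1 (mformC v); ring.
Qed.

Lemma beta_gt0 z : 0 < beta z. Proof. by rewrite oppr_gt0; exact: nv.2. Qed.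

Lemma mform_Wv z : mform (W z) v = - beta z.
Proof. by rewrite /W mformDl mformNl mformZl nv.1 mulr0 subr0 /beta opprK. Qed.

Lemma W_nullv z : nullv (W z).
Proof.
have b0 := beta_gt0 z.
apply: (@nullv_intro _ _ z); last first.
  rewrite /W mformDr mformNr mformZr mformJJ -[mform (J z) v]opprK -/(beta z).
  have -> : -1 - (2 * beta z)^-1 * - beta z = -1/2 by field; rewrite gt_eqF.
  lra.
rewrite /W mformDl !mformDr !mformNl !mformNr !mformZl !mformZr mformJJ (mformC v) nv.1.
rewrite -[mform (J z) v]opprK -/(beta z).
by field; rewrite gt_eqF.
Qed.

Lemma J_flow s z : 0 < s -> J (flow s z) = s *: W z + (2 * beta z * s)^-1 *: v.
Proof.
move=> s0; have b0 := beta_gt0 z; apply: of_JK.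
apply: (@hyperboloid_intro _ _ z).
  rewrite mform_comb (W_nullv z).1 mform_Wv.
  by field; rewrite !gt_eqF.
rewrite mformDr !mformZr.
have h1 : s * mform (J z) (W z) < 0 by rewrite pmulr_rlt0//; exact: (W_nullv z).2.
have h2 : (2 * beta z * s)^-1 * mform (J z) v < 0.
  by rewrite pmulr_rlt0 ?nv.2// invr_gt0 !mulr_gt0.
lra.
Qed.

Lemma flow1 z : flow 1 z = z.
Proof. by apply: J_inj; rewrite J_flow// mulr1 scale1r /W subrK. Qed.

Lemma kap_flow s t z w : 0 < s -> 0 < t -> kap (flow s z) (flow t w) =
  - (s * t * mform (W z) (W w)) + (s * beta z / (t * beta w) + t * beta w / (s * beta z)) / 2.
Proof.
move=> s0 t0; have b0 := beta_gt0 z; have c0 := beta_gt0 w.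
apply: oppr_inj; rewrite -mformJ !J_flow// mform_comb !mform_Wv.
by field; rewrite !gt_eqF.
Qed.

(** This yields joint continuity of the flow. [kap z w] splits into a product of null vectors and a
    mean of [beta] ratios, each bounded by the arithmetic-geometric inequality; in [e] the
    subtracted sum is at least [2]. *)
Lemma kap_flow_le s t z w : 0 < s -> 0 < t ->
  kap (flow s z) (flow t w) <= s * t * (kap z w - 1) + (s / t + t / s) * kap z w - 1.
Proof.
move=> s0 t0; have b0 := beta_gt0 z; have c0 := beta_gt0 w.
have := kap_flow z w ltr01 ltr01; rewrite !flow1 !mul1r kap_flow//.
have mn := nullv_mform (W_nullv z) (W_nullv w); set m := mform _ _ in mn *.
set k := kap z w => kE.
have amgm (x y : R) : 0 < x -> 0 < y -> 2 <= x / y + y / x.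
  move=> x0 y0; have -> : x / y + y / x = 2 + (x - y) ^+ 2 / (x * y) by field; rewrite !gt_eqF.
  by rewrite lerDl mulr_ge0 ?sqr_ge0// invr_ge0 mulr_ge0// ltW.
have h1 : - m <= k - 1 by have := amgm _ _ b0 c0; lra.
have h2 : (beta z / beta w + beta w / beta z) / 2 <= k by lra.
have h3 := amgm _ _ (mulr_gt0 s0 c0) (mulr_gt0 t0 b0).
have e : s * beta z / (t * beta w) + t * beta w / (s * beta z) =
    (s / t + t / s) * (beta z / beta w + beta w / beta z)
    - (s * beta w / (t * beta z) + t * beta z / (s * beta w)).
  by field; rewrite !gt_eqF.
have h4 : s * t * - m <= s * t * (k - 1) by rewrite ler_wpM2l// mulr_ge0 ?ltW.
have h5 : (s / t + t / s) * ((beta z / beta w + beta w / beta z) / 2) <= (s / t + t / s) * k.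
  by rewrite ler_wpM2l//; have := amgm _ _ s0 t0; lra.
rewrite e; lra.
Qed.

End Flow.

Lemma addsmx_row (R : realType) (u v w : 'rV[R]_4) : (u <= v + w)%MS ->
  exists x y : R, u = x *: v + y *: w.
Proof.
move=> /sub_addsmxP[[x y] /= ->]; exists (x ord0 ord0), (y ord0 ord0).
by rewrite {1}[x]mx11_scalar {1}[y]mx11_scalar !mul_scalar_mx.
Qed.

Section Tube.
Context {R : realType} (G : groupType) (act : G -> H3 R -> H3 R).
Hypothesis HA : good_action act.
Variables (a : G) (v : 'rV[R]_4) (r : R).
Hypotheses (a1 : a != 1%g) (nv : nullv v) (va : v *m lin (act a) = r *: v).
Implicit Types (p q y z : H3 R) (c : G).
Local Notation L c := (lin (act c)).
Local Notation W := (W v).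
Local Notation flow := (flow v).

(** It vanishes exactly when [c] preserves the line of [W z], the second end of the geodesic that
    issues from [v] through [z]. *)
Definition shear c z := - mform (W z) (W z *m L c).
(** For [c] commuting with [a] this is [(t + t^-1) / 2], with [t] the eigenvalue of [c] on [v];
    reading it off at [base_point] avoids choosing [t]. *)
Definition base_shift c := kap base_point (act c base_point) - shear c base_point.

Lemma shear_ge0 c z : 0 <= shear c z.
Proof.
by rewrite oppr_ge0; apply: nullv_mform; [|apply: (lin_nullv HA)]; exact: W_nullv.
Qed.

Lemma displacement_flow c z s : commute a c -> 0 < s ->
  kap (flow s z) (act c (flow s z)) = base_shift c + s ^+ 2 * shear c z.
Proof.
move=> cac s0; have [t t0 vc] := commuting_eigen HA a1 cac nv va.
suff h z' s' : 0 < s' -> kap (flow s' z') (act c (flow s' z')) = (t + t^-1) / 2 + s' ^+ 2 * shear c z'.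
  by rewrite /base_shift -{1 2}[base_point](flow1 nv) !h//; ring.
move=> s'0; have b0 := beta_gt0 nv z'.
have hv : mform v (W z' *m L c) = - (beta v z' / t).
  have := lin_mform v (W z') (act_dist HA c); rewrite vc mformZl => e.
  by apply: (mulfI (lt0r_neq0 t0)); rewrite e mformC mform_Wv//; field; rewrite gt_eqF.
apply: oppr_inj; rewrite -mformJ -(lin_J _ (act_dist HA c)).
rewrite J_flow// mulmxDl -!scalemxAl vc scalerA mform_comb// mform_Wv// (mformC _ v) hv /shear.
by field; rewrite !gt_eqF.
Qed.

(** The invariant geodesic when [a] is loxodromic, empty when [a] is parabolic. *)
Definition axis z := shear a z = 0.

Lemma shear_eigen c z : shear c z = 0 -> exists2 s, 0 < s & W z *m L c = s *: W z.
Proof.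
move=> /eqP; rewrite oppr_eq0 => /eqP.
by apply: nullv_parallel; [|apply: (lin_nullv HA)]; exact: W_nullv.
Qed.

Lemma eigen_shear c z (s : R) : W z *m L c = s *: W z -> shear c z = 0.
Proof. by move=> e; rewrite /shear e mformZr (W_nullv nv z).1 mulr0 oppr0. Qed.

Lemma axis_shear c z : commute a c -> axis z -> shear c z = 0.
Proof.
move=> cac /shear_eigen[s _ e].
by have [t _ /eigen_shear] := commuting_eigen HA a1 cac (W_nullv nv z) e.
Qed.

Lemma shear_gt0 c z : c != 1%g -> commute a c -> ~ axis z -> 0 < shear c z.
Proof.
move=> c1 cac nz; rewrite lt_neqAle shear_ge0 andbT eq_sym; apply/eqP => /shear_eigen[s _ e].
apply: nz; have [t _] := commuting_eigen HA c1 (commute_sym cac) (W_nullv nv z) e.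
exact: eigen_shear.
Qed.

(** Pairing with [v] forces the eigenvalue of [a] on both [W z] and [W p] to be the inverse of [r],
    so by uniqueness these are parallel. *)
Lemma axis_span z p : axis z -> axis p -> (J p <= v + W z)%MS.
Proof.
move=> /shear_eigen[s s0 es] /shear_eigen[t t0 et].
have inv w x : w *m L a = x *: w -> mform v w != 0 -> r * x = 1.
  move=> e n; apply: (mulIf n); rewrite mul1r -[RHS](lin_mform v w (act_dist HA a)) va e.
  by rewrite mformZl mformZr; ring.
have n q : mform v (W q) != 0 by rewrite mformC mform_Wv// oppr_eq0 gt_eqF ?beta_gt0.
have st : s = t.
  have h := inv _ _ es (n z); have h' := inv _ _ et (n p).
  apply: (@mulfI _ r); last by rewrite h h'.
  by apply/eqP => r0; move: h; rewrite r0 mul0r => /eqP; rewrite eq_sym oner_eq0.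
have [x _ Wp] := null_eigen_unique HA a1 (W_nullv nv z) (W_nullv nv p) es (etrans et (congr1 (fun x => x *: _) (esym st))).
have -> : J p = x *: W z + (2 * beta v p)^-1 *: v by rewrite -Wp /W subrK.
by rewrite addmx_sub// scalemx_sub// ?addsmxSl ?addsmxSr.
Qed.

Lemma span_axis z p : axis z -> (J p <= v + W z)%MS -> axis p.
Proof.
move=> az /addsmx_row[x [y e]].
have Wp : W p = (x - (2 * beta v p)^-1) *: v + y *: W z by rewrite /W e scalerBl addrAC.
move: Wp; set x' := x - _ => Wp.
have h1 : y * beta v z = beta v p.
  apply: oppr_inj; rewrite -[in RHS](mform_Wv nv) Wp mformDl !mformZl nv.1 mform_Wv//; ring.
have y0 : y != 0 by apply/eqP => y0; have := beta_gt0 nv p; rewrite -h1 y0 mul0r ltxx.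
have h2 : x' * (y * beta v z) = 0.
  have := (W_nullv nv p).1; rewrite Wp addrC mform_comb// (W_nullv nv z).1 mform_Wv// => h; lra.
have x0 : x' = 0 by move/eqP: h2; rewrite h1 mulf_eq0 (gt_eqF (beta_gt0 nv p)) orbF => /eqP.
have [s _ es] := shear_eigen az.
by apply: (@eigen_shear _ _ s); rewrite Wp x0 scale0r add0r -scalemxAl es !scalerA mulrC.
Qed.

(* The axis spans a plane; a chord can be rerouted through a vector of the frame
   lying outside the space spanned by this plane and the two end points. *)
Lemma off_axis_connect P z z' : (forall p, ~ axis p -> loc_const_at P p) ->
  ~ axis z -> ~ axis z' -> P z -> P z'.
Proof.
move=> lc nz nz' Pz.
have [[p0 ap0]|na] := pselect (exists p, axis p); last first.
  by apply: (chord_connect _ Pz) => p _; apply: lc => ap; apply: na; exists p.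
pose U := (v + W p0)%MS.
have chord_off y y' : ~ axis y' -> ~ (J y <= U + J y')%MS -> forall p, on_chord y y' p -> ~ axis p.
  move=> ny' nyU p [c [d [_ _ e]]] ap; have pU := axis_span ap0 ap.
  have [c0|c0] := eqVneq c 0.
    apply: ny'; apply: (span_axis ap0); move: e; rewrite c0 scale0r add0r => e.
    have d0 : d != 0.
      by apply/eqP => d0; have := mformJJ p; rewrite e d0 scale0r -[0](scale0r v) mformZl mul0r => /eqP; rewrite eq_sym oppr_eq0 oner_eq0.
    by rewrite -[J y'](scalerK d0) -e scalemx_sub.
  apply: nyU; rewrite -[J y](scalerK c0) scalemx_sub//.
  have -> : c *: J y = J p - d *: J y' by rewrite e addrK.
  by rewrite addmx_sub ?eqmx_opp ?scalemx_sub ?addsmxSr// (submx_trans pU) ?addsmxSl.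
have swap y y' p : on_chord y y' p -> on_chord y' y p.
  by move=> [c [d [c0 d0 e]]]; exists d, c; split => //; rewrite addrC.
have [zU|zU] := pselect (J z' <= U + J z)%MS; last first.
  by apply: (chord_connect _ Pz) => p /swap pc; apply: lc; exact: (chord_off z' z).
(* [U] has rank at most two, so [U + J z] has rank at most three and misses a frame vector. It
   contains [U + J z'], so the chords from this vector to [z] and to [z'] both avoid the axis. *)
have [i iU] : exists i, ~ (J (frame i) <= U + J z)%MS.
  apply: contrapT => h; have {}h i : (J (frame i) <= U + J z)%MS.
    by apply: contrapT => hi; apply: h; exists i.
  have full : (1%:M <= U + J z)%MS.
    apply/row_subP => i; rewrite (frame_decomposition (row i 1%:M)).
    by apply: summx_sub => j _; rewrite scalemx_sub.
  have := mxrankS full; rewrite mxrank1.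
  have := mxrank_adds_leqif U (J z); have := mxrank_adds_leqif v (W p0).
  have := rank_leq_row v; have := rank_leq_row (W p0); have := rank_leq_row (J z).
  by rewrite -/U => ? ? ? [? _] [? _]; lia.
have nm : ~ axis (frame i).
  by move=> am; apply: iU; rewrite (submx_trans (axis_span ap0 am))// addsmxSl.
have Pm : P (frame i).
  by apply: (chord_connect _ Pz) => p /swap pc; apply: lc; exact: (chord_off (frame i) z).
apply: (chord_connect _ Pm) => p pc; apply: lc; apply: (chord_off (frame i) z') => // iU'.
apply: iU; apply: (submx_trans iU'); rewrite addsmx_sub addsmxSl/= //.
Qed.

End Tube.

Section ThickPart.
Context {R : realType} (G : groupType) (act : G -> H3 R -> H3 R).
Hypothesis HA : good_action act.
Variable mu : R.
Hypotheses (mu0 : 0 < mu)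
  (mu_comm : forall a b z, hdist z (act a z) < mu -> hdist z (act b z) < mu -> commute a b).
Implicit Types (p q y z : H3 R) (a b c : G).

(* [tube a] is the union of the thin parts of the elements of the (abelian)
   centralizer of [a]; [adjacent a] is the frontier of this tube. *)
Definition thick z := forall a, a != 1%g -> mu <= hdist z (act a z).

Definition tube a z := exists c, [/\ c != 1%g, commute a c & hdist z (act c z) < mu].

Definition adjacent a y := thick y /\ forall e : R, 0 < e -> exists2 z, hdist y z < e & tube a z.

Lemma displacement_lip c y z : hdist z (act c z) <= hdist y (act c y) + 2 * hdist y z.
Proof.
have := hdist_triangle y z (act c z); have := hdist_triangle (act c y) y (act c z).
by rewrite (act_dist HA) (hdistC z y); lra.
Qed.

Lemma short_open c y : hdist y (act c y) < mu ->
  exists2 e : R, 0 < e & forall z, hdist y z < e -> hdist z (act c z) < mu.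
Proof.
move=> h; exists ((mu - hdist y (act c y)) / 2); first by rewrite divr_gt0// subr_gt0.
by move=> z yz; have := displacement_lip c y z; lra.
Qed.

Lemma tube_open a y : tube a y -> exists2 e : R, 0 < e & forall z, hdist y z < e -> tube a z.
Proof.
by move=> [c [c1 cac /short_open[e e0 he]]]; exists e => // z /he; exists c.
Qed.

(** Only finitely many [c] displace [y] by at most [mu + 1], so the strict inequalities hold with a
    common margin. *)
Lemma tube_gap a y : (forall c, c != 1%g -> commute a c -> mu < hdist y (act c y)) ->
  exists2 e : R, 0 < e & forall z, hdist y z < e -> ~ tube a z.
Proof.
move=> h; pose A := [set c | hdist y (act c y) <= mu + 1 /\ (c != 1%g /\ commute a c)].
have fA : finite_set A by apply: sub_finite_set (act_finite HA y (mu + 1)) => c [].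
have [|e e0 he] := finite_pos_lb fA (f := fun c => hdist y (act c y) - mu).
  by move=> c [_ [c1 cac]]; rewrite subr_gt0 h.
exists (Num.min e 1 / 2); first by rewrite divr_gt0// lt_min e0 ltr01.
move=> z; rewrite ltr_pdivlMr// lt_min => /andP[ze z1] [c [c1 cac hc]].
have := displacement_lip c z y; rewrite (hdistC z y) => hl.
have /he : A c by split => //; lra.
lra.
Qed.

Lemma tube_commute a b y : b != 1%g -> a != 1%g -> hdist y (act b y) < mu ->
  tube a y -> commute b a.
Proof.
move=> b1 a1 hb [d [d1 cad hd]].
exact: (commute_trans (act_kfree HA) b1 d1 a1 (mu_comm hb hd) (commute_sym cad)).
Qed.

(** An element short at [y] is short at nearby points of the tube, hence commutes with [a]; this
    would put [y] in the tube. *)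
Lemma boundary_adjacent a y : a != 1%g -> ~ tube a y ->
  (forall e : R, 0 < e -> exists2 z, hdist y z < e & tube a z) -> adjacent a y.
Proof.
move=> a1 ny hy; split => // b b1; rewrite leNgt; apply/negP => hb.
have [e e0 he] := short_open hb; have [z yz tz] := hy e e0.
by apply: ny; exists b; split => //; apply: commute_sym; exact: tube_commute (he z yz) tz.
Qed.

Section Exit.
Variables (a : G) (v : 'rV[R]_4) (r : R).
Hypotheses (a1 : a != 1%g) (nv : nullv v) (va : v *m lin (act a) = r *: v).
Local Notation flow := (flow v).
Local Notation axis := (axis act a v).
Local Notation shear := (shear act v).
Local Notation shift := (base_shift act v).

Lemma short_flow c z s : commute a c -> 0 < s ->
  (hdist (flow s z) (act c (flow s z)) < mu) = (shift c + s ^+ 2 * shear c z < ch mu).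
Proof. by move=> cac s0; rewrite hdist_lt_ch ?ltW// (displacement_flow HA a1 nv va). Qed.

(* The displacement of [c] at [flow s z] is increasing in [s], so that each
   flow line leaves the tube exactly once. *)
Definition exits z s := 0 < s /\ forall t, 0 < t -> (tube a (flow t z) <-> t < s).

Lemma exits_unique z s t : exits z s -> exits z t -> s = t.
Proof.
move=> [s0 hs] [t0 ht]; have [st|ts|//] := ltgtP s t.
  by have := (hs s s0).1 ((ht s s0).2 st); rewrite ltxx.
by have := (ht t t0).1 ((hs t t0).2 ts); rewrite ltxx.
Qed.

Lemma exits_exists z : ~ axis z -> (exists y, tube a y) -> exists s, exits z s.
Proof.
move=> nz [y [c0 [c01 cac0 hc0]]].
(* [c] is short at [flow t z] exactly while [t ^+ 2 < th c]. The exit time is the square root of the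
   largest threshold, attained because finitely many [c] displace the point at time [t0] by at most
   [mu]. *)
pose th c := (ch mu - shift c) / shear c z.
have thE c t : c != 1%g -> commute a c -> 0 < t ->
    (hdist (flow t z) (act c (flow t z)) < mu) = (t ^+ 2 < th c).
  move=> c1 cac t0; rewrite short_flow// /th [RHS]ltr_pdivlMr; last exact: (shear_gt0 HA nv c1 cac nz).
  by rewrite ltrBrDl.
have th0 : 0 < th c0.
  rewrite divr_gt0 ?(shear_gt0 HA nv c01 cac0 nz)// subr_gt0.
  have := short_flow y cac0 ltr01; rewrite flow1// hc0 => /esym.
  by have := shear_ge0 HA nv c0 y; rewrite expr1n mul1r; lra.
pose t0 := Num.min 1 (th c0 / 2).
have t00 : 0 < t0 by rewrite lt_min ltr01 divr_gt0.
have t01 : t0 ^+ 2 < th c0.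
  have h1 : t0 <= 1 by rewrite ge_min lexx.
  have h2 : t0 <= th c0 / 2 by rewrite ge_min lexx orbT.
  nra.
pose A := [set c | hdist (flow t0 z) (act c (flow t0 z)) <= mu /\ (c != 1%g /\ commute a c)].
have fA : finite_set A by apply: sub_finite_set (act_finite HA (flow t0 z) mu) => c [].
have Ac0 : A c0 by split => //; rewrite ltW// thE.
have [m [_ [m1 cam]] mP] := finite_argmax th fA Ac0.
have thm : 0 < th m := lt_le_trans th0 (mP _ Ac0).
have sq t : 0 < t -> (t < Num.sqrt (th m)) = (t ^+ 2 < th m).
  move=> t0'; have := sqr_sqrtr (ltW thm); have := sqrtr_ge0 (th m); set q := Num.sqrt _ => q0 qq.
  by rewrite -qq; apply/idP/idP => h; nra.
exists (Num.sqrt (th m)); split; first by rewrite sqrtr_gt0.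
move=> t tp; rewrite sq//; split; last by move=> h; exists m; rewrite thE.
move=> [c [c1 cac]]; rewrite thE// => tc; apply: (lt_le_trans tc).
have [tc0|ct0] := ltP (t0 ^+ 2) (th c); first by apply: mP; split => //; rewrite ltW// thE.
exact: le_trans ct0 (le_trans (ltW t01) (mP _ Ac0)).
Qed.

Lemma flow_close z s (e : R) : 0 < s -> 0 < e ->
  exists2 d : R, 0 < d & forall w t, hdist z w < d -> `|t - s| < d -> 0 < t /\ hdist (flow s z) (flow t w) < e.
Proof.
move=> s0 e0; have th0 : 0 < ch e - 1 by rewrite subr_gt0 -ch0 ch_lt.
set th := ch e - 1 in th0.
(* [k] bounds [kap z w - 1] and [n] the relative change of time; they are sized so that all error
   terms of [kap_flow_le] together stay below [th]. *)
pose k := Num.min 1 (th / (4 * (s ^+ 2 + 2) + 1)).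
have D0 : 0 < 4 * (s ^+ 2 + 2) + 1 by have := sqr_ge0 s; lra.
have k0 : 0 < k by rewrite lt_min ltr01 divr_gt0.
have k1 : k <= 1 by rewrite ge_min lexx.
have kD : k * (4 * (s ^+ 2 + 2) + 1) <= th.
  by rewrite -ler_pdivlMr// ge_min lexx orbT.
pose n := Num.min (1/2) (th / 4).
have n0 : 0 < n by rewrite lt_min !divr_gt0.
have n1 : n <= 1/2 by rewrite ge_min lexx.
have n2 : n <= th / 4 by rewrite ge_min lexx orbT.
have a0 : 0 <= arcosh (1 + k) by apply: arcosh_ge0; lra.
have ac : ch (arcosh (1 + k)) = 1 + k by apply: ch_arcosh; lra.
have a00 : 0 < arcosh (1 + k).
  by rewrite lt_neqAle a0 andbT; apply/eqP => h; move: ac; rewrite -h ch0; lra.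
exists (Num.min (arcosh (1 + k)) (n * s)); first by rewrite lt_min a00 mulr_gt0.
move=> w t; rewrite !lt_min => /andP[wk _] /andP[_ ts].
have {}wk : kap z w < 1 + k by rewrite -ac -hdist_lt_ch.
move: ts; rewrite ltr_norml => /andP[ts1 ts2].
have t2 : s <= 2 * t by nra.
have t0 : 0 < t by lra.
split => //; rewrite hdist_lt_ch ?ltW//.
apply: le_lt_trans (kap_flow_le nv z w s0 t0) _.
have -> : s / t + t / s = 2 + ((t - s) / s) ^+ 2 * (s / t) by field; rewrite !gt_eqF.
have x2 : ((t - s) / s) ^+ 2 <= n ^+ 2.
  rewrite -[_ ^+ 2]real_normK ?num_real// ler_sqr ?nnegrE ?normr_ge0 ?(ltW n0)//.
  by rewrite normrM normfV (gtr0_norm s0) ler_pdivrMr// ler_norml; apply/andP; split; lra.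
have y2 : s / t <= 2 by rewrite ler_pdivrMr//.
have y0 : 0 <= s / t by rewrite divr_ge0 ?ltW.
have xy : ((t - s) / s) ^+ 2 * (s / t) <= n.
  have := sqr_ge0 ((t - s) / s); move: x2 y2 y0; set x := _ ^+ 2; set y := s / t => x2 y2 y0 x0.
  have : x * y <= n ^+ 2 * 2 by apply: ler_pM.
  nra.
have xy0 : 0 <= ((t - s) / s) ^+ 2 * (s / t) by rewrite mulr_ge0 ?sqr_ge0.
move: xy xy0; set x := _ * (s / t) => xy xy0.
have kw := kap_ge1 z w; set q := kap z w in wk kw *.
have q0 : 0 <= q - 1 < k by apply/andP; split; lra.
have st : s * t <= 2 * s ^+ 2.
  have : t <= 2 * s by nra.
  nra.
have h1 : s * t * (q - 1) <= 2 * s ^+ 2 * k.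
  by case/andP: q0 => q0 qk; apply: ler_pM => //; rewrite ?mulr_ge0// ltW.
have h2 : (2 + x) * q <= (2 + x) * (1 + k) by rewrite ler_wpM2l; lra.
have h3 : x * k <= k by nra.
have : 2 * s ^+ 2 * k + (2 + x) * (1 + k) - 1 < 1 + th.
  have : x <= th / 4 by lra.
  nra.
rewrite /th; lra.
Qed.

Lemma exits_adjacent z s : exits z s -> adjacent a (flow s z).
Proof.
move=> [s0 hs]; apply: boundary_adjacent => //; first by rewrite hs// ltxx.
move=> e e0; have [d d0 hd] := flow_close z s0 e0.
pose t := s - Num.min d s / 2.
have m0 : 0 < Num.min d s by rewrite lt_min d0.
have md : Num.min d s <= d by rewrite ge_min lexx.
have zd : hdist z z < d by rewrite hdistxx.
have [|t0 h] := hd z t zd.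
  by rewrite /t addrAC subrr sub0r normrN gtr0_norm ?divr_gt0//; lra.
by exists (flow t z) => //; rewrite hs// /t; lra.
Qed.

Lemma flow_gap z s t : ~ axis z -> exits z s -> s < t ->
  exists2 e : R, 0 < e & forall y, hdist (flow t z) y < e -> ~ tube a y.
Proof.
move=> nz [s0 hs] st; apply: tube_gap => c c1 cac; have t0 := lt_trans s0 st.
have cp := shear_gt0 HA nv c1 cac nz.
have : ~ tube a (flow s z) by rewrite hs// ltxx.
move=> ns; have : ~~ (hdist (flow s z) (act c (flow s z)) < mu).
  by apply/negP => h; apply: ns; exists c.
rewrite short_flow// -leNgt => h.
rewrite ltNge hdist_le_ch ?(ltW mu0)// (displacement_flow HA a1 nv va)// -ltNge.
apply: le_lt_trans h _; rewrite ltrD2l ltr_pM2r//.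
by rewrite ltr_sqr ?nnegrE ?ltW.
Qed.

Lemma adjacent_exits y : adjacent a y -> ~ axis y /\ exits y 1.
Proof.
move=> [Xy hy]; have nty : ~ tube a y.
  by move=> [c [c1 _ hc]]; have := Xy c c1; rewrite leNgt hc.
have [z0 _ tz0] := hy 1 ltr01.
(* On the axis a commuting element attains its least displacement, so an element short somewhere
   would be short at [y]. *)
have ny : ~ axis y.
  move=> ay; apply: nty; have [c [c1 cac hc]] := tz0; exists c; split => //.
  have := short_flow y cac ltr01; have := short_flow z0 cac ltr01.
  rewrite !flow1// hc => /esym hz ->; rewrite (axis_shear HA a1 nv cac ay) mulr0 addr0.
  by have := shear_ge0 HA nv c z0; rewrite expr1n mul1r in hz; lra.
split=> //; have [s hs] := exits_exists ny (ex_intro _ z0 tz0).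
suff -> : 1 = s by [].
have s1 : s <= 1 by rewrite leNgt; apply/negP => /(hs.2 1 ltr01).2; rewrite flow1.
apply/eqP; rewrite eq_le s1 andbT leNgt; apply/negP => /(flow_gap ny hs)[e e0 he].
by have [z yz tz] := hy e e0; apply: (he z) => //; rewrite flow1.
Qed.

(** Just before [s] the flow line lies in the open tube, just after [s] it keeps away from it by
    [flow_gap]. Both persist for nearby [w] and trap its exit time. *)
Lemma exits_close z s (e : R) : ~ axis z -> exits z s -> 0 < e ->
  exists2 d : R, 0 < d & forall w, hdist z w < d ->
    exists2 t, exits w t & hdist (flow s z) (flow t w) < e.
Proof.
move=> nz zs e0; have [s0 hs] := zs.
have [d d0 hd] := flow_close z s0 e0.
pose m := Num.min d s / 2.
have m0 : 0 < m by rewrite divr_gt0// lt_min d0.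
have md : m < d.
  have : Num.min d s <= d by rewrite ge_min lexx.
  by rewrite /m; lra.
have ms : m < s.
  have : Num.min d s <= s by rewrite ge_min lexx orbT.
  by rewrite /m; lra.
have tm : tube a (flow (s - m) z) by rewrite hs; lra.
have [e1 e10 he1] := tube_open tm.
have sm0 : 0 < s - m by lra.
have sp0 : 0 < s + m by lra.
have [e2 e20 he2] : exists2 e2 : R, 0 < e2 & forall y, hdist (flow (s + m) z) y < e2 -> ~ tube a y.
  by apply: (flow_gap nz zs); lra.
have [d1 d10 hd1] := flow_close z sm0 e10.
have [d2 d20 hd2] := flow_close z sp0 e20.
exists (Num.min d (Num.min d1 d2)); first by rewrite !lt_min d0 d10 d20.
move=> w; rewrite !lt_min => /and3P[wd wd1 wd2].
have tw : tube a (flow (s - m) w).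
  by apply: he1; apply: (hd1 w (s - m) wd1 _).2; rewrite subrr normr0.
have ntw : ~ tube a (flow (s + m) w).
  by apply: he2; apply: (hd2 w (s + m) wd2 _).2; rewrite subrr normr0.
have nw : ~ axis w.
  move=> aw; apply: ntw; have [c [c1 cac hc]] := tw; exists c; split => //.
  move: hc; rewrite !short_flow// (axis_shear HA a1 nv cac aw); lra.
have [t ht] := exits_exists nw (ex_intro _ _ tw); exists t => //.
apply: (hd w t wd _).2; have [t0 ht'] := ht.
have h1 : s - m < t by rewrite -ht'.
have h2 : t <= s + m by rewrite leNgt; apply/negP => /(ht' _ sp0).2.
by rewrite ltr_norml; apply/andP; split; lra.
Qed.

End Exit.

(** The axis spans at most a plane, so it misses some point; the flow line of that point leaves the
    tube at a frontier point. *)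
Lemma adjacent_exists a z : a != 1%g -> tube a z -> exists y, adjacent a y.
Proof.
move=> a1 tz; have [v nv [r _ va]] := null_eigenvector HA a1.
suff [z' nz'] : exists z', ~ axis act a v z'.
  have [s hs] := exits_exists a1 nv va nz' (ex_intro _ z tz).
  by exists (flow v s z'); exact: (exits_adjacent a1 nv hs).
have [//|h] := pselect (exists z', ~ axis act a v z').
exfalso; have {}h z' : axis act a v z' by apply: contrapT => n; apply: h; exists z'.
have full : (1%:M <= v + W v (frame i0))%MS.
  apply/row_subP => i; rewrite (frame_decomposition (row i 1%:M)).
  by apply: summx_sub => j _; rewrite scalemx_sub// (axis_span HA a1 nv va).
have := mxrankS full; rewrite mxrank1.
have := mxrank_adds_leqif v (W v (frame i0)).
have := rank_leq_row v; have := rank_leq_row (W v (frame i0)).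
by move=> ? ? [? _]; lia.
Qed.

Section Label.
Variable lab : H3 R -> Prop.
Hypothesis lab_loc : forall x, thick x ->
  exists2 e : R, 0 < e & forall y, thick y -> hdist x y < e -> (lab y <-> lab x).

(* The points off the axis are connected and each of them is sent to the
   frontier of the tube by the flow, so the frontier is connected. *)
Lemma adjacent_label a y z : a != 1%g -> adjacent a y -> adjacent a z -> lab y -> lab z.
Proof.
move=> a1 ay az ly; have [v nv [r _ va]] := null_eigenvector HA a1.
have [ny ey] := adjacent_exits a1 nv va ay; have [nz ez] := adjacent_exits a1 nv va az.
pose P p := exists2 s, exits a v p s & lab (flow v s p).
have tex : exists w, tube a w by have [w _ tw] := ay.2 1 ltr01; exists w.
have [s es ls] : P z.
  apply: (off_axis_connect HA a1 nv va (P := P) _ ny nz); last by exists 1 => //; rewrite flow1.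
  move=> p np; have [s hs] := exits_exists a1 nv va np tex.
  have [e e0 he] := lab_loc (exits_adjacent a1 nv hs).1.
  have [d d0 hd] := exits_close a1 nv va np hs e0.
  exists d => // w /hd[t ht st].
  have {}he := he _ (exits_adjacent a1 nv ht).1 st.
  split=> -[u hu lu].
    by exists s => //; rewrite -he -(exits_unique hu ht).
  by exists t => //; rewrite he -(exits_unique hu hs).
by have := exits_unique es ez => s1; rewrite s1 flow1 in ls.
Qed.

(* Extension of [lab] over the thin part: a tube takes the label of its
   frontier. *)
Definition spread z := (thick z /\ lab z) \/
  (~ thick z /\ exists a, [/\ a != 1%g, hdist z (act a z) < mu & exists2 y, adjacent a y & lab y]).

Lemma short_not_thick a z : a != 1%g -> hdist z (act a z) < mu -> ~ thick z.
Proof. by move=> a1 h /(_ a a1); rewrite leNgt h. Qed.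

Lemma not_thickP z : ~ thick z -> exists2 a, a != 1%g & hdist z (act a z) < mu.
Proof.
move=> nz; apply: contrapT => h; apply: nz => a a1; rewrite leNgt; apply/negP => ha.
by apply: h; exists a.
Qed.

Lemma short_tube a z : a != 1%g -> hdist z (act a z) < mu -> tube a z.
Proof. by move=> a1 h; exists a. Qed.

Lemma adjacent_commute a b y : commute a b -> a != 1%g -> b != 1%g -> adjacent a y -> adjacent b y.
Proof.
move=> cab a1 b1 [Xy hy]; split=> // e /hy[z yz [c [c1 cac hc]]]; exists z => //.
exists c; split => //; exact: (commute_trans (act_kfree HA) b1 a1 c1 (commute_sym cab) cac).
Qed.

Lemma spread_thin a z y : a != 1%g -> hdist z (act a z) < mu -> adjacent a y -> (spread z <-> lab y).
Proof.
move=> a1 hz ay; split=> [[[Xz _]|[_ [b [b1 hb [y' by' ly']]]]]|ly].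
- by case: (short_not_thick a1 hz).
- have cba := mu_comm hb hz.
  exact: (adjacent_label a1 (adjacent_commute cba b1 a1 by') ay ly').
- by right; split; [exact: short_not_thick hz|exists a; split => //; exists y].
Qed.

(** Near a thin point the same short element decides the label. Near a thick [z], the chord from a
    thin [w] to [z] leaves the tube at a frontier point no farther from [z] than [w], where [lab]
    still has its value at [z]. *)
Lemma spread_loc z : loc_const_at spread z.
Proof.
have [Xz|nXz] := pselect (thick z); last first.
  have [a a1 ha] := not_thickP nXz; have [y ay] := adjacent_exists a1 (short_tube a1 ha).
  have [e e0 he] := short_open ha; exists e => // w /he hw.
  by rewrite (spread_thin a1 hw ay) (spread_thin a1 ha ay).
have sz w : thick w -> (spread w <-> lab w).
  by move=> Xw; split=> [[[]|[]]//|lw]; left.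
have [e e0 he] := lab_loc Xz; exists e => // w zw.
have [Xw|nXw] := pselect (thick w); first by rewrite !sz// he.
have [a a1 ha] := not_thickP nXw.
have ntz : ~ tube a z by move=> [c [c1 _ hc]]; exact: (short_not_thick c1 hc).
have [p [zp ntp hp]] := chord_boundary (short_tube a1 ha) ntz (@tube_open a).
have ap := boundary_adjacent a1 ntp hp.
rewrite (spread_thin a1 ha ap) sz//; apply: he; first exact: ap.1.
exact: le_lt_trans zp zw.
Qed.

Theorem thick_connected x y : thick x -> thick y -> lab x -> lab y.
Proof.
move=> Xx Xy lx; have [[_ //]|[]//] : spread y.
by apply: (chord_connect (z := x)) => [p _|]; [exact: spread_loc|left].
Qed.

Lemma thick_exists z a : a != 1%g -> exists x, thick x.
Proof.
move=> a1; have [Xz|/not_thickP[b b1 hb]] := pselect (thick z); first by exists z.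
by have [y [Xy _]] := adjacent_exists b1 (short_tube b1 hb); exists y.
Qed.

End Label.
End ThickPart.

(** * The relative neighbourhood graph *)

Section Midpoints.
Context {R : realType}.
Implicit Types (p q r s : H3 R).

Definition midpoint p q := of_J ((Num.sqrt (2 + 2 * kap p q))^-1 *: (J p + J q)).

Lemma J_midpoint p q : J (midpoint p q) = (Num.sqrt (2 + 2 * kap p q))^-1 *: (J p + J q).
Proof.
have k1 := kap_ge1 p q; have D0 : 0 < 2 + 2 * kap p q by lra.
apply: of_JK; apply: (@hyperboloid_intro _ _ p).
  rewrite mformZl mformZr mformDl !mformDr !mformJ !kapxx (kapC q p) mulrA -invfM -expr2.
  by rewrite sqr_sqrtr ?ltW//; field; rewrite gt_eqF.
rewrite mformZr mformDr !mformJ kapxx pmulr_rlt0 ?invr_gt0 ?sqrtr_gt0//; lra.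
Qed.

Lemma midpointC p q : midpoint p q = midpoint q p.
Proof. by rewrite /midpoint kapC (addrC (J p)). Qed.

Lemma midpoint_isometry g p q : preserves_dist g -> g (midpoint p q) = midpoint (g p) (g q).
Proof.
move=> hg; apply: J_inj; rewrite -(lin_J _ hg) !J_midpoint -scalemxAl mulmxDl !lin_J//.
by rewrite preserves_kap.
Qed.

(** Midpoints are normalized sums in the hyperboloid model; the product of the two normalizing roots
    is bounded by their mean square. *)
Lemma kap_midpoint_ge p q r s :
  (kap p r + kap p s + kap q r + kap q s) / (2 + kap p q + kap r s) <=
  kap (midpoint p q) (midpoint r s).
Proof.
have k1 := kap_ge1 p q; have k2 := kap_ge1 r s.
have := kap_ge1 p r; have := kap_ge1 p s; have := kap_ge1 q r; have := kap_ge1 q s.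
move=> h1 h2 h3 h4.
pose x := Num.sqrt (2 + 2 * kap p q); pose y := Num.sqrt (2 + 2 * kap r s).
have x0 : 0 < x by rewrite sqrtr_gt0; lra.
have y0 : 0 < y by rewrite sqrtr_gt0; lra.
have xx : x ^+ 2 = 2 + 2 * kap p q by rewrite sqr_sqrtr//; lra.
have yy : y ^+ 2 = 2 + 2 * kap r s by rewrite sqr_sqrtr//; lra.
have -> : kap (midpoint p q) (midpoint r s) = (kap p r + kap p s + kap q r + kap q s) / (x * y).
  apply: oppr_inj; rewrite -mformJ !J_midpoint mformZl mformZr mformDl !mformDr !mformJ -/x -/y.
  by field; rewrite !gt_eqF.
have xy : x * y <= 2 + kap p q + kap r s by have := sqr_ge0 (x - y); rewrite sqrrB; lra.
rewrite ler_pdivrMr; last by lra.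
rewrite mulrAC ler_pdivlMr ?mulr_gt0// ler_wpM2l//; lra.
Qed.

(** Two edges with a common end: the excess over [1] is [(k - 1) / (2 + x + y)], and the denominator
    is below 16/3. *)
Lemma near_ratio (x y k : R) : 1 <= x -> 1 <= y -> x < 5 / 3 -> y < 5 / 3 ->
  112 / 97 <= k -> 71 / 69 <= (1 + y + x + k) / (2 + x + y).
Proof. by move=> x1 y1 x2 y2 k1; rewrite ler_pdivlMr; lra. Qed.

(** Two edges without common end: the empty lunes let each edge be charged to cross distances.
    Adding the four inequalities gives [a + b + c + d] at least [x + y] plus twice 112/97. *)
Lemma far_ratio (a b c d x y : R) : 1 <= x -> 1 <= y -> x < 5 / 3 -> y < 5 / 3 ->
  112 / 97 <= a -> 112 / 97 <= b -> 112 / 97 <= c -> 112 / 97 <= d ->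
  x <= a \/ x <= c -> x <= b \/ x <= d -> y <= a \/ y <= b -> y <= c \/ y <= d ->
  71 / 69 <= (a + b + c + d) / (2 + x + y).
Proof.
move=> x1 y1 x2 y2 a1 b1 c1 d1 h1 h2 h3 h4; rewrite ler_pdivlMr; last by lra.
have e1 : x + 112 / 97 <= a + c by case: h1 => ?; lra.
have e2 : x + 112 / 97 <= b + d by case: h2 => ?; lra.
have e3 : y + 112 / 97 <= a + b by case: h3 => ?; lra.
have e4 : y + 112 / 97 <= c + d by case: h4 => ?; lra.
lra.
Qed.

(* [S] is separated by [kap >= c]; the edges [p q] and [r s] are those of its
   relative neighbourhood graph. *)
Lemma midpoints_apart (S : set (H3 R)) (c : R) p q r s : 112 / 97 <= c ->
  (forall z w, S z -> S w -> z <> w -> c <= kap z w) ->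
  S p -> S q -> S r -> S s -> p <> q -> r <> s ->
  kap p q < 5 / 3 -> kap r s < 5 / 3 ->
  (forall z, S z -> ~ (kap p z < kap p q /\ kap z q < kap p q)) ->
  (forall z, S z -> ~ (kap r z < kap r s /\ kap z s < kap r s)) ->
  (p = r /\ q = s) \/ (p = s /\ q = r) \/ 71 / 69 <= kap (midpoint p q) (midpoint r s).
Proof.
move=> c1 sep Sp Sq Sr Ss pq rs kpq krs npq nrs.
have adj x y z : S x -> S y -> S z -> y <> z -> kap x y < 5 / 3 -> kap x z < 5 / 3 ->
    71 / 69 <= kap (midpoint x y) (midpoint x z).
  move=> Sx Sy Sz yz kxy kxz; apply: le_trans (kap_midpoint_ge _ _ _ _).
  rewrite kapxx (kapC y x).
  by apply: near_ratio => //; [exact: kap_ge1|exact: kap_ge1|exact: le_trans c1 (sep _ _ _ _ _)].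
have [pr|pr] := pselect (p = r).
  have [qs|qs] := pselect (q = s); first by left.
  by right; right; rewrite -pr; apply: adj => //; rewrite pr.
have [ps|ps] := pselect (p = s).
  have [qr|qr] := pselect (q = r); first by right; left.
  by right; right; rewrite -ps (midpointC r); apply: adj => //; rewrite kapC ps.
have [qr|qr] := pselect (q = r).
  by right; right; rewrite -qr (midpointC p); apply: adj => //; rewrite ?qr// kapC -qr.
have [qs|qs] := pselect (q = s).
  right; right; rewrite -qs (midpointC p) (midpointC r); apply: adj => //; first by rewrite kapC.
  by rewrite kapC qs.
right; right; apply: le_trans (kap_midpoint_ge _ _ _ _).
have mx (x y z : R) : ~ (x < z /\ y < z) -> z <= x \/ z <= y.
  by move=> h; have [xz|zx] := leP z x; [left|right; rewrite leNgt; apply/negP => yz; apply: h].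
apply: far_ratio => //; [exact: kap_ge1|exact: kap_ge1|..].
- exact: le_trans c1 (sep _ _ _ _ pr).
- exact: le_trans c1 (sep _ _ _ _ ps).
- exact: le_trans c1 (sep _ _ _ _ qr).
- exact: le_trans c1 (sep _ _ _ _ qs).
- by rewrite (kapC q r); exact: mx (npq r Sr).
- by rewrite (kapC q s); exact: mx (npq s Ss).
- by rewrite (kapC p r); exact: mx (nrs p Sp).
- by rewrite (kapC q r); exact: mx (nrs q Sq).
Qed.

End Midpoints.

Section Families.

(** Used for the vertices, with [S] the thick part, and again for the orbits of edges; volume
    supplies the bound [N]. *)
Lemma maximal_family (T : Type) (S : set T) (near : T -> T -> Prop) (N : nat) :
  (forall x y, near x y -> near y x) ->
  (forall n (c : 'I_n -> T), (forall i, S (c i)) -> (forall i j, i != j -> ~ near (c i) (c j)) ->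
    (n <= N)%N) ->
  exists n (c : 'I_n -> T), [/\ forall i, S (c i), forall i j, i != j -> ~ near (c i) (c j) &
    forall x, S x -> exists i, near x (c i)].
Proof.
move=> sym bound.
pose P n := `[< exists c : 'I_n -> T, (forall i, S (c i)) /\ (forall i j, i != j -> ~ near (c i) (c j)) >].
have exP : exists n, P n.
  by exists 0%N; apply/asboolP; exists (fun i : 'I_0 => False_rect T (notF (ltn_ord i))); split; case.
have leP n : P n -> (n <= N)%N by move=> /asboolP[c [Sc nc]]; exact: (bound n c).
have [n /asboolP[c [Sc nc]] nmax] := ex_maxnP exP leP.
exists n, c; split => // x Sx; apply: contrapT => nx.
have {}nx i : ~ near x (c i) by move=> h; apply: nx; exists i.
suff /nmax : P n.+1 by rewrite ltnn.
apply/asboolP; exists (fun i => if unlift ord_max i is Some j then c j else x); split.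
  by move=> i; case: unliftP => [j _|_].
move=> i j; case: unliftP => [i' ->|->]; case: unliftP => [j' ->|->].
- by move=> ij; apply: nc; apply: contra ij => /eqP ->.
- by move=> _ /sym; exact: nx.
- by move=> _; exact: nx.
- by rewrite eqxx.
Qed.

End Families.

Section Constants.
Context {R : realType}.

(* [ch mu = 2 / sqrt 3 > 112 / 97], and
   [ch (2 * rho) < 71 / 69 < 1 + (3 / 16) (112 / 97 - 1)]. *)
Definition mu : R := ln 3 / 2.

Lemma mu_gt0 : 0 < mu. Proof. by apply: divr_gt0 => //; rewrite ln_gt0 ?ltr1n. Qed.

Lemma lt_mu (d : R) : (d < mu) = (expR (2 * d) < 3).
Proof.
rewrite -[in RHS](@lnK R 3) ?posrE// ltr_expR /mu ltr_pdivlMr//.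
by rewrite mulrC.
Qed.

Lemma ch_2mu : ch (2 * mu) = 5 / 3 :> R.
Proof.
have -> : 2 * mu = ln 3 :> R by rewrite /mu; field.
by rewrite /ch expRN lnK ?posrE//; field.
Qed.

Lemma ch_mu : 112 / 97 <= ch mu :> R.
Proof.
have := ch_2mu; rewrite mulr2n mulrDl !mul1r chD -!expr2 => h.
have := ch2 mu; have := ch_gt0 mu; nra.
Qed.

(** Chosen so that [expR (2 * rho)] is the rational number [(63 / 62) ^+ 15]; the hyperbolic
    functions of [2 * rho] are then rational. *)
Definition rho : R := 15 * ln (63 / 62) / 2.

Lemma rho_gt0 : 0 < rho.
Proof. by rewrite divr_gt0// mulr_gt0// ln_gt0//; lra. Qed.

Lemma expR_2rho : expR (2 * rho) = (63 / 62) ^+ 15.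
Proof.
have -> : 2 * rho = 15%:R * ln (63 / 62) :> R by rewrite /rho; field.
by rewrite expRM_natl lnK// posrE; lra.
Qed.

Lemma ch_2rho : ch (2 * rho) < 71 / 69 :> R.
Proof. rewrite /ch expRN expR_2rho -exprVn invf_div; lra. Qed.

Definition ball_bound : R := 25 / 9 * (sh (2 * rho) - 2 * rho).

(** The transcendental term [2 * rho] is [15 * ln (63 / 62)], bounded above by the rational
    [15 * sh (ln (63 / 62))] through [sh_gt]. *)
Lemma ball_bound_ge : 1 <= (157 + 497 / 1000) * ball_bound.
Proof.
have l0 : 0 < ln (63 / 62) :> R by rewrite ln_gt0//; lra.
have := sh_gt l0; rewrite /ball_bound /sh expRN [expR (- (2 * _))]expRN expR_2rho lnK ?posrE; last by lra.
have -> : 2 * rho = 15 * ln (63 / 62) :> R by rewrite /rho; field.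
rewrite -exprVn invf_div; set x := ln _; lra.
Qed.

End Constants.

Section Graph.
Context {R : realType} (G : groupType) (act : G -> H3 R -> H3 R).
Hypothesis HA : good_action act.
Variable V : \bar R.
Hypotheses (Vfin : (V < +oo)%E)
  (packing : forall A : set (H3 R), hmeasurable A ->
    (forall a p, A p -> A (act a p) -> act a p = p) -> (hvolume A <= V)%E).
Implicit Types (x y z : H3 R) (a b g : G).
Local Notation mu := (@mu R).
Local Notation rho := (@rho R).

Lemma mu2_ge0 : 0 <= 2 * mu. Proof. by rewrite mulr_ge0// ltW// mu_gt0. Qed.
Lemma rho2_ge0 : 0 <= 2 * rho. Proof. by rewrite mulr_ge0// ltW// rho_gt0. Qed.

Lemma short_commute a b z : hdist z (act a z) < mu -> hdist z (act b z) < mu -> commute a b.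
Proof. by rewrite !lt_mu; exact: short_elements_commute. Qed.

Lemma act_hdist a b x y : hdist (act a x) (act b y) = hdist x (act (a^-1 * b)%g y).
Proof. by rewrite -[RHS](act_dist HA a) -[act a (act _ y)]/((act a \o act _) y) -(actM HA) mulKVg. Qed.

Lemma act_kap a b x y : kap (act a x) (act b y) = kap x (act (a^-1 * b)%g y).
Proof. by apply/hdist_kap; exact: act_hdist. Qed.

Lemma thick_act g z : thick act mu z -> thick act mu (act g z).
Proof.
move=> hz a a1; rewrite -[act a (act g z)]/((act a \o act g) z) -(actM HA) act_hdist.
apply: hz; apply: contra a1 => /eqP e; apply/eqP.
by apply: (mulgI g^-1%g); apply: (mulIg g); rewrite -mulgA e mulg1 mulVg.
Qed.

(** The separation also covers [i = j] with [a != 1], so no two distinct points of the union of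
    balls are equivalent and [packing] applies to it. *)
Lemma orbit_packing n (c : 'I_n -> H3 R) (r : R) : 0 < r ->
  (forall i j a, i != j \/ a != 1%g -> 2 * r <= hdist (c i) (act a (c j))) ->
  ((n%:R * (25 / 9 * (sh (2 * r) - 2 * r)))%:E <= V)%E.
Proof.
move=> r0 sep; pose A := \bigcup_(i in [set: 'I_n]) hball (c i) r.
have mA : hmeasurable A.
  rewrite /hmeasurable /A image_bigcup; apply: fin_bigcup_measurable => [|i _]; first exact: finite_finset.
  exact: hmeasurable_hball.
apply: (@le_trans _ _ (hvolume A)).
  apply: (@hball_packing _ _ c) => //.
    by move=> i j ij; have := sep i j 1%g (or_introl ij); rewrite (act1 HA).
  by move=> i z zi; exists i.
apply: packing => // a p [i _ pi] [j _ pj].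
have [->|a1] := eqVneq a 1%g; first by rewrite (act1 HA).
have := sep j i a (or_intror a1); rewrite leNgt => /negP[].
apply: le_lt_trans (hdist_triangle (act a p) _ _) _; rewrite (act_dist HA) (hdistC p).
by move: pi pj; rewrite /hball /=; lra.
Qed.

Lemma packing_bound (w : R) : 0 < w -> exists N, forall n, ((n%:R * w)%:E <= V)%E -> (n <= N)%N.
Proof.
move=> w0; have [V0|V0] := leP 0%E V; last first.
  exists 0%N => n h; exfalso; have := le_lt_trans h V0; rewrite lte_fin ltNge => /negP[].
  by rewrite mulr_ge0// ltW.
have Vf : V = (fine V)%:E by rewrite fineK// ge0_fin_numE.
exists (Num.truncn (fine V / w)) => n; rewrite Vf lee_fin -ler_pdivlMr// => h.
by rewrite -ltnS -(ltr_nat R); apply: le_lt_trans h (truncnS_gt _).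
Qed.

Variables (n : nat) (c : 'I_n -> H3 R).
Hypotheses (c_thick : forall i, thick act mu (c i))
  (c_sep : forall i j, i != j -> ~ exists a, hdist (c i) (act a (c j)) < mu)
  (c_cover : forall z, thick act mu z -> exists i a, hdist z (act a (c i)) < mu).

Local Notation vertex := ('I_n * G)%type.
Implicit Types (p q r s : vertex).

(* The vertex [(i, a)] is the translate by [a] of the centre [c i]. *)
Definition pt p := act p.2 (c p.1).

Lemma pt_sep p q : p <> q -> mu <= hdist (pt p) (pt q).
Proof.
case: p q => [i a] [j b] ab; rewrite act_hdist /=; have [ij|ij] := eqVneq i j.
  rewrite ij; apply: c_thick; apply/eqP => e; apply: ab; rewrite ij; congr pair.
  by apply: (mulgI a^-1%g); rewrite e mulVg.
by rewrite leNgt; apply/negP => h; apply: (c_sep ij); exists (a^-1 * b)%g.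
Qed.

Lemma pt_inj : injective pt.
Proof.
move=> p q e; apply: contrapT => /pt_sep; rewrite e hdistxx leNgt mu_gt0 //.
Qed.

Lemma pt_kap z w : range pt z -> range pt w -> z <> w -> 112 / 97 <= kap z w.
Proof.
move=> [p _ <-] [q _ <-] pq; apply: le_trans (@ch_mu R) _.
by rewrite kapE (ch_leE (ltW (@mu_gt0 R)) (hdist_ge0 _ _)); apply: pt_sep => e; apply: pq; rewrite e.
Qed.

Definition edge p q := [/\ p <> q, kap (pt p) (pt q) < 5 / 3 &
  forall z, range pt z -> ~ (kap (pt p) z < kap (pt p) (pt q) /\ kap z (pt q) < kap (pt p) (pt q))].

Definition label p q : G := (p.2^-1 * q.2)%g.

Definition edge_group : set G := generated [set g | exists p q, edge p q /\ g = label p q].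

Local Notation H := edge_group.

Definition shift g p : vertex := (p.1, (g * p.2)%g).

Lemma pt_shift g p : pt (shift g p) = act g (pt p).
Proof. by rewrite /pt /= (actM HA). Qed.

Lemma label_shift g p q : label (shift g p) (shift g q) = label p q.
Proof. by rewrite /label /= invMg -mulgA mulKg. Qed.

(* By induction on the length: a pair which is not an edge is replaced by two
   shorter ones. *)
Lemma short_label p q : kap (pt p) (pt q) < 5 / 3 -> H (label p q).
Proof.
have sH : is_subgroup H := generated_subgroup _.
(* Up to translation a pair of vertices is a triple of two indices and a group element. Finitely
   many triples are short, so a counterexample of least length exists. *)
pose P (t : 'I_n * 'I_n * G) := kap (c t.1.1) (act t.2 (c t.1.2)) < 5 / 3.
suff h t : P t -> H t.2.
  by move=> pq; apply: (h ((p.1, q.1), label p q)); rewrite /P /= -act_kap.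
apply: contraPP => nH Pt.
pose B := [set t | P t /\ ~ H t.2].
have fP : finite_set [set t | P t].
  pose F (ij : 'I_n * 'I_n) := [set g | kap (c ij.1) (act g (c ij.2)) < 5 / 3].
  have fF ij : finite_set (F ij).
    apply: sub_finite_set (act_finite HA (c ij.2) (hdist (c ij.2) (c ij.1) + 2 * mu)) => g /=.
    rewrite /F /= -ch_2mu -(hdist_lt_ch _ _ mu2_ge0) => h.
    by have := hdist_triangle (c ij.1) (c ij.2) (act g (c ij.2)); lra.
  apply: (@sub_finite_set _ _ (\bigcup_(ij in [set: 'I_n * 'I_n]) (pair ij @` F ij))).
    by move=> [ij g] Pg; exists ij => //; exists g.
  by apply: bigcup_finite => [|ij _]; [exact: finite_finset|exact: finite_image].
have fB : finite_set B by apply: sub_finite_set fP => u [].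
have [[[i j] g] [Pij nHg] mn] := finite_argmax (fun t => - kap (c t.1.1) (act t.2 (c t.1.2))) fB (conj Pt nH).
pose p0 : vertex := (i, 1%g); pose q0 : vertex := (j, g).
have pq0 : kap (pt p0) (pt q0) = kap (c i) (act g (c j)) by rewrite /pt /= (act1 HA).
have lab0 : label p0 q0 = g by rewrite /label /= invg1 mul1g.
have lt u : P u -> kap (c u.1.1) (act u.2 (c u.1.2)) < kap (pt p0) (pt q0) -> H u.2.
  move=> Pt' tl; apply: contrapT => nt; have := mn u (conj Pt' nt).
  by rewrite lerN2 /= -pq0 leNgt tl.
apply: (nHg); rewrite /= -lab0; have [e|ne] := pselect (edge p0 q0).
  by apply: sub_generated; exists p0, q0.
have npq : p0 <> q0 by move=> e; apply: (nHg); rewrite /= -lab0 -e /label mulVg; exact: sH.1.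
have kpq : kap (pt p0) (pt q0) < 5 / 3 by rewrite pq0.
have [r [r1 r2]] : exists r, kap (pt p0) (pt r) < kap (pt p0) (pt q0) /\ kap (pt r) (pt q0) < kap (pt p0) (pt q0).
  apply: contrapT => h; apply: ne; split => // z [r _ <-] hr; by apply: h; exists r.
have -> : label p0 q0 = (label p0 r * label r q0)%g by rewrite /label mulgA mulgK.
apply: (is_subgroupM sH).
  apply: (lt (i, r.1, label p0 r)); rewrite /P /= -act_kap; last exact: r1.
  exact: lt_trans r1 kpq.
apply: (lt (r.1, j, label r q0)); rewrite /P /= -act_kap; last exact: r2.
exact: lt_trans r2 kpq.
Qed.

(* Moving in the thick part, consecutive nearest vertices are at distance less
   than [2 * mu], so the coset of [H] they determine does not change. *)
Lemma edge_group_full g : H g.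
Proof.
have sH : is_subgroup H := generated_subgroup _.
have [g1|g1] := eqVneq g 1%g; first by rewrite g1; exact: sH.1.
have [z0 tz0] := thick_exists HA (@mu_gt0 R) short_commute base_point g1.
have [i0 _] := c_cover tz0.
pose lab z := exists p, hdist z (pt p) < mu /\ H p.2.
have labE z p : hdist z (pt p) < mu -> (lab z <-> H p.2).
  move=> zp; split; last by exists p.
  move=> [q [zq Hq]].
  have -> : p.2 = (q.2 * label q p)%g by rewrite /label mulKVg.
  apply: (is_subgroupM sH) => //; apply: short_label; rewrite -ch_2mu -(hdist_lt_ch _ _ mu2_ge0).
  by apply: le_lt_trans (hdist_triangle z _ _) _; rewrite (hdistC _ z); lra.
have lab_loc x : thick act mu x -> exists2 e : R, 0 < e &
    forall y, thick act mu y -> hdist x y < e -> (lab y <-> lab x).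
  move=> /c_cover[i [a xp]]; exists (mu - hdist x (pt (i, a))); first by rewrite subr_gt0.
  move=> y _ xy; have yp : hdist y (pt (i, a)) < mu.
    by apply: le_lt_trans (hdist_triangle x _ _) _; rewrite (hdistC y); lra.
  have [x1 x2] := labE x (i, a) xp; have [y1 y2] := labE y (i, a) yp.
  by split=> [/y1/x2|/x1/y2].
have tp p : thick act mu (pt p) by apply: thick_act; exact: c_thick.
have pp p : hdist (pt p) (pt p) < mu by rewrite hdistxx mu_gt0.
have [lg _] := labE (pt (i0, g)) (i0, g) (pp _); apply: lg.
apply: (thick_connected HA (@mu_gt0 R) short_commute lab_loc (tp (i0, 1%g)) (tp (i0, g))).
by have [_] := labE (pt (i0, 1%g)) (i0, 1%g) (pp _); apply; exact: sH.1.
Qed.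

Definition mid (e : vertex * vertex) := midpoint (pt e.1) (pt e.2).

Lemma mid_near e e' g : edge e.1 e.2 -> edge e'.1 e'.2 -> hdist (mid e) (act g (mid e')) < 2 * rho ->
  (e.1 = shift g e'.1 /\ e.2 = shift g e'.2) \/ (e.1 = shift g e'.2 /\ e.2 = shift g e'.1).
Proof.
case: e e' => [p q] [r s] /= [pq kpq npq] [rs krs nrs].
rewrite /mid (midpoint_isometry _ _ (act_dist HA g)) -!pt_shift => h.
have krs' : kap (pt (shift g r)) (pt (shift g s)) = kap (pt r) (pt s).
  by rewrite !pt_shift preserves_kap//; exact: (act_dist HA).
have nrs' z : range pt z -> ~ (kap (pt (shift g r)) z < kap (pt (shift g r)) (pt (shift g s)) /\
    kap z (pt (shift g s)) < kap (pt (shift g r)) (pt (shift g s))).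
  move=> [u _ <-]; rewrite krs' !pt_shift => hu; apply: (nrs (pt (shift g^-1%g u))); first by exists (shift g^-1%g u).
  have e (x y : H3 R) : kap x (act g y) = kap (act g^-1%g x) y.
    rewrite -[x in LHS]/(idfun x) -(act1 HA) -(mulgV g) (actM HA) /=.
    by rewrite preserves_kap//; exact: (act_dist HA).
  by rewrite pt_shift kapC -e kapC -e.
have pr u : range pt (pt u) by exists u.
have pq' : pt p <> pt q by move=> /pt_inj.
have rs' : pt (shift g r) <> pt (shift g s).
  by move/pt_inj => -[e1 /mulgI e2]; apply: rs; case: r s e1 e2 {krs nrs h krs' nrs'} => [? ?] [? ?] /= -> ->.
have krs2 : kap (pt (shift g r)) (pt (shift g s)) < 5 / 3 by rewrite krs'.
have [[e1 e2]|[[e1 e2]|]] := midpoints_apart (lexx _) pt_kap (pr p) (pr q) (pr (shift g r))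
  (pr (shift g s)) pq' rs' kpq krs2 npq nrs'.
- by left; split; exact: pt_inj.
- by right; split; exact: pt_inj.
- move=> k; exfalso; move: h; rewrite (hdist_lt_ch _ _ rho2_ge0) => h.
  by have := lt_trans (le_lt_trans k h) (@ch_2rho R); rewrite ltxx.
Qed.

(** Otherwise [a] maps the edge to itself. Fixing an end gives [a = 1], and exchanging the ends
    gives [a ^+ 2 = 1], which torsion-freeness excludes. *)
Lemma mid_sep e a : edge e.1 e.2 -> a != 1%g -> 2 * rho <= hdist (mid e) (act a (mid e)).
Proof.
move=> ee a1; rewrite leNgt; apply/negP => /(mid_near ee ee)[[e1 _]|[e1 e2]]; move/eqP: a1; apply.
  by apply: (mulIg e.1.2); rewrite mul1g [in RHS]e1.
apply: (act_torsion HA (n := 2)) => //; apply: (mulIg e.1.2).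
by rewrite mul1g expgS expg1 -mulgA [in RHS]e1 /= [in RHS]e2.
Qed.

Lemma rank_bound : exists2 m, has_rank [set: G] m & ((m%:R * ball_bound)%:E <= V)%E.
Proof.
pose near (e e' : vertex * vertex) := exists g, hdist (mid e) (act g (mid e')) < 2 * rho.
have nearC e e' : near e e' -> near e' e.
  by move=> [g h]; exists g^-1%g; rewrite hdistC (actV HA).
have pk m (d : 'I_m -> vertex * vertex) : (forall i, edge (d i).1 (d i).2) ->
    (forall i j, i != j -> ~ near (d i) (d j)) -> ((m%:R * ball_bound)%:E <= V)%E.
  move=> ed nd; apply: (orbit_packing (c := fun i => mid (d i)) (@rho_gt0 R)) => i j a.
  have [->|ij _] := eqVneq i j; first by move=> [//|]; exact: mid_sep.
  by rewrite leNgt; apply/negP => h; apply: (nd i j ij); exists a.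
have b0 : 0 < @ball_bound R by have := @ball_bound_ge R; nra.
have [N hN] := packing_bound b0.
have [m [d [ed nd cd]]] := maximal_family (S := [set e | edge e.1 e.2]) nearC (fun m d ed nd => hN m (pk m d ed nd)).
pose X : {fset G} := [fset label (d i).1 (d i).2 | i in 'I_m]%fset.
have XG : generated [set` X] = [set: G].
  apply/seteqP; split=> // g _; have := edge_group_full g; apply.
  split; first exact: generated_subgroup.
  (* By maximality every edge is a translate of some [d i], possibly with its ends exchanged;
     translation keeps the label and exchange inverts it. *)
  move=> _ [p [q [epq ->]]]; have [i [a h]] := cd (p, q) epq.
  have Xi : generated [set` X] (label (d i).1 (d i).2).
    by apply: sub_generated => /=; apply/imfsetP; exists i.
  have [[/= -> ->]|[/= -> ->]] := mid_near (e := (p, q)) epq (ed i) h; rewrite label_shift//.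
  have -> : label (d i).2 (d i).1 = (label (d i).1 (d i).2)^-1%g by rewrite /label invMg invgK.
  exact: (is_subgroupV (generated_subgroup _) Xi).
have [k rk km] := rank_exists X; exists k; first by rewrite -XG.
apply: le_trans (pk m d ed nd); rewrite lee_fin ler_pM2r // ler_nat.
by apply: leq_trans km (leq_trans (leq_imfset_card _ _ _) _); rewrite -cardE card_ord.
Qed.

End Graph.

(** * From the action to the rank of the fundamental group *)

Section RankOfAction.
Context {R : realType} (G : groupType) (act : G -> H3 R -> H3 R).
Hypothesis HA : good_action act.
Variable V : \bar R.
Hypotheses (Vfin : (V < +oo)%E)
  (packing : forall A : set (H3 R), hmeasurable A ->
    (forall a p, A p -> A (act a p) -> act a p = p) -> (hvolume A <= V)%E).

Lemma rank_volume : exists2 m, has_rank [set: G] m & ((m%:R * @ball_bound R)%:E <= V)%E.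
Proof.
pose near (x y : H3 R) := exists a, hdist x (act a y) < @mu R.
have nearC x y : near x y -> near y x.
  by move=> [a h]; exists a^-1%g; rewrite hdistC (actV HA).
have m0 := @mu_gt0 R; have m2 : 0 < mu / 2 :> R by rewrite divr_gt0.
pose w : R := 25 / 9 * (sh (2 * (mu / 2)) - 2 * (mu / 2)).
have w0 : 0 < w by rewrite mulr_gt0// subr_gt0 sh_gt// mulr_gt0.
have [N hN] := packing_bound Vfin w0.
have bound n (c : 'I_n -> H3 R) : (forall i, thick act mu (c i)) ->
    (forall i j, i != j -> ~ near (c i) (c j)) -> (n <= N)%N.
  move=> tc nc; apply: hN; apply: (orbit_packing HA packing (c := c)) => // i j a.
  have -> : 2 * (mu / 2) = mu :> R by field.
  have [->|ij _] := eqVneq i j; first by move=> [//|]; exact: tc.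
  by rewrite leNgt; apply/negP => h; apply: (nc i j ij); exists a.
have [n [c [tc nc cc]]] := maximal_family (S := [set z | thick act mu z]) nearC bound.
exact: (rank_bound HA Vfin packing tc nc cc).
Qed.

End RankOfAction.

Section PiOneAction.
Context {R : realType} (M : hyperbolic_3_manifold R) (x : manifold_space M).
Hypothesis hfree : k_free (pi1 R x) 5.

Lemma pi1_good_action : exists2 act : pi1 R x -> H3 R -> H3 R, good_action act &
  forall g, deck M g -> exists a, act a = g.
Proof.
have [act [Mact actM act_inj act_surj]] := deck_action x; exists act => //.
have act1 : act 1%g = idfun.
  have [a a1] := act_surj _ (deck_id M); have := actM 1%g a.
  by rewrite mul1g a1.
have act_pow (a : pi1 R x) n : act (a ^+ n)%g =1 iter n (act a).
  by elim: n => [|n IH] z; rewrite ?act1// expgS actM /= IH.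
split=> //.
- by move=> a; exact: (deck_preserves_dist (Mact a)).
- move=> z r; apply: (finite_set_inj (deck_finite M z r) (f := act)) => [a ha|a b _ _]; last exact: act_inj.
  by split.
- by move=> a z az; apply: act_inj; rewrite act1; exact: (deck_free (Mact a) az).
- move=> a n n0 an; apply: act_inj; rewrite act1; apply: (deck_torsion_free (Mact a) n0) => z.
  by rewrite -act_pow an act1.
Qed.

End PiOneAction.

Theorem theorem7p6 (R : realType) (M : hyperbolic_3_manifold R) (x : manifold_space M)
    (hfin : (vol M < +oo)%E)
    (hor : orientable M)
    (hfree : k_free (pi1 R x) 5) :
  exists2 n : nat, has_rank [set: pi1 R x] n &
    (n%:R%:E < 1%:E + (157 + 497 / 1000)%R%:E * vol M)%E.
Proof.
have [act HA act_surj] := pi1_good_action hfree.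
have packing (A : set (H3 R)) : hmeasurable A ->
    (forall a p, A p -> A (act a p) -> act a p = p) -> (hvolume A <= vol M)%E.
  move=> mA injA; apply: ereal_sup_ubound; exists A => //; split => // p q Ap Aq.
  move=> /prP[g Mg gpq]; have [a ag] := act_surj g Mg.
  by rewrite -gpq -ag; apply/esym/injA; [exact: set_mem|rewrite ag gpq; exact: set_mem].
have [n rn nV] := rank_volume HA hfin packing; exists n => //.
have b1 := @ball_bound_ge R; have b0 : 0 < @ball_bound R by nra.
have V0 : (0 <= vol M)%E by apply: le_trans nV; rewrite lee_fin mulr_ge0// ltW.
have Vf : vol M = (fine (vol M))%:E by rewrite fineK// ge0_fin_numE.
move: nV; rewrite Vf -EFinM -EFinD lee_fin lte_fin => nV.
have n0 : 0 <= n%:R :> R by [].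
(* The packing gives [n] at most 157.497 times the volume; the summand [1] makes the inequality
   strict. *)
have : n%:R <= n%:R * ((157 + 497 / 1000) * @ball_bound R) by rewrite ler_peMr.
nra.
Qed.
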